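(* Let $\beta>0$ and $\gamma\ge0$ be arbitrary parameters and, for each $N$, let $\bar Y=(Y_1,\dots,Y_N)\in[0,1]^N$ be a random vector with density $$f_{\bar Y}(\bar y)=\frac1{Z_N}\exp\Big(-\sum_{i=1}^{N}\Big(\frac{\beta}{2y_i}+\frac{\gamma}{y_i+y_{i+1}}\Big)\Big),\qquad Z_N=\int_{[0,1]^N}\exp\Big(-\sum_{i=1}^{N}\Big(\frac{\beta}{2y_i}+\frac{\gamma}{y_i+y_{i+1}}\Big)\Big)d\bar y,$$ where indices are taken modulo $N$ (so $y_{N+1}=y_1$). Denote $$\sigma_N^2:=\frac1N\operatorname{Var}\Big(\sum_{i=1}^N\big(Y_i-\mathbb E(Y_i)\big)\Big),\qquad \zeta_N:=\frac{1}{\sqrt{N\sigma_N^2}}\sum_{i=1}^N\big(Y_i-\mathbb E(Y_i)\big).$$ Then for any $\epsilon\in(0,1/4)$, $$\sup_{z\in\mathbb R}\big|\mathbb P(\zeta_N\le z)-\mathbb P(Z\le z)\big|=\mathcal O\big(N^{-\frac14+\epsilon}\big)\qquad (N\to\infty),$$ where $Z$ is a standard normal random variable.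
   Context: The distribution of each $Y_i=Y_{i,N}$ depends on $N$; the parameters $\beta,\gamma$ are fixed as $N\to\infty$. The density is read as $0$ when some $y_i=0$. *)

(* Defs.v *)
From HB Require Import structures.
From mathcomp Require Import all_boot all_order all_algebra.
From mathcomp Require Import all_classical all_reals all_analysis.
Import Order.TTheory GRing.Theory Num.Theory.
Import numFieldNormedType.Exports.

Set Implicit Arguments.
Unset Strict Implicit.
Unset Printing Implicit Defensive.

Local Open Scope classical_set_scope.
Local Open Scope ring_scope.

Section cons_measure.
Context d (T : measurableType d) (R : realType) (n : nat).

Definition pair_cons (p : T * n.-tuple T) : n.+1.-tuple T :=
  [tuple of p.1 :: p.2].

Lemma measurable_pair_cons : measurable_fun [set: T * n.-tuple T] pair_cons.
Proof. exact: measurable_cons. Qed.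

Variable mu : {sigma_finite_measure set T -> \bar R}.
Variable nu : {sigma_finite_measure set (n.-tuple T) -> \bar R}.

Definition cons_measure : set (n.+1.-tuple T) -> \bar R :=
  pushforward (mu \x nu)%E pair_cons.

Let cons_measure0 : cons_measure set0 = 0%E.
Proof. by rewrite /cons_measure /pushforward preimage_set0 measure0. Qed.

Let cons_measure_ge0 A : (0 <= cons_measure A)%E.
Proof. by rewrite /cons_measure /pushforward; exact: integral_ge0. Qed.

Let cons_measure_sigma_additive : semi_sigma_additive cons_measure.
Proof.
exact: (@measure_semi_sigma_additive _ _ _
  (measure_function_pushforward__canonical__measure_function_Measure
     (mu \x nu)%E measurable_pair_cons)).
Qed.

HB.instance Definition _ := isMeasure.Build _ _ _ cons_measure
  cons_measure0 cons_measure_ge0 cons_measure_sigma_additive.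

Let sigma_finite_cons_measure : sigma_finite setT cons_measure.
Proof.
have /sigma_finiteP[F [TF ndF Foo]] := sigma_finiteT mu.
have /sigma_finiteP[G [TG ndG Goo]] := sigma_finiteT nu.
exists (fun k => [set t | F k (thead t) /\ G k [tuple of behead t]]).
  apply/seteqP; split=> // t _.
  have [i _ Fi] : (\bigcup_i F i) (thead t) by rewrite -TF.
  have [j _ Gj] : (\bigcup_i G i) [tuple of behead t] by rewrite -TG.
  exists (maxn i j) => //; split.
    by move: Fi; exact/subsetPset/ndF/leq_maxl.
  by move: Gj; exact/subsetPset/ndG/leq_maxr.
move=> k; have [mF ?] := Foo k; have [mG ?] := Goo k; split.
  apply: measurableI; rewrite -[X in measurable X]setTI.
    exact: measurable_tnth.
  exact: measurable_behead.
rewrite /cons_measure /pushforward (_ : _ @^-1` _ = F k `*` G k).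
  by rewrite product_measure1E// lte_mul_pinfty// ge0_fin_numE.
have beheadK (x : T) (t : n.-tuple T) : [tuple of behead [tuple of x :: t]] = t.
  exact: val_inj.
by apply/seteqP; split=> -[x t] /=; rewrite beheadK.
Qed.

HB.instance Definition _ := @Measure_isSigmaFinite.Build _ _ _ cons_measure
  sigma_finite_cons_measure.

End cons_measure.


Section tuple_measure.
Context d (T : measurableType d) (R : realType).
Variable mu : {sigma_finite_measure set T -> \bar R}.

Fixpoint tuple_measure n : {sigma_finite_measure set (n.-tuple T) -> \bar R} :=
  if n is n'.+1 then cons_measure mu (tuple_measure n') else \d_[tuple].

Lemma tuple_measure_box n (A : 'I_n -> set T) : (forall i, measurable (A i)) ->
  tuple_measure n [set t | forall i, A i (tnth t i)] = (\prod_(i < n) mu (A i))%E.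
Proof.
elim: n A => [|n IH] A mA.
  by rewrite big_ord0 /= diracE mem_set//; case.
rewrite big_ord_recl -IH => [|i]; last exact: mA.
rewrite [LHS]/= /cons_measure /pushforward -product_measure1E//.
  congr (_ _); apply/seteqP; split => -[x t] /=.
    move=> At; split; first exact: (At ord0).
    by move=> i; have := At (lift ord0 i); rewrite tnthS.
  by move=> [Ax At] i; case: (unliftP ord0 i) => [j|] ->; rewrite ?tnthS.
rewrite (_ : mkset _ = \bigcap_(i in [set: 'I_n]) (@tnth n T ^~ i) @^-1` A (lift ord0 i)).
  apply: fin_bigcap_measurable => // i _.
  by rewrite -[X in measurable X]setTI; exact: measurable_tnth.
by apply/seteqP; split => [t tA i _|t tA i]; [exact: tA|exact: tA].
Qed.

End tuple_measure.

Section gibbs.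
Variable R : realType.
Implicit Types (beta gamma : R) (n : nat).

(* measurableTypeR R is R with its Borel sigma-algebra, the domain of
   lebesgue_measure. *)
Definition lebesgue_tuple n :
    {sigma_finite_measure set (n.-tuple (measurableTypeR R)) -> \bar R} :=
  tuple_measure (@lebesgue_measure R) n.

Definition coord n (y : n.-tuple (measurableTypeR R)) (i : 'I_n) : R := tnth y i.

Definition unit_cube n : set (n.-tuple (measurableTypeR R)) :=
  [set y | forall i, 0 <= coord y i <= 1].

(* ordS is the cyclic successor on 'I_n. Since x / 0 = 0 in MathComp, the
   value 0 at points with a vanishing coordinate is imposed explicitly. *)
Definition gibbs_weight beta gamma n (y : n.-tuple (measurableTypeR R)) : R :=
  if [exists i, coord y i == 0] then 0
  else expR (- \sum_(i < n) (beta / (2 * coord y i)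
                             + gamma / (coord y i + coord y (ordS i)))).

Definition partition_function beta gamma n : R :=
  \int[lebesgue_tuple n]_(y in @unit_cube n) gibbs_weight beta gamma y.

Definition gibbs_density beta gamma n (y : n.-tuple (measurableTypeR R)) : R :=
  (partition_function beta gamma n)^-1 * gibbs_weight beta gamma y.

End gibbs.

Section random_vector.
Context d (T : measurableType d) (R : realType) (P : probability T R) (n : nat).
Variable Y : {RV P >-> n.-tuple (measurableTypeR R)}.

Definition has_density_on (D : set (n.-tuple (measurableTypeR R)))
    (f : n.-tuple (measurableTypeR R) -> R) :=
  forall A, measurable A ->
    P (Y @^-1` A) = (\int[lebesgue_tuple R n]_(y in A `&` D) (f y)%:E)%E.

Definition component (i : 'I_n) : T -> R := fun w => coord (Y w) i.

Definition centered_sum : T -> R :=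
  fun w => \sum_(i < n) (component i w - fine 'E_P[component i]).

Definition sigma2 : R := n%:R^-1 * fine 'V_P[centered_sum].

Definition zeta : T -> R :=
  fun w => (Num.sqrt (n%:R * sigma2))^-1 * centered_sum w.

End random_vector.

Definition standard_normal d (T : measurableType d) (R : realType)
    (P : probability T R) (Z : {RV P >-> R}) :=
  forall A, measurable A -> distribution P Z A = normal_prob 0 1 A.

(* sup_z |P(X <= z) - Q(Z <= z)| for real random variables X on (T, P) and
   Z on (T', Q). *)
Definition kolmogorov_distance d d' (T : measurableType d)
    (T' : measurableType d') (R : realType) (P : probability T R)
    (Q : probability T' R) (X : T -> R) (Z : T' -> R) : R :=
  sup [set `|fine (P [set w | X w <= z]) - fine (Q [set w | Z w <= z])|
      | z in [set: R]].

(* Main.v *)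
Require Import Defs.
From HB Require Import structures.
From mathcomp Require Import all_boot all_order all_algebra.
From mathcomp Require Import all_classical all_reals all_analysis.
From mathcomp Require Import measurable_realfun.
From mathcomp Require Import ring lra zify.
Import Order.TTheory GRing.Theory Num.Theory.
Import numFieldNormedType.Exports.

(** Stein's method for a weakly dependent ring. With h(x, y) the interaction
    between neighbours, the Gibbs weight is the product of the h(y_i, y_(i+1)).
    Whatever its two neighbours are, a site sees weights comparable, up to a
    factor K, to those obtained by pinning it to the value 1, as soon as its
    own value is at least 1/2. Pinning two sites cuts the ring into independent
    arcs, so integrating out two more sites on each side of a block contracts the
    oscillation of the conditional means by a fixed factor: correlations decay
    exponentially. The same comparison gives a linear lower bound for the
    variance, by testing the sum against the scores
    psi(y_i) w(y with y_i pinned) / w(y), which have conditional mean zero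
    given the other sites.

    Let f' - x f = g - E g(Z) be Stein's equation for g, a continuous ramp of
    slope 1/delta replacing the indicator of ]-oo, z]. Expanding E[W f(W)] around
    the sum of the coordinates at distance more than 2k from a given site bounds
    |E g(W) - E g(Z)| by C k^2 N^(-1/2) / delta. The ramp itself costs delta,
    hence delta = N^(-1/4), with k of order log N. *)

Set Implicit Arguments.
Unset Strict Implicit.
Unset Printing Implicit Defensive.

Local Open Scope classical_set_scope.
Local Open Scope ring_scope.

(** The obstacle is that [h] has no positive lower bound: exp(- beta / (2 y)) tends to 0 with y, so
    conditional densities admit no uniform minorisation. What survives is a comparison of the
    product of the two edges at one site: the factor that is singular in the left neighbour occurs
    on both sides and cancels. Replacing the site by the star costs a factor K at every value of the
    site; the reverse comparison holds only on [G]. That is enough, since a lower bound may be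
    restricted to the event that the site lies in [G], which has mass [theta]. Conditional
    expectations are never built by disintegration. The reference law is a product, so integrating a
    fresh copy of some coordinates gives them as functions defined at every point, and bounds on
    conditional means are stated with denominators cleared. The exponent 1/4 is a balance: with q =
    N^(1/4) and sigma of order q^2, the Taylor remainder N k^2 q / sigma^3 is of order k^2 / q and
    meets the smoothing cost 1 / q. All other errors are smaller, and the loss N^eps pays for
    k^2. *)

Section bmeas.
Context d (T : measurableType d) (R : realType).
Implicit Types f g : T -> R.

(** These functions form an algebra on which every probability measure integrates, so integrability
    never has to be tracked on its own. *)
Definition bmeas f := measurable_fun [set: T] f /\ exists M : R, forall x, `|f x| <= M.

Lemma bmeasW f M : measurable_fun [set: T] f -> (forall x, `|f x| <= M) -> bmeas f.
Proof. by move=> mf fM; split=> //; exists M. Qed.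

Lemma bmeas_cst (c : R) : bmeas (fun=> c).
Proof. by apply: (@bmeasW _ `|c|). Qed.

Lemma bmeasD f g : bmeas f -> bmeas g -> bmeas (fun x => f x + g x).
Proof.
move=> [mf [M fM]] [mg [K gK]]; apply: (@bmeasW _ (M + K)).
  exact: measurable_funD.
by move=> x; rewrite (le_trans (ler_normD _ _)) ?lerD.
Qed.

Lemma bmeasM f g : bmeas f -> bmeas g -> bmeas (fun x => f x * g x).
Proof.
move=> [mf [M fM]] [mg [K gK]]; apply: (@bmeasW _ (M * K)).
  exact: measurable_funM.
by move=> x; rewrite normrM ler_pM.
Qed.

Lemma bmeasZ c f : bmeas f -> bmeas (fun x => c * f x).
Proof. by apply: bmeasM; exact: bmeas_cst. Qed.

Lemma bmeasN f : bmeas f -> bmeas (fun x => - f x).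
Proof.
by move=> [mf [M fM]]; apply: (@bmeasW _ M) => [|x]; [exact: measurableT_comp|rewrite normrN].
Qed.

Lemma bmeasB f g : bmeas f -> bmeas g -> bmeas (fun x => f x - g x).
Proof. by move=> bf bg; apply: bmeasD => //; apply: bmeasN. Qed.

Lemma bmeas_norm f : bmeas f -> bmeas (fun x => `|f x|).
Proof.
move=> [mf [M fM]]; apply: (@bmeasW _ M) => [|x]; first exact: measurableT_comp.
by rewrite normr_id.
Qed.

Lemma bmeasX f n : bmeas f -> bmeas (fun x => f x ^+ n).
Proof.
move=> bf; elim: n => [|n IH]; first by under eq_fun do rewrite expr0; exact: bmeas_cst.
by under eq_fun do rewrite exprS; exact: bmeasM.
Qed.

Lemma bmeas_sum (I : Type) (r : seq I) (p : pred I) (F : I -> T -> R) :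
  (forall i, bmeas (F i)) -> bmeas (fun x => \sum_(i <- r | p i) F i x).
Proof.
move=> bF; elim: r => [|i r IH].
  by under eq_fun do rewrite big_nil; exact: bmeas_cst.
under eq_fun do rewrite big_cons; case: (p i) => //; exact: bmeasD.
Qed.

Lemma bmeas_prod (I : Type) (r : seq I) (p : pred I) (F : I -> T -> R) :
  (forall i, bmeas (F i)) -> bmeas (fun x => \prod_(i <- r | p i) F i x).
Proof.
move=> bF; elim: r => [|i r IH].
  by under eq_fun do rewrite big_nil; exact: bmeas_cst.
under eq_fun do rewrite big_cons; case: (p i) => //; exact: bmeasM.
Qed.

End bmeas.

Lemma bmeas_comp d d' (T : measurableType d) (T' : measurableType d')
    (R : realType) (f : T' -> R) (g : T -> T') :
  bmeas f -> measurable_fun [set: T] g -> bmeas (fun x => f (g x)).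
Proof.
move=> [mf [M fM]] mg; apply: (@bmeasW _ _ _ _ M) => //.
exact: (measurableT_comp mf mg).
Qed.

(** * Expectation of bounded measurable functions *)

Section mean.
Context d (T : measurableType d) (R : realType) (P : probability T R).
Implicit Types f g : T -> R.

Definition mean f : R := \int[P]_x f x.

Let massP : (P : {measure set T -> \bar R}) [set: T] = 1%E.
Proof. exact: probability_setT. Qed.

Lemma bmeas_integrable f : bmeas f -> P.-integrable [set: T] (EFin \o f).
Proof.
move=> [mf [M fM]]; apply: measurable_bounded_integrable => //.
  by rewrite massP ltry.
exists M; split; first by rewrite num_real.
by move=> y My x _; apply: le_trans (fM x) (ltW My).
Qed.

Lemma eq_mean f g : f =1 g -> mean f = mean g.
Proof. by move=> fg; apply: eq_Rintegral => x _. Qed.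

Lemma mean_cst c : mean (fun=> c) = c.
Proof. by rewrite /mean Rintegral_cst// massP mulr1. Qed.

Lemma meanD f g : bmeas f -> bmeas g -> mean (fun x => f x + g x) = mean f + mean g.
Proof. by move=> bf bg; apply: RintegralD => //; exact: bmeas_integrable. Qed.

Lemma meanB f g : bmeas f -> bmeas g -> mean (fun x => f x - g x) = mean f - mean g.
Proof. by move=> bf bg; apply: RintegralB => //; exact: bmeas_integrable. Qed.

Lemma meanZl c f : bmeas f -> mean (fun x => c * f x) = c * mean f.
Proof. by move=> bf; apply: RintegralZl => //; exact: bmeas_integrable. Qed.

Lemma meanZr c f : bmeas f -> mean (fun x => f x * c) = mean f * c.
Proof. by move=> bf; apply: RintegralZr => //; exact: bmeas_integrable. Qed.

Lemma mean_ge0 f : (forall x, 0 <= f x) -> 0 <= mean f.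
Proof. by move=> f0; apply: Rintegral_ge0. Qed.

Lemma le_mean f g : bmeas f -> bmeas g -> (forall x, f x <= g x) -> mean f <= mean g.
Proof.
by move=> bf bg fg; apply: le_Rintegral => //; exact: bmeas_integrable.
Qed.

Lemma mean_sum (I : Type) (r : seq I) (p : pred I) (F : I -> T -> R) :
  (forall i, bmeas (F i)) ->
  mean (fun x => \sum_(i <- r | p i) F i x) = \sum_(i <- r | p i) mean (F i).
Proof.
move=> bF; elim: r => [|i r IH].
  by under eq_mean do rewrite big_nil; rewrite mean_cst big_nil.
under eq_mean do rewrite big_cons; rewrite big_cons; case: (p i) => //.
by rewrite meanD ?IH//; exact: bmeas_sum.
Qed.

Lemma normr_mean f : bmeas f -> `|mean f| <= mean (fun x => `|f x|).
Proof. by move=> bf; apply: le_normr_Rintegral => //; exact: bmeas_integrable. Qed.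

Lemma normr_mean_le f M : bmeas f -> (forall x, `|f x| <= M) -> `|mean f| <= M.
Proof.
move=> bf fM; rewrite (le_trans (normr_mean bf))// -[leRHS]mean_cst.
by apply: le_mean => //; [exact: bmeas_norm|exact: bmeas_cst].
Qed.

Lemma mean_EFin f : bmeas f -> (\int[P]_x (f x)%:E)%E = (mean f)%:E.
Proof. by move=> bf; rewrite fineK//; exact: integrable_fin_num (bmeas_integrable bf). Qed.

Lemma mean_indic (A : set T) : measurable A -> mean (\1_A) = fine (P A).
Proof. by move=> mA; rewrite /mean /Rintegral integral_indic// setIT. Qed.

Lemma mean_gt0 f : bmeas f -> (forall x, 0 < f x) -> 0 < mean f.
Proof.
move=> bf f_gt0; rewrite lt_def mean_ge0 ?andbT => [|x]; last exact: ltW.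
apply/eqP => f0; have mf : measurable_fun [set: T] (EFin \o f).
  by apply/measurable_EFinP; case: bf.
have /(ae_eq_integral_abs P measurableT mf) [N [mN N0 fN]] :
    (\int[P]_x `|(EFin \o f) x| = 0)%E.
  rewrite -[RHS]/(0%:E) -f0 -mean_EFin//; apply: eq_integral => x _.
  by rewrite /= ger0_norm// ltW.
have : (P : {measure set T -> \bar R}) [set: T] = 0%E.
  rewrite -N0; congr (P _); apply/seteqP; split=> // x _; apply: fN => /(_ I) /= [].
  by move/eqP; rewrite gt_eqF.
by rewrite massP => /eqP; rewrite onee_eq0.
Qed.

Lemma mean_sqr_ge0 f : 0 <= mean (fun x => f x ^+ 2).
Proof. by apply: mean_ge0 => x; exact: sqr_ge0. Qed.

Lemma mean_cauchy_schwarz f g : bmeas f -> bmeas g ->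
  mean (fun x => f x * g x) ^+ 2 <= mean (fun x => f x ^+ 2) * mean (fun x => g x ^+ 2).
Proof.
move=> bf bg; set a := mean _; set b := mean _; set c := mean _.
have bf2 := bmeasX 2 bf; have bg2 := bmeasX 2 bg; have bfg := bmeasM bf bg.
have quad t : 0 <= b - 2 * t * a + t ^+ 2 * c.
  have -> : b - 2 * t * a + t ^+ 2 * c = mean (fun x => (f x - t * g x) ^+ 2).
    rewrite -[2 * t * a]meanZl// -[t ^+ 2 * c]meanZl// -meanB//; last exact: bmeasZ.
    rewrite -meanD//; [|by apply: bmeasB => //; exact: bmeasZ|exact: bmeasZ].
    by apply: eq_mean => x; ring.
  exact: mean_sqr_ge0.
have b0 : 0 <= b := mean_sqr_ge0 f.
have c0 : 0 <= c := mean_sqr_ge0 g.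
have [c_eq0|c_gt0] := eqVneq c 0; last first.
  have := quad (a / c); have cp : 0 < c by rewrite lt_def c_gt0.
  rewrite -(pmulr_rge0 _ cp).
  have -> : c * (b - 2 * (a / c) * a + (a / c) ^+ 2 * c) = b * c - a ^+ 2 by field.
  by rewrite subr_ge0.
have [->|a0] := eqVneq a 0; first by rewrite expr0n mulr_ge0.
(* With c = 0 the quadratic is affine in t, and this t gives it the value -1. *)
have := quad ((b + 1) / (2 * a)).
have -> : b - 2 * ((b + 1) / (2 * a)) * a + ((b + 1) / (2 * a)) ^+ 2 * c = - 1.
  by rewrite c_eq0; field.
by rewrite lerNr oppr0 ler10.
Qed.

Lemma mean_norm_le f : bmeas f ->
  mean (fun x => `|f x|) <= Num.sqrt (mean (fun x => f x ^+ 2)).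
Proof.
move=> bf; rewrite -ler_sqr ?nnegrE ?sqrtr_ge0//; last by apply: mean_ge0.
rewrite sqr_sqrtr ?mean_sqr_ge0//.
have := mean_cauchy_schwarz (bmeas_norm bf) (bmeas_cst T (1 : R)).
under eq_mean do rewrite mulr1; move=> /le_trans; apply.
by rewrite [X in _ * X](_ : _ = 1) ?mulr1;
  [under eq_mean do rewrite real_normK ?num_real//
  |under eq_mean do rewrite expr1n; rewrite mean_cst].
Qed.

End mean.

(** * Fubini for bounded functions *)

Section mean_fubini.
Context d1 d2 (T1 : measurableType d1) (T2 : measurableType d2) (R : realType).
Variables (P : probability T1 R) (Q : probability T2 R) (f : T1 * T2 -> R).
Hypothesis bf : bmeas f.

Let bfx x : bmeas (fun y => f (x, y)).
Proof. by apply: (bmeas_comp bf); exact: measurable_pair1. Qed.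

Let bfy y : bmeas (fun x => f (x, y)).
Proof. by apply: (bmeas_comp bf); exact: measurable_pair2. Qed.

Lemma bmeas_mean1 : bmeas (fun x => mean Q (fun y => f (x, y))).
Proof.
have [_ [M fM]] := bf; apply: (@bmeasW _ _ _ _ M); last first.
  by move=> x; apply: normr_mean_le.
apply: measurableT_comp => //.
exact: measurable_fubini_F (bmeas_integrable (P \x Q)%E bf).
Qed.

Lemma bmeas_mean2 : bmeas (fun y => mean P (fun x => f (x, y))).
Proof.
have [_ [M fM]] := bf; apply: (@bmeasW _ _ _ _ M); last first.
  by move=> x; apply: normr_mean_le.
apply: measurableT_comp => //.
exact: measurable_fubini_G (bmeas_integrable (P \x Q)%E bf).
Qed.

Lemma mean_prod1 :
  mean (P \x Q)%E f = mean P (fun x => mean Q (fun y => f (x, y))).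
Proof.
rewrite /mean {1}/Rintegral -integral12_prod_meas1; last exact: bmeas_integrable.
congr fine; apply: eq_integral => x _; rewrite /fubini_F /Rintegral fineK//.
exact: (integrable_fin_num measurableT (bmeas_integrable Q (bfx x))).
Qed.

Lemma mean_prod2 :
  mean (P \x Q)%E f = mean Q (fun y => mean P (fun x => f (x, y))).
Proof.
rewrite /mean {1}/Rintegral -integral21_prod_meas1; last exact: bmeas_integrable.
congr fine; apply: eq_integral => x _; rewrite /fubini_G /Rintegral fineK//.
exact: (integrable_fin_num measurableT (bmeas_integrable P (bfy x))).
Qed.

Lemma mean_swap : mean P (fun x => mean Q (fun y => f (x, y))) =
  mean Q (fun y => mean P (fun x => f (x, y))).
Proof. by rewrite -mean_prod1 mean_prod2. Qed.

End mean_fubini.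

(** * Exchanging coordinates between two tuples *)

Section mix.
Context (T : Type) (n : nat).
Implicit Types (B C : pred 'I_n) (y z : n.-tuple T).

(** When [z] is integrated against a product law and [y] is fixed, this yields the conditional
    expectation given the coordinates outside [B]. *)
Definition mix B z y : n.-tuple T := [tuple if B i then tnth z i else tnth y i | i < n].

Lemma tnth_mix B z y i : tnth (mix B z y) i = if B i then tnth z i else tnth y i.
Proof. by rewrite tnth_mktuple. Qed.

(** Pointwise form of measurability with respect to the coordinates in [B]; measurability itself is
    carried separately by [bmeas]. *)
Definition depends_only (S : Type) B (f : n.-tuple T -> S) :=
  forall y z, (forall i, B i -> tnth y i = tnth z i) -> f y = f z.

Lemma depends_only_mix (S : Type) B (f : n.-tuple T -> S) y z :
  depends_only B f -> f (mix B z y) = f z.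
Proof. by move=> fB; apply: fB => i Bi; rewrite tnth_mix Bi. Qed.

Lemma depends_only_mixC (S : Type) B (f : n.-tuple T -> S) y z :
  depends_only (predC B) f -> f (mix B z y) = f y.
Proof. by move=> fB; apply: fB => i; rewrite tnth_mix /= => /negbTE ->. Qed.

Lemma depends_onlyS (S : Type) B C (f : n.-tuple T -> S) :
  (forall i, B i -> C i) -> depends_only B f -> depends_only C f.
Proof. by move=> BC fB y z yz; apply: fB => i /BC; exact: yz. Qed.

Lemma depends_only_comp2 (S1 S2 S : Type) (op : S1 -> S2 -> S) B
    (f : n.-tuple T -> S1) (g : n.-tuple T -> S2) :
  depends_only B f -> depends_only B g -> depends_only B (fun y => op (f y) (g y)).
Proof. by move=> fB gB y z yz; rewrite (fB y z)// (gB y z). Qed.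

End mix.

Lemma tnth_pair_consS d (T : measurableType d) n (x : T) (t : n.-tuple T) (j : 'I_n) :
  tnth (pair_cons (x, t)) (lift ord0 j) = tnth t j.
Proof. by rewrite tnthS. Qed.

Lemma mix_pair_cons d (T : measurableType d) n (B : pred 'I_n.+1) (x z : T)
    (s t : n.-tuple T) :
  mix B (pair_cons (z, t)) (pair_cons (x, s)) =
  pair_cons (if B ord0 then z else x, mix (fun i => B (lift ord0 i)) t s).
Proof.
apply: eq_from_tnth => i; rewrite tnth_mix.
case: (unliftP ord0 i) => [j|] ->; rewrite ?tnthS ?tnth_mix//=.
Qed.

(** * Finite powers of a probability measure *)

Section tuple_prob.
Context d (X : measurableType d) (R : realType) (mu : probability X R).

Definition tuple_prob n : set (n.-tuple X) -> \bar R := tuple_measure mu n.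
Arguments tuple_prob : clear implicits.

HB.instance Definition _ n := Measure.on (tuple_prob n).

Let tuple_prob_setT n : tuple_prob n [set: n.-tuple X] = 1%E.
Proof.
have := tuple_measure_box mu (fun i : 'I_n => @measurableT _ X).
rewrite big1; last by move=> i _; exact: probability_setT.
by move=> <-; congr (tuple_prob _ _); apply/seteqP; split.
Qed.

HB.instance Definition _ n := @Measure_isProbability.Build _ _ _ (tuple_prob n)
  (tuple_prob_setT n).

Lemma mean_tuple0 (F : 0.-tuple X -> R) y : bmeas F -> mean (tuple_prob 0) F = F y.
Proof.
move=> [mF _]; rewrite /mean /Rintegral (_ : integral _ _ _ = (F y)%:E)//.
rewrite [LHS](integral_dirac [tuple] measurableT (f := EFin \o F)) ?diracT ?mul1e//.
  by rewrite [y]tuple0.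
exact/measurable_EFinP.
Qed.

Lemma mean_tupleS n (F : n.+1.-tuple X -> R) : bmeas F ->
  mean (tuple_prob n.+1) F =
  mean mu (fun x => mean (tuple_prob n) (fun t => F (pair_cons (x, t)))).
Proof.
move=> bF; have bF' := bmeas_comp bF (@measurable_pair_cons _ _ _).
rewrite -(@mean_prod1 _ _ _ _ _ mu (tuple_prob n) (fun p => F (pair_cons p)))//.
rewrite /mean /Rintegral; congr fine.
rewrite [LHS](@integral_pushforward _ _ _ _ _ (@pair_cons _ _ n) _
  (mu \x tuple_measure mu n)%E setT (EFin \o F))//.
- exact: measurable_pair_cons.
- by apply/measurable_EFinP; case: bF.
- by rewrite preimage_setT; exact: (bmeas_integrable (mu \x tuple_prob n)%E).
Qed.

Lemma measurable_mix n (B : pred 'I_n) :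
  measurable_fun [set: n.-tuple X * n.-tuple X] (fun p => mix B p.1 p.2).
Proof.
apply/measurable_fun_tnthP => i.
rewrite (_ : _ \o _ = fun p => if B i then tnth p.1 i else tnth p.2 i); last first.
  by apply/funext => p; rewrite /= tnth_mix.
by case: (B i); apply: (measurableT_comp (@measurable_tnth _ _ n i)).
Qed.

Lemma bmeas_mix n (B : pred 'I_n) (F : n.-tuple X -> R) : bmeas F ->
  bmeas (fun p : n.-tuple X * n.-tuple X => F (mix B p.1 p.2)).
Proof. by move=> bF; apply: (bmeas_comp bF); exact: measurable_mix. Qed.

(** A tuple in which some coordinates are replaced by those of an independent copy has the same law.
    This single identity yields independence, the tower rule and invariance under resampling. *)
Lemma mean_mix n (B : pred 'I_n) (F : n.-tuple X -> R) : bmeas F ->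
  mean (tuple_prob n) (fun y => mean (tuple_prob n) (fun z => F (mix B z y))) =
  mean (tuple_prob n) F.
Proof.
elim: n B F => [|n IH] B F bF.
  rewrite [RHS](mean_tuple0 [tuple])// -[RHS](mean_cst (tuple_prob 0)).
  apply: eq_mean => y; rewrite -[RHS](mean_cst (tuple_prob 0)).
  by apply: eq_mean => z; rewrite [mix _ _ _]tuple0.
pose B' i := B (lift ord0 i).
have bFm := bmeas_mix B bF.
have bFy y : bmeas (fun z => F (mix B z y)).
  exact: (bmeas_comp bFm (measurable_pair2 y)).
rewrite !mean_tupleS//; last exact: (bmeas_mean2 (tuple_prob n.+1) (tuple_prob n.+1) bFm).
transitivity (mean mu (fun x => mean mu (fun z => mean (tuple_prob n) (fun t =>
    F (pair_cons (if B ord0 then z else x, t)))))); last first.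
  by case: (B ord0); [exact: mean_cst|apply: eq_mean => x; exact: mean_cst].
apply: eq_mean => x.
under eq_mean => t do rewrite mean_tupleS//.
have bG : bmeas (fun p : (n.-tuple X * X) * n.-tuple X =>
    F (mix B (pair_cons (p.1.2, p.2)) (pair_cons (x, p.1.1)))).
  apply: (bmeas_comp (g := fun p : (n.-tuple X * X) * n.-tuple X =>
    (pair_cons (p.1.2, p.2), pair_cons (x, p.1.1))) bFm); apply: measurable_fun_pair.
    apply: measurableT_comp; first exact: measurable_pair_cons.
    apply: measurable_fun_pair => //; exact: measurableT_comp.
  apply: measurableT_comp; first exact: measurable_pair_cons.
  by apply: measurable_fun_pair => //; exact: measurableT_comp.
(* The head of the new tuple has to move outside the tail of the old one, so that the two tails
   become adjacent and the induction hypothesis applies. *)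
rewrite (mean_swap _ _ (f := fun p : n.-tuple X * X => mean (tuple_prob n) (fun z =>
   F (mix B (pair_cons (p.2, z)) (pair_cons (x, p.1)))))); last first.
  exact: (bmeas_mean1 (tuple_prob n \x mu)%E (tuple_prob n) bG).
have bH u : bmeas (fun t => F (pair_cons (u, t))).
  apply: (bmeas_comp bF); apply: measurableT_comp (measurable_pair1 u).
  exact: measurable_pair_cons.
apply: eq_mean => x'.
under eq_mean => t do under eq_mean => z do rewrite mix_pair_cons.
exact: (IH B' (fun t => F (pair_cons (if B ord0 then x' else x, t)))).
Qed.

(** After mixing along [B], F reads only the fresh copy and G only the original tuple. *)
Lemma mean_indep n (B : pred 'I_n) (F G : n.-tuple X -> R) : bmeas F -> bmeas G ->
  depends_only B F -> depends_only (predC B) G ->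
  mean (tuple_prob n) (fun y => F y * G y) =
  mean (tuple_prob n) F * mean (tuple_prob n) G.
Proof.
move=> bF bG FB GB; rewrite -(mean_mix B); last exact: bmeasM.
rewrite mulrC -meanZr//; apply: eq_mean => y; rewrite mulrC -meanZr//.
by apply: eq_mean => z; rewrite depends_only_mix// depends_only_mixC.
Qed.

Lemma mean_tnth n (i : 'I_n) (f : X -> R) : bmeas f ->
  mean (tuple_prob n) (fun y => f (tnth y i)) = mean mu f.
Proof.
move=> bf; elim: n i => [[]//|n IH] i.
rewrite mean_tupleS; last exact: (bmeas_comp bf (measurable_tnth _)).
case: (unliftP ord0 i) => [j|] ->.
  rewrite -[RHS](mean_cst mu); apply: eq_mean => x.
  by rewrite -(IH j); apply: eq_mean => t; rewrite tnthS.
by apply: eq_mean => x; rewrite -[RHS](mean_cst (tuple_prob n)); apply: eq_mean => t.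
Qed.

End tuple_prob.
Arguments tuple_prob {d X R} mu n _.

(* Unfolding [mean] makes unification explore the construction of the integral. *)
Opaque mean.

Lemma ordS_neq n (p : 'I_n) : (1 < n)%N -> ordS p != p.
Proof.
move=> n_gt1; apply/eqP => /(congr1 val) /= pE; have pn := ltn_ord p.
have [pn'|pn'] := ltnP p.+1 n.
  by move: pE; rewrite modn_small//; lia.
have pE' : p.+1 = n by lia.
by move: pE; rewrite pE' modnn; lia.
Qed.

Lemma ord_pred_neq n (p : 'I_n) : (1 < n)%N -> ord_pred p != p.
Proof.
move=> n_gt1; apply/eqP => pE; have := ordS_neq (ord_pred p) n_gt1.
by rewrite ord_predK pE eqxx.
Qed.

(** * Resampling as conditional expectation *)

Section resampling.
Context d (X : measurableType d) (R : realType) (mu : probability X R) (n : nat).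
Local Notation T := (n.-tuple X).
Local Notation I := (mean (tuple_prob mu n)).
Implicit Types (B C : pred 'I_n) (F G : T -> R) (y z u : T).

(** Conditional expectation of F given the coordinates outside [B], under the product law and not
    under the Gibbs law; the weight is put into F when needed. *)
Definition resample B F y : R := I (fun u => F (mix B u y)).

Lemma bmeas_mixl B F y : bmeas F -> bmeas (fun u => F (mix B u y)).
Proof. by move=> bF; exact: (bmeas_comp (bmeas_mix B bF) (measurable_pair2 y)). Qed.

Lemma bmeas_mixr B F u : bmeas F -> bmeas (fun y => F (mix B u y)).
Proof. by move=> bF; exact: (bmeas_comp (bmeas_mix B bF) (measurable_pair1 u)). Qed.

Lemma bmeas_resample B F : bmeas F -> bmeas (resample B F).
Proof.
by move=> bF; exact: (bmeas_mean2 (tuple_prob mu n) (tuple_prob mu n) (bmeas_mix B bF)).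
Qed.

Lemma mean_resample B F : bmeas F -> I (resample B F) = I F.
Proof. by move=> bF; exact: mean_mix. Qed.

Lemma resampleD B F G y : bmeas F -> bmeas G ->
  resample B (fun y => F y + G y) y = resample B F y + resample B G y.
Proof. by move=> bF bG; rewrite /resample meanD//; exact: bmeas_mixl. Qed.

Lemma resampleZ B F c y : bmeas F ->
  resample B (fun y => c * F y) y = c * resample B F y.
Proof. by move=> bF; rewrite /resample meanZl//; exact: bmeas_mixl. Qed.

Lemma resample_ge0 B F y : (forall y, 0 <= F y) -> 0 <= resample B F y.
Proof. by move=> F0; apply: mean_ge0. Qed.

Lemma resample_out B F G y : bmeas F -> depends_only (predC B) G ->
  resample B (fun y => F y * G y) y = resample B F y * G y.
Proof.
move=> bF GB; rewrite /resample -meanZr; last exact: bmeas_mixl.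
by apply: eq_mean => u; rewrite (depends_only_mixC _ _ GB).
Qed.

(** Tower rule. The inner resampling overwrites the outer one on [B], so [B] and [C] may overlap. *)
Lemma resample_comp B C B' F y : bmeas F -> (forall i, B' i = B i || C i) ->
  resample B' F y = I (fun u => resample B F (mix C u y)).
Proof.
move=> bF B'E; rewrite {1}/resample -(mean_mix mu B); last exact: bmeas_mixl.
apply: eq_mean => u; apply: eq_mean => v; congr F; apply: eq_from_tnth => i.
by rewrite !tnth_mix B'E; case: (B i).
Qed.

End resampling.

(** * Ring weights and the contraction of conditional means *)

Section ring_weight.
Context d (X : measurableType d) (R : realType) (mu : probability X R).
Variables (h : X -> X -> R) (star : X) (G : set X) (K : R).
Hypothesis mh : measurable_fun setT (fun p => h p.1 p.2).
Hypothesis h_gt0 : forall x y, 0 < h x y.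
Hypothesis h_le1 : forall x y, h x y <= 1.
Hypothesis mG : measurable G.
Hypothesis K_gt0 : 0 < K.
Hypothesis h_star_ub : forall x t z, h x t * h t z <= K * (h x star * h star z).
Hypothesis h_star_lb : forall x t z, G t -> h x star * h star z <= K * (h x t * h t z).
Variable n : nat.
Hypothesis n_gt1 : (1 < n)%N.
Local Notation T := (n.-tuple X).
Local Notation I := (mean (tuple_prob mu n)).
Local Notation J := (resample mu).
Implicit Types (B C : pred 'I_n) (f : T -> R) (y z u : T) (p q i : 'I_n).

Definition edge y i : R := h (tnth y i) (tnth y (ordS i)).
Definition ring_weight y : R := \prod_(i < n) edge y i.
Local Notation w := ring_weight.
Definition stars : T := [tuple star | _ < n].
Local Notation pin p := (mix (pred1 p) stars).

Definition theta : R := mean mu (\1_G).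
(** One round pins two sites, and compares both a numerator and a denominator with their pinned
    versions: K^2 for each. Both sites lie in [G] with probability theta^2, and the 2 is there
    because only one of f - a and b - f is sure to carry half of the gap. *)
Definition contraction_ratio : R := 1 - theta ^+ 2 / (2 * K ^+ 4).

Lemma bmeas_indicG : bmeas (\1_G : X -> R).
Proof.
apply: (@bmeasW _ _ _ _ 1); first exact: measurable_indic.
by move=> x; rewrite indicE; case: (_ \in _); rewrite ?normr1 ?normr0.
Qed.

Lemma theta_ge0 : 0 <= theta.
Proof. by apply: mean_ge0 => x; rewrite indicE. Qed.

Lemma theta_le1 : theta <= 1.
Proof.
rewrite -[leRHS](mean_cst mu); apply: le_mean; [exact: bmeas_indicG|exact: bmeas_cst|].
by move=> x; rewrite indicE; case: (_ \in _).
Qed.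

Lemma K_ge1 : 1 <= K.
Proof.
by have := h_star_ub star star star; rewrite ler_pMl ?mulr_gt0.
Qed.

Lemma contraction_ratio_ge0 : 0 <= contraction_ratio.
Proof.
have K41 : 1 <= K ^+ 4 by rewrite exprn_ege1 ?K_ge1.
rewrite subr_ge0 ler_pdivrMr ?mul1r; last by rewrite mulr_gt0// exprn_gt0.
apply: (@le_trans _ _ 1); first by rewrite exprn_ile1 ?theta_ge0 ?theta_le1.
by lra.
Qed.

Lemma edge_gt0 y i : 0 < edge y i. Proof. exact: h_gt0. Qed.

Lemma edge_prod_gt0 (P : pred 'I_n) y : 0 < \prod_(i < n | P i) edge y i.
Proof. by apply: prodr_gt0 => i _; exact: edge_gt0. Qed.

Lemma bmeas_edge i : bmeas (fun y : T => edge y i).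
Proof.
apply: (@bmeasW _ _ _ _ 1); last by move=> y; rewrite gtr0_norm ?edge_gt0 ?h_le1.
have : measurable_fun [set: T] (fun y : T => (tnth y i, tnth y (ordS i))).
  by apply: measurable_fun_pair; exact: measurable_tnth.
by move=> /(measurableT_comp mh).
Qed.

Lemma bmeas_edge_prod (P : pred 'I_n) : bmeas (fun y : T => \prod_(i < n | P i) edge y i).
Proof. by apply: bmeas_prod => i; exact: bmeas_edge. Qed.

Lemma bmeas_ring_weight : bmeas (w : T -> R).
Proof. exact: bmeas_edge_prod. Qed.
Hint Resolve bmeas_ring_weight : core.

Lemma ring_weight_gt0 y : 0 < w y. Proof. exact: edge_prod_gt0. Qed.

Lemma depends_only_edge_prod (P B : pred 'I_n) :
  (forall i, P i -> B i && B (ordS i)) ->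
  depends_only B (fun y => \prod_(i < n | P i) edge y i).
Proof.
move=> PB y z yz; apply: eq_bigr => i /PB /andP[Bi BSi].
by rewrite /edge !yz.
Qed.


Definition site_weight p y : R :=
  h (tnth y (ord_pred p)) (tnth y p) * h (tnth y p) (tnth y (ordS p)).
Definition site_rest p y : R :=
  \prod_(i < n | (i != p) && (ordS i != p)) edge y i.

Lemma ring_weightE p y : w y = site_weight p y * site_rest p y.
Proof.
(* Here [n_gt1] matters: the edges starting at [p] and at its predecessor are then distinct. *)
rewrite /ring_weight (bigD1 p)//= (bigD1 (ord_pred p))/=; last first.
  by apply/eqP => pE; have := ordS_neq (ord_pred p) n_gt1; rewrite ord_predK pE eqxx.
rewrite /site_weight /edge ord_predK mulrA [h (tnth y p) _ * _]mulrC; congr (_ * _).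
by apply: eq_bigl => i; rewrite (can2_eq (@ordSK n) (@ord_predK n)).
Qed.

Lemma site_rest_gt0 p y : 0 < site_rest p y. Proof. exact: edge_prod_gt0. Qed.

Lemma bmeas_site_rest p : bmeas (site_rest p : T -> R).
Proof. exact: bmeas_edge_prod. Qed.
Hint Resolve bmeas_site_rest : core.

Lemma depends_only_site_rest p : depends_only (predC (pred1 p)) (site_rest p).
Proof. by apply: depends_only_edge_prod => i /andP[/= -> ->]. Qed.

Lemma tnth_pin p y i : tnth (pin p y) i = if i == p then star else tnth y i.
Proof. by rewrite tnth_mix /= tnth_mktuple. Qed.


Lemma site_weight_pin p y : site_weight p (pin p y) =
  h (tnth y (ord_pred p)) star * h star (tnth y (ordS p)).
Proof.
by rewrite /site_weight !tnth_pin eqxx (negbTE (ordS_neq p n_gt1)) (negbTE (ord_pred_neq p n_gt1)).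
Qed.

Lemma site_weight_le p y : site_weight p y <= K * site_weight p (pin p y).
Proof. by rewrite site_weight_pin; exact: h_star_ub. Qed.

Lemma site_weight_ge p y : G (tnth y p) -> site_weight p (pin p y) <= K * site_weight p y.
Proof. by rewrite site_weight_pin; exact: h_star_lb. Qed.

Lemma site_weight_gt0 p y : 0 < site_weight p y.
Proof. by rewrite mulr_gt0. Qed.

Section isolated_site.
Variables (B : pred 'I_n) (p : 'I_n) (f : T -> R).
Hypothesis pB : [&& ~~ B p, ~~ B (ordS p) & ~~ B (ord_pred p)].
Hypothesis bf : bmeas f.
Hypothesis fB : depends_only B f.

Let D := J B (fun y => f y * w y).

Lemma resample_siteE y : D y = J B (fun y => f y * site_rest p y) y * site_weight p y.
Proof.
case/and3P: pB => Bp BSp BPp; rewrite -resample_out; last 2 first.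
- exact: (bmeasM bf (bmeas_site_rest p)).
- by move=> u v uv; rewrite /site_weight !uv.
by apply: eq_mean => u; rewrite (ring_weightE p); ring.
Qed.

Lemma resample_site_pin y :
  J B (fun y => f y * site_rest p y) (pin p y) = J B (fun y => f y * site_rest p y) y.
Proof.
case/and3P: pB => Bp _ _; apply: eq_mean => u; rewrite !(depends_only_mix _ _ fB).
congr (_ * _); apply: depends_only_site_rest => i /= ip.
by rewrite !tnth_mix /= (negbTE ip).
Qed.

Hypothesis D_ge0 : forall y, 0 <= D y.

Let E_ge0 y : 0 <= J B (fun y => f y * site_rest p y) y.
Proof. by rewrite -(pmulr_lge0 _ (site_weight_gt0 p y)) -resample_siteE. Qed.

(** Since [p] and its neighbours lie outside [B], the two edges at [p] come out of the integral, and
    what remains does not see the value at [p]. Positivity is required of the integral and not of f,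
    because it will be applied to f - a, which is nonnegative only in conditional mean. *)
Lemma resample_pin_ub y : D y <= K * D (pin p y).
Proof.
by rewrite !resample_siteE resample_site_pin [leRHS]mulrCA ler_wpM2l// site_weight_le.
Qed.

Lemma resample_pin_lb y : G (tnth y p) -> D (pin p y) <= K * D y.
Proof.
by move=> Gy; rewrite !resample_siteE resample_site_pin [leRHS]mulrCA ler_wpM2l// site_weight_ge.
Qed.

End isolated_site.

(** * Enlarging a block up to two pinned sites *)

Section growth.
Variables (B B1 : pred 'I_n) (p q : 'I_n).
Hypothesis BB1 : forall i, B i -> B1 i.
Hypothesis B_succ : forall i, B i -> B1 (ordS i).
Hypothesis B_pred : forall i, B (ordS i) -> B1 i.
Hypothesis B1_succ : forall i, B1 i -> [|| B1 (ordS i), ordS i == p | ordS i == q].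
Hypothesis B1_pred : forall i, B1 (ordS i) -> [|| B1 i, i == p | i == q].
Hypothesis B1p : ~~ B1 p.
Hypothesis B1q : ~~ B1 q.
Hypothesis pq : p != q.

(** Intended case: [B] and [B1] are balls of radii s and s + 1, and [p], [q] are the two sites at
    distance s + 2. The layer between [B] and [B1] keeps [p] and [q] from touching [B]. *)
Definition grown : pred 'I_n := fun i => [|| B1 i, i == p | i == q].
Local Notation pin2 y := (pin q (pin p y)).

Let isoP r : ~~ B1 r -> [&& ~~ B r, ~~ B (ordS r) & ~~ B (ord_pred r)].
Proof.
move=> B1r; apply/and3P; split; apply: contra B1r.
- exact: BB1.
- exact: B_pred.
- by move=> Br; have := B_succ Br; rewrite ord_predK.
Qed.

Definition inner_weight y : R := \prod_(i < n | B1 i || B1 (ordS i)) edge y i.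
Definition outer_weight y : R := \prod_(i < n | ~~ (B1 i || B1 (ordS i))) edge y i.

Lemma ring_weight_cut y : w y = inner_weight y * outer_weight y.
Proof. by rewrite /ring_weight (bigID (fun i => B1 i || B1 (ordS i))). Qed.

(** A number rather than a function of the outer configuration: the stars at [p] and [q] screen [B1]
    from everything else. *)
Definition pinned_mean f : R := I (fun u => f u * inner_weight (pin2 u)).

Lemma bmeas_pin2 f : bmeas f -> bmeas (fun y => f (pin2 y)).
Proof.
by move=> bf; exact: (bmeas_mixr (pred1 p) stars (bmeas_mixr (pred1 q) stars bf)).
Qed.

Lemma tnth_pin2 y i : tnth (pin2 y) i = if (i == p) || (i == q) then star else tnth y i.
Proof. by rewrite !tnth_pin orbC; case: (i == q). Qed.

(** After pinning, an edge that meets [B1] has its other end in [B1] or at a star, and any other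
    edge reads only [y] and stars. The weight therefore factorises. *)
Lemma mean_pinned f y : bmeas f -> depends_only B f ->
  I (fun u => J B (fun y => f y * w y) (pin2 (mix B1 u y))) =
  pinned_mean f * outer_weight (pin2 y).
Proof.
move=> bf fB.
have bfw : bmeas (fun y => f y * w (pin2 y)) by apply: bmeasM => //; exact: bmeas_pin2.
transitivity (J B1 (fun y => f y * w (pin2 y)) y).
  have B1E i : B1 i = B i || B1 i by case Bi: (B i) => //=; exact: BB1.
  rewrite -[RHS]/(J B1 _ y) (resample_comp mu y bfw B1E).
  apply: eq_mean => u; apply: eq_mean => v; rewrite !(depends_only_mix _ _ fB).
  congr (_ * w _); apply: eq_from_tnth => i; rewrite tnth_mix !tnth_pin2 !tnth_mix.
  case: ifP => [Bi|//]; have Ni r : ~~ B1 r -> (i == r) = false.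
    by move=> B1r; apply/negbTE; apply: contra B1r => /eqP <-; exact: BB1.
  by rewrite !Ni.
rewrite /resample /pinned_mean -meanZr; last first.
  by apply: bmeasM => //; apply: (@bmeas_pin2 inner_weight); exact: bmeas_edge_prod.
apply: eq_mean => u; rewrite ring_weight_cut mulrA.
have fB1 := depends_onlyS BB1 fB; rewrite (depends_only_mix _ _ fB1).
congr (_ * _ * _); apply: eq_bigr => i; rewrite /edge !tnth_pin2 !tnth_mix.
  case/orP => B1i.
    rewrite B1i; move: (B1_succ B1i); case: (B1 (ordS i)) => //= ->.
    by [].
  by rewrite B1i; move: (B1_pred B1i); case: (B1 i) => //= ->.
by rewrite negb_or => /andP[/negbTE -> /negbTE ->].
Qed.

Local Notation D f := (J B (fun y => f y * w y)).
Local Notation D' f := (J grown (fun y => f y * w y)).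

Let fill u y := mix (fun i => grown i && ~~ B i) u y.

Let resample_grownE f y : bmeas f -> D' f y = I (fun u => D f (fill u y)).
Proof.
move=> bf; apply: resample_comp => [|i]; first exact: bmeasM.
by rewrite /grown; case Bi: (B i); rewrite ?(BB1 Bi) ?andbT.
Qed.

Let D_pin2_fill f u y : D f (pin2 (fill u y)) = D f (pin2 (mix B1 u y)).
Proof.
apply: eq_mean => v; congr (_ * _); [congr f|congr w]; apply: eq_from_tnth => i;
  rewrite !tnth_mix /= /grown; case: (B i) => //; rewrite !tnth_mktuple andbT;
  by case: (i == q); case: (i == p); rewrite ?orbF.
Qed.

Let bmeas_D f : bmeas f -> bmeas (D f).
Proof. by move=> bf; apply: bmeas_resample; exact: bmeasM. Qed.

Let bmeas_D_fill f y : bmeas f -> bmeas (fun u => D f (fill u y)).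
Proof. by move=> bf; exact: (bmeas_mixl _ y (bmeas_D bf)). Qed.

Let bmeas_D_pin2 f y : bmeas f -> bmeas (fun u => D f (pin2 (mix B1 u y))).
Proof. by move=> bf; exact: (bmeas_mixl B1 y (bmeas_pin2 (bmeas_D bf))). Qed.

Section bounds.
Variable f : T -> R.
Hypotheses (bf : bmeas f) (fB : depends_only B f) (D_ge0 : forall y, 0 <= D f y).

Lemma grown_ub y : D' f y <= K ^+ 2 * (pinned_mean f * outer_weight (pin2 y)).
Proof.
rewrite resample_grownE// -mean_pinned// -meanZl; last first.
  exact: bmeas_D_pin2.
apply: le_mean => [||u].
- exact: bmeas_D_fill.
- by apply: bmeasZ; exact: bmeas_D_pin2.
rewrite -D_pin2_fill expr2 -mulrA (le_trans (resample_pin_ub (isoP B1p) bf fB D_ge0 _))//.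
by rewrite ler_wpM2l ?(ltW K_gt0)// (resample_pin_ub (isoP B1q) bf fB D_ge0).
Qed.

(** The integral is restricted to the event that both free values at [p] and [q] lie in [G], where
    pinning can be compared in the reverse direction. The pinned integrand ignores these two values,
    so by independence the event contributes exactly theta^2. *)
Lemma grown_lb y :
  theta ^+ 2 * (pinned_mean f * outer_weight (pin2 y)) <= K ^+ 2 * D' f y.
Proof.
pose chi r u : R := \1_G (tnth u r).
have bchi r : bmeas (chi r : T -> R) by exact: (bmeas_comp bmeas_indicG (measurable_tnth r)).
have chi_only r : depends_only (pred1 r) (chi r).
  by move=> u v uv; rewrite /chi uv//=.
have bE : bmeas (fun u => D f (pin2 (mix B1 u y))).
  exact: bmeas_D_pin2.
have E_only r : ~~ B1 r -> depends_only (predC (pred1 r)) (fun u => D f (pin2 (mix B1 u y))).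
  move=> B1r u v uv; congr (D f _); apply: eq_from_tnth => i; rewrite !tnth_pin2 !tnth_mix.
  case: ifP => // _; case: ifP => // B1i; apply: uv => /=.
  by apply: contraNneq B1r => <-.
have chiE r : I (chi r) = theta by apply: mean_tnth; exact: bmeas_indicG.
rewrite -mean_pinned// expr2 -mulrA -{1}(chiE p) -(chiE q).
rewrite -(mean_indep mu (bchi q) bE (chi_only q) (E_only q B1q)).
have bqE : bmeas (fun u => chi q u * D f (pin2 (mix B1 u y))) by exact: bmeasM.
have bqE_only : depends_only (predC (pred1 p)) (fun u => chi q u * D f (pin2 (mix B1 u y))).
  move=> u v uv; rewrite (E_only p B1p _ _ uv); congr (_ * _).
  by apply: chi_only => i /= /eqP ->; apply: uv; rewrite /= eq_sym.
rewrite -(mean_indep mu (bchi p) bqE (chi_only p) bqE_only).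
rewrite resample_grownE// -meanZl; last exact: bmeas_D_fill.
apply: le_mean => [||u]; [exact: bmeasM|by apply: bmeasZ; exact: bmeas_D_fill|].
rewrite -D_pin2_fill; set v := fill u y.
have vp : tnth v p = tnth u p.
  by rewrite tnth_mix /grown eqxx orbT /= (negbTE (contra (@BB1 p) B1p)).
have vq : tnth v q = tnth u q.
  by rewrite tnth_mix /grown eqxx !orbT /= (negbTE (contra (@BB1 q) B1q)).
have Dv : 0 <= K ^+ 2 * D f v by rewrite mulr_ge0// exprn_ge0// ltW.
rewrite /chi !indicE; case: (boolP (tnth u p \in G)) => [/set_mem Gp|_]; last by rewrite mul0r.
case: (boolP (tnth u q \in G)) => [/set_mem Gq|_]; last by rewrite mul0r mulr0.
rewrite !mul1r expr2 -mulrA.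
(* The pins are released one at a time; [pq] ensures that the star still placed at [p] does not hide
   the value at [q]. *)
apply: le_trans (resample_pin_lb (isoP B1q) bf fB D_ge0 _) _.
  by rewrite tnth_pin eq_sym (negbTE pq) vq.
by rewrite ler_wpM2l ?(ltW K_gt0)// (resample_pin_lb (isoP B1p) bf fB D_ge0)// vp.
Qed.

Lemma grown_ge0 y : 0 <= D' f y.
Proof. by rewrite resample_grownE//; exact: mean_ge0. Qed.

End bounds.

Lemma pinned_mean_linear f g (a b : R) : bmeas f -> bmeas g ->
  pinned_mean (fun y => a * f y + b * g y) = a * pinned_mean f + b * pinned_mean g.
Proof.
move=> bf bg; have bw := bmeas_pin2 (bmeas_edge_prod (fun i => B1 i || B1 (ordS i))).
have ba e : bmeas e -> bmeas (fun u => e u * inner_weight (pin2 u)).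
  by move=> be; exact: bmeasM be bw.
rewrite /pinned_mean -!meanZl; [|exact: ba..].
rewrite -meanD; [|by apply: bmeasZ; exact: ba..].
by apply: eq_mean => u; ring.
Qed.


(** The Gibbs conditional mean of f given the coordinates outside [C] is a quotient of two
    resamplings; this places it in [a, b] without dividing. *)
Definition squeezed C f (a b : R) := forall y,
  a * J C w y <= J C (fun y => f y * w y) y <= b * J C w y.

(** The functions f - a and b - f have nonnegative conditional means, and their pinned means add up
    to (b - a) times that of 1. Whichever has at least half of it is bounded below on the larger
    block, and the corresponding end of the interval moves inwards. *)
Lemma grown_contract f (a b : R) : bmeas f -> depends_only B f -> a <= b ->
  squeezed B f a b ->
  exists a' b', [/\ a' <= b', b' - a' <= contraction_ratio * (b - a) & squeezed grown f a' b'].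
Proof.
move=> bf fB ab sq; set s := 1 - contraction_ratio.
have K2 : 0 < K ^+ 2 by rewrite exprn_gt0.
pose g1 y := 1 * f y + - a * 1; pose g2 y := - 1 * f y + b * 1.
have bc : bmeas (fun _ : T => 1 : R) by exact: bmeas_cst.
have bg1 : bmeas g1 by apply: bmeasD; exact: bmeasZ.
have bg2 : bmeas g2 by apply: bmeasD; exact: bmeasZ.
have lin C c e y : J C (fun y => (c * f y + e * 1) * w y) y =
    c * J C (fun y => f y * w y) y + e * J C w y.
  rewrite -!resampleZ//; last by apply: bmeasM.
  rewrite -resampleD; [|by apply: bmeasZ; apply: bmeasM|exact: bmeasZ].
  by apply: eq_mean => u; ring.
have g1B : depends_only B g1 by move=> u v uv; rewrite /g1 (fB u v).
have g2B : depends_only B g2 by move=> u v uv; rewrite /g2 (fB u v).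
have oneB : depends_only B (fun _ : T => 1 : R) by [].
have D1E C y : J C (fun y => 1 * w y) y = J C w y by apply: eq_mean => u; rewrite mul1r.
have w_ge0 C y : 0 <= J C w y by apply: resample_ge0 => u; exact/ltW/ring_weight_gt0.
have D1_ge0 y : 0 <= D (fun=> 1) y by rewrite D1E.
have g1_ge0 y : 0 <= D g1 y by rewrite lin mul1r mulNr subr_ge0; case/andP: (sq y).
have g2_ge0 y : 0 <= D g2 y by rewrite lin mulN1r addrC subr_ge0; case/andP: (sq y).
pose k := pinned_mean (fun _ : T => 1 : R).
pose k1 := pinned_mean g1; pose k2 := pinned_mean g2.
have k_ge0 : 0 <= k by apply: mean_ge0 => u; rewrite mul1r ltW ?edge_prod_gt0.
have kk : k1 + k2 = (b - a) * k by rewrite /k1 /k2 !pinned_mean_linear// /k; ring.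
(* The lower bound for g is set against the upper bound for the constant 1, and the common factor
   that depends on the outer configuration cancels. *)
have key g : bmeas g -> depends_only B g -> (forall y, 0 <= D g y) ->
    (b - a) * k <= 2 * pinned_mean g -> forall y, s * (b - a) * J grown w y <= D' g y.
  move=> bg gB g0 kg y.
  have ub := grown_ub bc oneB D1_ge0 y; rewrite D1E in ub.
  have lb := grown_lb bg gB g0 y.
  have U0 : 0 < outer_weight (pin2 y) by exact: edge_prod_gt0.
  rewrite -(ler_pM2l K2); apply: le_trans lb.
  apply: (@le_trans _ _ (theta ^+ 2 * ((b - a) * k / 2 * outer_weight (pin2 y)))); last first.
    by rewrite ler_wpM2l ?sqr_ge0// ler_wpM2r ?(ltW U0)// ler_pdivrMr// [leRHS]mulrC.
  have -> : K ^+ 2 * (s * (b - a) * J grown w y) =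
      theta ^+ 2 * ((b - a) / 2 * (J grown w y / K ^+ 2)).
    rewrite /s /contraction_ratio opprB addrC subrK; field; by rewrite gt_eqF.
  rewrite ler_wpM2l ?sqr_ge0//.
  have -> : (b - a) * k / 2 * outer_weight (pin2 y) = (b - a) / 2 * (k * outer_weight (pin2 y)).
    by field.
  by rewrite ler_wpM2l ?divr_ge0 ?subr_ge0// ler_pdivrMr// mulrC.
have s_le1 : s <= 1 by rewrite /s gerBl contraction_ratio_ge0.
have [k21|k12] := leP k2 k1.
  exists (a + s * (b - a)), b; split.
  - by rewrite -lerBrDl ler_piMl// subr_ge0.
  - by rewrite /s; nra.
  - move=> y; apply/andP; split.
      have k1_ge : (b - a) * k <= 2 * k1 by rewrite -kk; lra.
      by have := key g1 bg1 g1B g1_ge0 k1_ge y; rewrite lin mul1r mulNr lerBrDl -mulrDl.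
    by have := grown_ge0 bg2 g2_ge0 y; rewrite lin mulN1r addrC subr_ge0.
exists a, (b - s * (b - a)); split.
- by rewrite lerBrDr -lerBrDl ler_piMl// subr_ge0.
- by rewrite /s; nra.
- move=> y; apply/andP; split.
    by have := grown_ge0 bg1 g1_ge0 y; rewrite lin mul1r mulNr subr_ge0.
  have k2_ge : (b - a) * k <= 2 * k2 by rewrite -kk; lra.
  have := key g2 bg2 g2B g2_ge0 k2_ge y; rewrite lin mulN1r; lra.
Qed.


End growth.

End ring_weight.

(** * Balls on the ring *)

Section ring_ball.
Variable n : nat.
Implicit Types (i j k : 'I_n) (r s : nat).

(* The number of successor steps from [i] to [j] along the ring. *)
Definition ring_offset i j : nat := ((j + n - i) %% n)%N.

(** The two distances around the ring are the offset a and n - a; the second test is n - a <= r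
    written without truncated subtraction. *)
Definition ring_ball i r : pred 'I_n :=
  fun j => (ring_offset i j <= r)%N || (n <= ring_offset i j + r)%N.

Lemma ring_offset_lt i j : (ring_offset i j < n)%N.
Proof. by rewrite ltn_mod (leq_ltn_trans _ (ltn_ord i)). Qed.

Lemma ring_offsetE i j :
  ring_offset i j = if (i <= j)%N then (j - i)%N else (j + n - i)%N.
Proof.
have := ltn_ord i; have := ltn_ord j => jn i_n; rewrite /ring_offset.
have [ij|ij] := leqP i j; last by rewrite modn_small//; lia.
by rewrite -addnBAC// modnDr modn_small//; lia.
Qed.

Lemma val_ordS i : ordS i = (if i.+1 == n then 0 else i.+1)%N :> nat.
Proof.
rewrite /=; case: eqP => [->|ne]; first by rewrite modnn.
by rewrite modn_small//; have := ltn_ord i; lia.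
Qed.

Lemma ring_offset_ordS i j : ring_offset i (ordS j) =
  if (ring_offset i j).+1 == n then 0%N else (ring_offset i j).+1.
Proof.
rewrite !ring_offsetE val_ordS; have := ltn_ord i; have := ltn_ord j.
by repeat case: ifP; lia.
Qed.

Lemma ring_offset_inj i j k : ring_offset i j = ring_offset i k -> j = k.
Proof.
rewrite !ring_offsetE => jk; apply: val_inj => /=; move: jk.
have := ltn_ord i; have := ltn_ord j; have := ltn_ord k.
by repeat case: ifP; lia.
Qed.

Lemma ring_offset_ex i a : (a < n)%N -> exists j, ring_offset i j = a.
Proof.
move=> an; have i_n := ltn_ord i.
have lt' : ((if i + a < n then i + a else i + a - n) < n)%N by case: ifP; lia.
by exists (Ordinal lt'); rewrite ring_offsetE /=; case: ifP; case: ifP; lia.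
Qed.

Lemma ring_ball_refl i r : ring_ball i r i.
Proof. by rewrite /ring_ball ring_offsetE leqnn subnn. Qed.

Lemma ring_ball_sym i j r : ring_ball i r j = ring_ball j r i.
Proof.
rewrite /ring_ball !ring_offsetE; have := ltn_ord i; have := ltn_ord j.
by repeat case: ifP; lia.
Qed.

Lemma ring_ball_le i j r s : (r <= s)%N -> ring_ball i r j -> ring_ball i s j.
Proof. by rewrite /ring_ball; lia. Qed.

Lemma ring_ball_trans i j k r s :
  ring_ball i r j -> ring_ball j s k -> ring_ball i (r + s) k.
Proof.
rewrite /ring_ball !ring_offsetE; have := ltn_ord i; have := ltn_ord j; have := ltn_ord k.
by repeat case: ifP; lia.
Qed.

Lemma card_ring_ball i r : (#|ring_ball i r| <= (2 * r).+1)%N.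
Proof.
have [le|gt] := leqP n (2 * r).+1.
  by apply: leq_trans le; rewrite -[leqRHS](card_ord n); exact: max_card.
(* Offsets 0..r are kept and offsets n - r..n - 1 are sent to r + 1..2 r, which is injective on the
   ball. *)
pose f j : 'I_(2 * r).+1 :=
  inord (if ring_offset i j <= r then ring_offset i j else 2 * r + 1 + ring_offset i j - n)%N.
rewrite -(@card_in_image _ _ f); last first.
  move=> j k; rewrite -!topredE /= /ring_ball => Bj Bk /(congr1 val) /=.
  have := ring_offset_lt i j; have := ring_offset_lt i k => kn jn.
  rewrite inordK; last by case: ifP; lia.
  rewrite inordK; last by case: ifP; lia.
  by move=> fjk; apply: (@ring_offset_inj i); move: fjk; case: ifP; case: ifP; lia.
by rewrite -[leqRHS](card_ord (2 * r).+1); exact: max_card.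
Qed.

End ring_ball.

(** * Exponential decay of correlations *)

Section gibbs_mean.
Context d (X : measurableType d) (R : realType) (mu : probability X R).
Variables (h : X -> X -> R) (star : X) (G : set X) (K : R).
Hypothesis mh : measurable_fun setT (fun p => h p.1 p.2).
Hypothesis h_gt0 : forall x y, 0 < h x y.
Hypothesis h_le1 : forall x y, h x y <= 1.
Hypothesis mG : measurable G.
Hypothesis K_gt0 : 0 < K.
Hypothesis h_star_ub : forall x t z, h x t * h t z <= K * (h x star * h star z).
Hypothesis h_star_lb : forall x t z, G t -> h x star * h star z <= K * (h x t * h t z).
Variable n : nat.
Hypothesis n_gt1 : (1 < n)%N.
Local Notation T := (n.-tuple X).
Local Notation I := (mean (tuple_prob mu n)).
Local Notation J := (resample mu).
Local Notation w := (ring_weight h (n := n)).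
Local Notation rho := (contraction_ratio mu G K).
Implicit Types (f g : T -> R) (i j : 'I_n).

Definition gibbs_mean f : R := I (fun y => f y * w y) / I w.
Local Notation E := gibbs_mean.

Let bw : bmeas w := bmeas_ring_weight mh h_gt0 h_le1 n.
Let w_gt0 y : 0 < w y := ring_weight_gt0 h_gt0 y.

Let rho_ge0 : 0 <= rho.
Proof. exact: (contraction_ratio_ge0 mu h_gt0 mG K_gt0 h_star_ub). Qed.

(** Each round enlarges the radius by two and multiplies the oscillation by the contraction ratio;
    the starting interval is [-M, M]. *)
Lemma squeezed_ball i r k f M : bmeas f -> depends_only (ring_ball i r) f ->
  0 <= M -> (forall y, `|f y| <= M) -> (2 * (r + 2 * k) < n)%N ->
  exists a b, [/\ a <= b, b - a <= rho ^+ k * (2 * M) &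
    squeezed mu h (ring_ball i (r + 2 * k)) f a b].
Proof.
move=> bf fB M_ge0 fM; elim: k => [|k IH] rkn.
  rewrite muln0 addn0; exists (- M), M; split; [lra|by rewrite expr0; lra|].
  move=> y; rewrite -!resampleZ//.
  have bfw : bmeas (fun y => f y * w y) by exact: bmeasM.
  apply/andP; split; apply: le_mean; do ?[exact: (bmeas_mixl _ y bfw)|
      exact: (bmeas_mixl _ y (bmeasZ _ bw))];
    move=> u; rewrite ler_wpM2r ?(ltW (w_gt0 _))//;
    have := fM (mix (ring_ball i r) u y);
    by rewrite ler_norml => /andP[].
have rkn' : (2 * (r + 2 * k) < n)%N by lia.
have [a [b [ab ba sq]]] := IH rkn'.
set s := (r + 2 * k)%N in rkn' sq.
have sE : (r + 2 * k.+1 = s.+2)%N by rewrite /s; lia.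
(* The two sites at distance s + 2, one on each side; they are distinct because 2 (s + 2) < n. *)
have [p pE] : exists p, ring_offset i p = s.+2 by apply: ring_offset_ex; lia.
have [q qE] : exists q, ring_offset i q = (n - s.+2)%N by apply: ring_offset_ex; lia.
have off_lt j := ring_offset_lt i j.
have eqrel j l : (j == l) = (ring_offset i j == ring_offset i l).
  by apply/eqP/eqP => [->//|]; exact: ring_offset_inj.
have fBs : depends_only (ring_ball i s) f.
  by apply: depends_onlyS fB => j; apply: ring_ball_le; rewrite /s; lia.
have -> : ring_ball i (r + 2 * k.+1) = grown (ring_ball i s.+1) p q.
  apply/funext => j; rewrite /grown !eqrel pE qE /ring_ball sE.
  by have := off_lt j; lia.
have [||||||||a' [b' [ab' ba' sq']]] := @grown_contract _ _ _ mu h star G K mh h_gt0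
  h_le1 mG K_gt0 h_star_ub h_star_lb n n_gt1
  (ring_ball i s) (ring_ball i s.+1) p q _ _ _ _ _ _ _ _ f a b bf fBs ab sq.
- by move=> j; exact: ring_ball_le.
- by move=> j; rewrite /ring_ball ring_offset_ordS; have := off_lt j; case: ifP; lia.
- by move=> j; rewrite /ring_ball ring_offset_ordS; have := off_lt j; case: ifP; lia.
- by move=> j; rewrite !eqrel pE qE /ring_ball ring_offset_ordS; have := off_lt j; case: ifP; lia.
- by move=> j; rewrite !eqrel pE qE /ring_ball ring_offset_ordS; have := off_lt j; case: ifP; lia.
- by rewrite /ring_ball pE; lia.
- by rewrite /ring_ball qE; lia.
- by rewrite eqrel pE qE; lia.
exists a', b'; split => //; apply: (le_trans ba').
by rewrite exprS -mulrA ler_wpM2l.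
Qed.

Lemma mean_weight_gt0 : 0 < I w.
Proof. exact: mean_gt0. Qed.

Lemma gibbs_meanD f g : bmeas f -> bmeas g -> E (fun y => f y + g y) = E f + E g.
Proof.
move=> bf bg; rewrite /E -mulrDl -meanD; [|exact: bmeasM..].
by congr (_ / _); apply: eq_mean => y; rewrite mulrDl.
Qed.

Lemma gibbs_meanZ c f : bmeas f -> E (fun y => c * f y) = c * E f.
Proof.
move=> bf; rewrite /E mulrA -meanZl; last exact: bmeasM.
by congr (_ / _); apply: eq_mean => y; rewrite mulrA.
Qed.

Lemma gibbs_mean_cst c : E (fun=> c) = c.
Proof. by rewrite /E meanZl// mulfK// gt_eqF// mean_weight_gt0. Qed.

Lemma le_gibbs_mean f g : bmeas f -> bmeas g -> (forall y, f y <= g y) -> E f <= E g.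
Proof.
move=> bf bg fg; rewrite ler_pM2r ?invr_gt0 ?mean_weight_gt0//.
by apply: le_mean => [||y]; [exact: bmeasM..|rewrite ler_wpM2r// ltW].
Qed.

(** A function g of the outer coordinates commutes with resampling of [B], so the pointwise squeeze
    may be integrated against g. *)
Lemma gibbs_mean_squeezed (B : pred 'I_n) f g a b : bmeas f -> bmeas g ->
  depends_only (predC B) g -> (forall y, 0 <= g y) -> squeezed mu h B f a b ->
  a * E g <= E (fun y => f y * g y) <= b * E g.
Proof.
move=> bf bg gB g_ge0 sq.
have bfw : bmeas (fun y => f y * w y) by exact: bmeasM.
have IE e : bmeas e -> I (fun y => e y * g y) = I (fun y => J B e y * g y).
  move=> be; rewrite -(mean_resample mu B (bmeasM be bg)).
  by apply: eq_mean => y; exact: resample_out.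
have -> : E (fun y => f y * g y) = I (fun y => J B (fun y => f y * w y) y * g y) / I w.
  by rewrite -IE// /E; congr (_ / _); apply: eq_mean => y; rewrite mulrAC.
have -> : E g = I (fun y => J B w y * g y) / I w.
  by rewrite -IE// /E; congr (_ / _); apply: eq_mean => y; rewrite mulrC.
have bJ e : bmeas e -> bmeas (fun y => J B e y * g y).
  by move=> be; apply: bmeasM => //; exact: bmeas_resample.
rewrite !mulrA -!meanZl; [|exact: bJ..].
by apply/andP; split; rewrite ler_pM2r ?invr_gt0 ?mean_weight_gt0//; apply: le_mean;
  do ?[exact: bJ|by apply: bmeasZ; exact: bJ]; move=> y; rewrite mulrA ler_wpM2r//;
  case/andP: (sq y).
Qed.

(** The mean of f and all its conditional means given the far coordinates lie in one interval of
    length at most 2 M1 rho^k. The covariance with g is at most this length times the mean of g +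
    M2, which is at most 2 M2. *)
Theorem gibbs_mean_mixing i r k f g M1 M2 : bmeas f -> bmeas g ->
  depends_only (ring_ball i r) f -> depends_only (predC (ring_ball i (r + 2 * k))) g ->
  0 <= M1 -> 0 <= M2 -> (forall y, `|f y| <= M1) -> (forall y, `|g y| <= M2) ->
  (2 * (r + 2 * k) < n)%N ->
  `|E (fun y => f y * g y) - E f * E g| <= rho ^+ k * (4 * M1 * M2).
Proof.
move=> bf bg fB gB M1_ge0 M2_ge0 fM1 gM2 rkn.
have [a [b [ab ba sq]]] := squeezed_ball bf fB M1_ge0 fM1 rkn.
have b1 c : bmeas (fun _ : T => c : R) := bmeas_cst _ c.
(* The shift makes g nonnegative, as the squeeze demands, and leaves the covariance unchanged. *)
pose g' y := g y + M2.
have bg' : bmeas g' by exact: bmeasD.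
have g'B : depends_only (predC (ring_ball i (r + 2 * k))) g'.
  by move=> u v uv; rewrite /g' (gB u v).
have g'_ge0 y : 0 <= g' y by have := gM2 y; rewrite /g' ler_norml; lra.
have := gibbs_mean_squeezed bf bg' g'B g'_ge0 sq.
have := gibbs_mean_squeezed bf (b1 1) (fun _ _ _ => erefl) (fun=> ler01) sq.
have -> : E (fun y => f y * 1) = E f.
  by congr (_ / _); apply: eq_mean => y; rewrite mulr1.
have -> : E (fun y => f y * g' y) = E (fun y => f y * g y) + M2 * E f.
  rewrite -gibbs_meanZ// -gibbs_meanD; [|exact: bmeasM|exact: bmeasZ].
  by congr (_ / _); apply: eq_mean => y; rewrite /g'; ring.
rewrite /g' gibbs_meanD// !gibbs_mean_cst !mulr1.
have Eg : E g + M2 <= 2 * M2.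
  suff : E g <= M2 by lra.
  rewrite -[leRHS]gibbs_mean_cst; apply: le_gibbs_mean => // y.
  by have := gM2 y; rewrite ler_norml => /andP[].
have Eg0 : 0 <= E g + M2.
  suff : - M2 <= E g by lra.
  rewrite -[leLHS]gibbs_mean_cst; apply: le_gibbs_mean => // y.
  by have := gM2 y; rewrite ler_norml => /andP[].
move: (E f) (E g) Eg Eg0 (E _) => u v v1 v2 t /andP[u1 u2] /andP[t1 t2].
apply: (@le_trans _ _ ((b - a) * (v + M2))).
  by rewrite ler_norml; apply/andP; split; nra.
apply: (@le_trans _ _ (rho ^+ k * (2 * M1) * (2 * M2))); last by lra.
by apply: ler_pM => //; rewrite subr_ge0.
Qed.

End gibbs_mean.

(** * Linear lower bound for the variance *)

Section variance_lower_bound.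
Context d (X : measurableType d) (R : realType) (mu : probability X R).
Variables (h : X -> X -> R) (star : X) (G : set X) (K : R).
Hypothesis mh : measurable_fun setT (fun p => h p.1 p.2).
Hypothesis h_gt0 : forall x y, 0 < h x y.
Hypothesis h_le1 : forall x y, h x y <= 1.
Hypothesis K_gt0 : 0 < K.
Hypothesis h_star_ub : forall x t z, h x t * h t z <= K * (h x star * h star z).
Hypothesis h_star_lb : forall x t z, G t -> h x star * h star z <= K * (h x t * h t z).
Variable n : nat.
Hypothesis n_gt1 : (1 < n)%N.
Local Notation T := (n.-tuple X).
Local Notation I := (mean (tuple_prob mu n)).
Local Notation w := (ring_weight h (n := n)).
Local Notation pin p := (mix (pred1 p) (stars star n)).
Variable P : probability T R.
Hypothesis PE : forall f, bmeas f -> mean P f = gibbs_mean mu h f.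
Variables (s psi : X -> R).
Hypotheses (bs : bmeas s) (bpsi : bmeas psi).
Hypothesis psi_le1 : forall x, `|psi x| <= 1.
Hypothesis psi_supp : forall x, psi x != 0 -> G x.
Hypothesis psi0 : mean mu psi = 0.
Implicit Types (i j : 'I_n) (y : T).

Let bw : bmeas w := bmeas_ring_weight mh h_gt0 h_le1 n.
Let w_gt0 y : 0 < w y := ring_weight_gt0 h_gt0 y.
Let Iw_gt0 : 0 < I w := mean_weight_gt0 mu mh h_gt0 h_le1 n.

(* Under the Gibbs measure [score i] has conditional mean zero given all the
   coordinates but the i-th one. *)
Definition score i y : R := psi (tnth y i) * (w (pin i y) / w y).

Lemma site_rest_pin i y : site_rest h i (pin i y) = site_rest h i y.
Proof.
apply: depends_only_site_rest => j /= ij.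
by rewrite tnth_mix /= (negbTE ij).
Qed.

Lemma ring_weight_pin_le i y : w y <= K * w (pin i y).
Proof.
rewrite !(ring_weightE h n_gt1 i) site_rest_pin.
by rewrite mulrA ler_wpM2r ?(ltW (site_rest_gt0 h_gt0 _ _))// site_weight_le.
Qed.

Lemma ring_weight_pin_ge i y : G (tnth y i) -> w (pin i y) <= K * w y.
Proof.
move=> Gy; rewrite !(ring_weightE h n_gt1 i) site_rest_pin.
rewrite mulrA ler_wpM2r ?(ltW (site_rest_gt0 h_gt0 _ _))//.
exact: (site_weight_ge h_star_lb n_gt1).
Qed.

Lemma scoreE i y : score i y =
  psi (tnth y i) * (site_weight h i (pin i y) / site_weight h i y).
Proof.
rewrite /score !(ring_weightE h n_gt1 i) site_rest_pin.
have r0 : site_rest h i y != 0 by rewrite gt_eqF// site_rest_gt0.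
by rewrite -mulf_div divff// mulr1.
Qed.

Lemma score_le i y : `|score i y| <= K.
Proof.
rewrite /score normrM; have [->|p0] := eqVneq (psi (tnth y i)) 0.
  by rewrite normr0 mul0r ltW.
rewrite -[leRHS]mul1r ler_pM//.
by rewrite gtr0_norm ?divr_gt0// ler_pdivrMr// ring_weight_pin_ge//; exact: psi_supp.
Qed.

Let bw_pin i : bmeas (fun y => w (pin i y)).
Proof. exact: (bmeas_mixr _ _ bw). Qed.

Let bpsi_tnth i : bmeas (fun y : T => psi (tnth y i)).
Proof. exact: (bmeas_comp bpsi (measurable_tnth i)). Qed.

Let bs_tnth i : bmeas (fun y : T => s (tnth y i)).
Proof. exact: (bmeas_comp bs (measurable_tnth i)). Qed.

Lemma bmeas_score i : bmeas (score i).
Proof.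
apply: (bmeasW (M := K)); last exact: score_le.
have -> : score i = fun y => psi (tnth y i) * (w (pin i y) * expR (- ln (w y))).
  by apply/funext => y; rewrite expRN lnK// posrE.
have [mp _] := bpsi_tnth i; have [mpin _] := bw_pin i; have [mw _] := bw.
apply: measurable_funM => //; apply: measurable_funM => //.
do 2 apply: measurableT_comp => //.
exact: measurableT_comp.
Qed.

(** Multiplying by the Gibbs weight cancels the denominator of the score. The pinned weight and f do
    not see the i-th coordinate, so [psi] is integrated alone and gives 0. *)
Lemma mean_score i f : bmeas f -> depends_only (predC (pred1 i)) f ->
  mean P (fun y => f y * score i y) = 0.
Proof.
move=> bf fi; rewrite PE; last by apply: bmeasM => //; exact: bmeas_score.
rewrite /gibbs_mean (_ : I _ = 0) ?mul0r//.
transitivity (I (fun y => psi (tnth y i) * (f y * w (pin i y)))).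
  apply: eq_mean => y; rewrite /score; have := w_gt0 y => w0.
  by field; rewrite gt_eqF.
rewrite (@mean_indep _ _ _ mu n (pred1 i))//; last first.
- move=> y z yz; rewrite (fi _ _ yz); congr (_ * w _); apply: eq_from_tnth => j.
  by rewrite !tnth_mix /=; case: ifPn => // /yz.
- by move=> y z yz; rewrite yz//=.
- exact: bmeasM.
by rewrite (mean_tnth mu i bpsi) psi0 mul0r.
Qed.

(** The same cancellation leaves the mean of s psi times the ratio of the pinned to the unpinned
    total weight, and pinning loses at most a factor K. *)
Lemma mean_score_self i : 0 <= mean mu (fun x => s x * psi x) ->
  mean mu (fun x => s x * psi x) / K <= mean P (fun y => s (tnth y i) * score i y).
Proof.
move=> a_ge0; rewrite PE; last by apply: bmeasM => //; exact: bmeas_score.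
have -> : gibbs_mean mu h (fun y => s (tnth y i) * score i y) =
    mean mu (fun x => s x * psi x) * (I (fun y => w (pin i y)) / I w).
  rewrite /gibbs_mean mulrA -(mean_tnth mu i (bmeasM bs bpsi)).
  rewrite -(@mean_indep _ _ _ mu n (pred1 i))//; last first.
  - move=> y z yz; congr w; apply: eq_from_tnth => j.
    by rewrite !tnth_mix /=; case: ifPn => // /yz.
  - by move=> y z yz; rewrite yz//=.
  - exact: (bmeas_comp (bmeasM bs bpsi) (measurable_tnth i)).
  congr (_ / _); apply: eq_mean => y; rewrite /score; have := w_gt0 y => w0.
  by field; rewrite gt_eqF.
rewrite ler_wpM2l// ler_pdivlMr// mulrC ler_pdivrMr// mulrC -meanZl//.
by apply: le_mean => //; [exact: bmeasZ|exact: ring_weight_pin_le].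
Qed.

(** By [scoreE] a score reads only its own site and the two neighbouring ones. *)
Lemma depends_only_score i j : ~~ ring_ball i 1 j ->
  depends_only (predC (pred1 i)) (score j).
Proof.
move=> ij y z yz; have [ji Sji Sij] : [/\ j != i, ordS j != i & ord_pred j != i].
  have off := ring_offset_lt i j.
  split; apply: contraNneq ij => ji; first by rewrite ji ring_ball_refl.
  - have := ring_offset_ordS i j; rewrite ji /ring_ball.
    by rewrite [X in X = _](_ : _ = 0)%N ?ring_offsetE ?leqnn ?subnn//; case: ifP; lia.
  - rewrite -[j]ord_predK ji /ring_ball ring_offset_ordS.
    by rewrite ring_offsetE leqnn subnn; case: ifP; lia.
by rewrite !scoreE /site_weight !tnth_mix /= !yz//=.
Qed.

(** Cauchy-Schwarz between the sum S and the sum V of the scores: the mean of S V is at least n a /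
    K and that of V^2 at most 3 n K^2. The centring constants [m] are arbitrary, since scores have
    mean zero. *)
Lemma variance_ge a (m : 'I_n -> R) : 0 < a -> a <= mean mu (fun x => s x * psi x) ->
  n%:R * (a ^+ 2 / (3 * K ^+ 4)) <=
  mean P (fun y => (\sum_(i < n) (s (tnth y i) - m i)) ^+ 2).
Proof.
move=> a_gt0 a_le; pose S (y : T) := \sum_(i < n) (s (tnth y i) - m i).
rewrite -[leRHS]/(mean P (fun y => S y ^+ 2)).
pose V y := \sum_(i < n) score i y.
have bsc := bmeas_score.
have bS1 i : bmeas (fun y : T => s (tnth y i) - m i).
  by apply: bmeasB => //; exact: bmeas_cst.
have bS : bmeas S by exact: bmeas_sum.
have bV : bmeas V by exact: bmeas_sum.
have n_gt0 : 0 < n%:R :> R by rewrite ltr0n ltnW.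
have SV : n%:R * (a / K) <= mean P (fun y => S y * V y).
  have -> : mean P (fun y => S y * V y) =
      \sum_(i < n) \sum_(j < n) mean P (fun y => (s (tnth y i) - m i) * score j y).
    under eq_mean => y do rewrite /S /V big_distrlr.
    rewrite mean_sum => [|i]; last by apply: bmeas_sum => j; exact: bmeasM.
    by apply: eq_bigr => i _; rewrite mean_sum// => j; exact: bmeasM.
  rewrite -[n in leLHS]card_ord -sumr_const mulr_suml.
  (* Off the diagonal, the i-th summand does not depend on coordinate j, hence is orthogonal to the
     j-th score. *)
  apply: ler_sum => i _; rewrite mul1r (bigD1 i)//= big1 ?addr0; last first.
    move=> j ji; apply: mean_score => // y z yz; rewrite yz//=.
    by rewrite eq_sym.
  have -> : mean P (fun y => (s (tnth y i) - m i) * score i y) =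
      mean P (fun y => s (tnth y i) * score i y) - mean P (fun y => m i * score i y).
    rewrite -meanB; [|exact: bmeasM|exact: bmeasZ].
    by apply: eq_mean => y; rewrite mulrBl.
  rewrite (mean_score (bmeas_cst _ _)) ?subr0//.
  apply: le_trans (mean_score_self i (le_trans (ltW a_gt0) a_le)).
  by rewrite ler_pM2r ?invr_gt0.
have VV : mean P (fun y => V y ^+ 2) <= n%:R * (3 * K ^+ 2).
  have -> : mean P (fun y => V y ^+ 2) =
      \sum_(i < n) \sum_(j < n) mean P (fun y => score i y * score j y).
    under eq_mean => y do rewrite expr2 /V big_distrlr.
    rewrite mean_sum => [|i]; last by apply: bmeas_sum => j; exact: bmeasM.
    by apply: eq_bigr => i _; rewrite mean_sum// => j; exact: bmeasM.
  rewrite -[n in leRHS]card_ord -sumr_const mulr_suml.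
  (* Scores at distance at least 2 are orthogonal; the 3 counts a site and its two neighbours. *)
  apply: ler_sum => i _; rewrite mul1r (bigID (ring_ball i 1))/= [X in _ + X]big1 ?addr0.
    apply: (@le_trans _ _ (\sum_(j < n | ring_ball i 1 j) K ^+ 2)).
      apply: ler_sum => j _; apply: le_trans (ler_norm _) _.
      apply: normr_mean_le; first exact: bmeasM.
      by move=> y; rewrite normrM expr2 ler_pM ?score_le.
    rewrite sumr_const -[leLHS]mulr_natl ler_wpM2r ?sqr_ge0// (ler_nat _ _ 3).
    exact: card_ring_ball.
  move=> j ij; under eq_mean do rewrite mulrC.
  by apply: mean_score => //; exact: depends_only_score.
have := mean_cauchy_schwarz P bS bV.
set SS := mean P (fun y => S y ^+ 2) => CS.
have SS_ge0 : 0 <= SS by exact: mean_sqr_ge0.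
have aK : 0 < a / K by rewrite divr_gt0.
have : (n%:R * (a / K)) ^+ 2 <= SS * (n%:R * (3 * K ^+ 2)).
  apply: (@le_trans _ _ (mean P (fun y => S y * V y) ^+ 2)).
    by rewrite ler_sqr ?nnegrE ?(le_trans _ SV)// ltW// mulr_gt0.
  by apply: le_trans CS _; rewrite ler_wpM2l.
rewrite -ler_pdivrMr; last by rewrite !mulr_gt0// exprn_gt0.
by apply: le_trans; rewrite le_eqVlt; apply/orP; left; apply/eqP; field; rewrite !gt_eqF.
Qed.

End variance_lower_bound.

(** * Gaussian density and tails *)

Section gauss_tail.
Variable R : realType.
Local Notation mu := (@lebesgue_measure R).
Local Notation phi := (@normal_pdf R 0 1).
Local Notation peak := (@normal_peak R 1).
Implicit Types x t : R.

Lemma normal_pdf01E x : phi x = peak * expR (- (x ^+ 2 / 2)).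
Proof. by rewrite normal_pdfE ?oner_neq0// /normal_fun subr0 expr1n mulr2n mulNr. Qed.

Lemma normal_pdf01_gt0 x : 0 < phi x.
Proof. by rewrite normal_pdf01E mulr_gt0 ?expR_gt0 ?normal_peak_gt0 ?oner_neq0. Qed.

Lemma normal_pdf01N x : phi (- x) = phi x.
Proof. by rewrite !normal_pdf01E sqrrN. Qed.

Lemma normal_peak1_le1 : peak <= 1.
Proof.
rewrite /normal_peak expr1n mul1r invf_le1; last by rewrite sqrtr_gt0 mulrn_wgt0// pi_gt0.
rewrite -[leLHS]sqrtr1 ler_wsqrtr//; have := @pi_ge2 R; lra.
Qed.

Lemma normal_pdf01_le1 x : phi x <= 1.
Proof. by rewrite (le_trans _ normal_peak1_le1)// normal_pdf_ub// oner_neq0. Qed.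

Lemma continuous_normal_pdf01 : continuous phi.
Proof. by apply: continuous_normal_pdf; rewrite oner_neq0. Qed.

Lemma is_derive_normal_pdf01 x : is_derive x 1 phi (- x * phi x).
Proof.
rewrite (_ : phi = fun x => peak * expR (- (x ^+ 2 / 2))); last first.
  by apply/funext => t; exact: normal_pdf01E.
apply: is_derive_eq.
by rewrite /GRing.scale /=; field.
Qed.

Lemma normal_pdf01_cvgy : phi x @[x --> +oo] --> 0.
Proof.
have cv : peak * expR (- x) @[x --> +oo] --> 0.
  by rewrite -[0](mulr0 peak); apply: cvgMr; exact: cvgr_expR.
apply: (squeeze_cvgr _ (cvg_cst 0) cv); near=> x.
rewrite ltW ?normal_pdf01_gt0//= normal_pdf01E ler_wpM2l ?normal_peak_ge0// ler_expR lerN2.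
have x2 : 2 <= x by near: x; exact: nbhs_pinfty_ge.
by nra.
Unshelve. all: by end_near. Qed.

(** Mills' bound: t / x >= 1 on the domain, and (t / x) phi(t) has the primitive - phi(t) / x. *)
Lemma normal_tail_ub x : 0 < x -> \int[mu]_(t in `[x, +oo[) phi t <= phi x / x.
Proof.
move=> x_gt0.
have dF t : is_derive t 1 (fun t => - (phi t / x)) (t / x * phi t).
  have := is_derive_normal_pdf01 t => dphi.
  by apply: is_derive_eq; rewrite /GRing.scale /=; field; rewrite gt_eqF.
have tail : (\int[mu]_(t in `[x, +oo[) (t / x * phi t)%:E = 0%:E - (- (phi x / x))%:E)%E.
  apply: (@ge0_continuous_FTC2y _ _ (fun t => - (phi t / x))).
  - by move=> t xt; rewrite mulr_ge0 ?normal_pdf_ge0// divr_ge0 ?(ltW x_gt0)//; lra.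
  - apply: continuous_subspaceT => t; apply: cvgM; last exact: continuous_normal_pdf01.
    by apply: cvgM => //; exact: cvg_cst.
  - have : - (phi t / x) @[t --> +oo] --> - (0 / x).
      by apply: cvgN; apply: cvgM; [exact: normal_pdf01_cvgy|exact: cvg_cst].
    by rewrite mul0r oppr0.
  - by move=> t _; exact: ex_derive.
  - apply: cvg_at_right_filter; apply: (@continuous_comp _ _ _ phi (fun u => - (u / x))).
      exact: continuous_normal_pdf01.
    by apply: cvgN; apply: cvgM; [exact: cvg_id|exact: cvg_cst].
  - by move=> t _; rewrite derive1E derive_val.
rewrite -EFinB sub0r opprK in tail; rewrite -lee_fin -tail.
have int1 : mu.-integrable `[x, +oo[ (EFin \o phi).
  by apply: integrableS (integrable_normal_pdf 0 1).
rewrite fineK; last exact: integrable_fin_num int1.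
apply: ge0_le_integral => //.
- by move=> t _; rewrite lee_fin normal_pdf_ge0.
- by apply/measurable_EFinP; apply: measurable_funTS; exact: measurable_normal_pdf.
- apply/measurable_EFinP; apply: measurable_funM.
    by apply: measurable_funM => //; exact: measurable_cst.
  by apply: measurable_funTS; exact: measurable_normal_pdf.
- move=> t /=; rewrite in_itv/= andbT => xt; rewrite lee_fin ler_peMl ?normal_pdf_ge0//.
  by rewrite ler_pdivlMr// mul1r.
Qed.

Lemma normal_lower_tail_ub x : x < 0 -> \int[mu]_(t in `]-oo, x]) phi t <= phi x / - x.
Proof.
move=> x_lt0; have Nx_gt0 : 0 < - x by rewrite oppr_gt0.
rewrite -normal_pdf01N; apply: le_trans (normal_tail_ub Nx_gt0).
rewrite /Rintegral -{1}(opprK x) ge0_integration_by_substitutionNy; last 2 first.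
- by apply: continuous_subspaceT; exact: continuous_normal_pdf01.
- by move=> t _; exact: normal_pdf_ge0.
rewrite (_ : phi \o -%R = phi)//.
by apply/funext => t; exact: normal_pdf01N.
Qed.

End gauss_tail.

(** * The bounded solution of Stein's equation *)

Section stein_solution.
Variable R : realType.
Local Notation mu := (@lebesgue_measure R).
Local Notation phi := (@normal_pdf R 0 1).
Variable h : R -> R.
Hypothesis ch : continuous h.
Hypothesis h01 : forall x, 0 <= h x <= 1.
Implicit Types x t : R.

Definition normal_mean : R := \int[mu]_t (h t * phi t).
Local Notation c := normal_mean.
Let q t := h t - c.
Let F x := \int[mu]_(t in `]-oo, x]) (q t * phi t).
(** The usual formula exp(x^2 / 2) times the integral of (h - c) exp(- t^2 / 2) up to x, with the
    Gaussian density as integrating factor. *)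
Definition stein_solution x : R := F x / phi x.
Local Notation f := stein_solution.

Let phi_int (A : set R) : measurable A -> mu.-integrable A (EFin \o phi).
Proof. by move=> mA; apply: integrableS (integrable_normal_pdf 0 1). Qed.

Let measurable_h : measurable_fun [set: R] h.
Proof. exact: continuous_measurable_fun. Qed.

Let mul_phi_int (g : R -> R) (A : set R) : measurable_fun [set: R] g ->
  (forall t, `|g t| <= 1) -> measurable A -> mu.-integrable A (EFin \o (fun t => g t * phi t)).
Proof.
move=> mg g1 mA; refine (@le_integrable _ (measurableTypeR R) R mu A mA
  (EFin \o (fun t => g t * phi t)) (EFin \o phi) _ _ (phi_int mA)).
  apply/measurable_EFinP; apply: measurable_funTS; apply: measurable_funM => //.
  exact: measurable_normal_pdf.
by move=> t _; rewrite lee_fin normrM ler_piMl.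
Qed.

Lemma Rintegral_normal_pdf : \int[mu]_t phi t = 1.
Proof. by rewrite /Rintegral integral_normal_pdf. Qed.

Lemma normal_mean01 : 0 <= c <= 1.
Proof.
apply/andP; split.
  by apply: Rintegral_ge0 => t _; rewrite mulr_ge0 ?normal_pdf_ge0//; case/andP: (h01 t).
rewrite -[leRHS]Rintegral_normal_pdf; apply: le_Rintegral => //.
- by apply: mul_phi_int => // t; have /andP[? ?] := h01 t; rewrite ger0_norm.
- exact: phi_int.
- by move=> t _; rewrite ler_piMl ?normal_pdf_ge0//; case/andP: (h01 t).
Qed.

Let q_le1 t : `|q t| <= 1.
Proof. by have := h01 t; have := normal_mean01; rewrite /q ler_norml; lra. Qed.

Let measurable_q : measurable_fun [set: R] q.
Proof. exact: measurable_funB. Qed.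

Let q_int (A : set R) : measurable A -> mu.-integrable A (EFin \o (fun t => q t * phi t)).
Proof. exact: mul_phi_int. Qed.

Let q_mean0 : \int[mu]_t (q t * phi t) = 0.
Proof.
have -> : \int[mu]_t (q t * phi t) = \int[mu]_t (h t * phi t - c * phi t).
  by apply: eq_Rintegral => t _; rewrite mulrBl.
rewrite RintegralB//.
- by rewrite RintegralZl ?Rintegral_normal_pdf ?mulr1 ?subrr//; exact: phi_int.
- by apply: mul_phi_int => // t; have /andP[? ?] := h01 t; rewrite ger0_norm.
- apply: mul_phi_int => // t; have := normal_mean01; rewrite ler_norml; lra.
Qed.

Let le_int (A : set R) : measurable A ->
  `|\int[mu]_(t in A) (q t * phi t)| <= \int[mu]_(t in A) phi t.
Proof.
move=> mA; apply: le_trans.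
  exact: (@le_normr_Rintegral _ (measurableTypeR R) R mu A (fun t => q t * phi t) mA (q_int mA)).
apply: le_Rintegral => //; [|exact: phi_int|].
  exact: (integrable_norm (q_int mA)).
move=> t _; rewrite normrM [X in _ * X]ger0_norm ?normal_pdf_ge0//.
by rewrite ler_piMl// normal_pdf_ge0.
Qed.

(** The centred function has Gaussian integral 0, so F(x) is minus the integral over the upper ray,
    where the tail is small. *)
Let F_pos x : 0 < x -> `|F x| <= phi x / x.
Proof.
move=> x_gt0; have FE : F x = - \int[mu]_(t in `]x, +oo[) (q t * phi t).
  apply/eqP; rewrite -addr_eq0 -Rintegral_setU//.
  - rewrite (_ : _ `|` _ = [set: R]) ?q_mean0//.
    apply/seteqP; split=> // t _ /=; rewrite !in_itv/= andbT.
    by case: (leP t x); [left|right].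
  - exact/q_int/measurableU.
  - rewrite disj_set2E; apply/eqP/seteqP; split=> // t /=; rewrite !in_itv/= andbT.
    by case=> /le_lt_trans /[apply]; rewrite ltxx.
rewrite FE normrN; apply: (le_trans (le_int _)) => //.
apply: le_trans (normal_tail_ub x_gt0).
rewrite -Rintegral_itv_obnd_cbnd//; exact: phi_int.
Qed.

Let F_neg x : x < 0 -> `|F x| <= phi x / - x.
Proof.
by move=> x_lt0; apply: le_trans (normal_lower_tail_ub x_lt0); exact: le_int.
Qed.

Let F_le1 x : `|F x| <= 1.
Proof.
apply: (le_trans (le_int _)) => //; rewrite -[leRHS]Rintegral_normal_pdf.
rewrite /Rintegral fine_le//; [exact: integrable_fin_num (phi_int _)..|].
apply: ge0_subset_integral => //.
  by apply/measurable_EFinP; exact: measurable_normal_pdf.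
by move=> t _; rewrite lee_fin normal_pdf_ge0.
Qed.

Lemma stein_solution_mulx x : `|x * f x| <= 1.
Proof.
have p0 := normal_pdf01_gt0 x; rewrite /stein_solution mulrA normrM normfV (gtr0_norm p0).
rewrite ler_pdivrMr// mul1r normrM.
have [x_lt0|x_gt0|->] := ltgtP x 0; last by rewrite normr0 mul0r ltW ?normal_pdf01_gt0.
- by rewrite ltr0_norm// -ler_pdivlMl ?oppr_gt0// mulrC F_neg.
- by rewrite gtr0_norm// -ler_pdivlMl// mulrC F_pos.
Qed.

(** For |x| >= 1 this follows from |x f(x)| <= 1; for |x| < 1 from |F| <= 1 and phi(x) >= phi(1). *)
Lemma stein_solution_le x : `|f x| <= (phi 1)^-1.
Proof.
have p1 := normal_pdf01_gt0 (1 : R); have p1' := normal_pdf01_le1 (1 : R).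
have [x1|x1] := leP 1 `|x|.
  have := stein_solution_mulx x; rewrite normrM => xf.
  apply: (@le_trans _ _ 1); last by rewrite invf_ge1.
  by apply: le_trans xf; rewrite ler_peMl.
have px := normal_pdf01_gt0 x.
rewrite /stein_solution normrM normfV (gtr0_norm px).
rewrite -[leRHS]mul1r ler_pM//; first by rewrite invr_ge0 ltW.
rewrite lef_pV2 ?posrE// !normal_pdf01E ler_wpM2l ?normal_peak_ge0// ler_expR lerN2.
by move: x1; rewrite ltr_norml expr1n => /andP[? ?]; nra.
Qed.

Lemma is_derive_stein_solution x : is_derive x 1 f (x * f x + (h x - c)).
Proof.
have xx : x < x + 1 by lra.
have cq : {for x, continuous (fun t => q t * phi t)}.
  apply: cvgM; last exact: continuous_normal_pdf01.
  by apply: cvgB; [exact: ch|exact: cvg_cst].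
have mray : measurable `]-oo, (x + 1)%R] by [].
have FTC := @continuous_FTC1 R (fun t => q t * phi t) (BInfty R true) x
  (x + 1) xx (q_int mray).
have [|dF F'] := FTC _ cq; first by rewrite ltNyr.
have p0 : phi x != 0 by rewrite gt_eqF// normal_pdf01_gt0.
have isF : is_derive x 1 F (q x * phi x).
  by apply: DeriveDef; [exact: dF|rewrite -derive1E].
have isV : is_derive x 1 (fun t => (phi t)^-1) (x / phi x).
  have pk : @normal_peak R 1 != 0 by rewrite gt_eqF ?normal_peak_gt0 ?oner_neq0.
  have VE t : (phi t)^-1 = (@normal_peak R 1)^-1 * expR (t ^+ 2 / 2).
    by rewrite normal_pdf01E invfM -expRN opprK.
  rewrite VE (_ : (fun t => _) = fun t => (@normal_peak R 1)^-1 * expR (t ^+ 2 / 2)).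
    by apply: is_derive_eq; rewrite /GRing.scale /=; field.
  by apply/funext => t; exact: VE.
have isFV := is_deriveM isF isV; apply: (is_derive_eq isFV).
by rewrite /GRing.scale /= /stein_solution -/(q x); field.
Qed.

End stein_solution.

Lemma mean_value_between (R : realType) (f df : R -> R) (a b : R) :
  (forall x : R, is_derive x 1 f (df x)) ->
  exists2 c, `|c - b| <= `|b - a| & f b - f a = df c * (b - a).
Proof.
move=> fdf; have cf : continuous f.
  move=> x; apply: differentiable_continuous; apply/derivable1_diffP.
  by have dfx := fdf x; exact: ex_derive.
have cfw u v : {within `[u, v], continuous f} by exact: continuous_subspaceT.
have [ab|/ltW ba] := leP a b.
  have [c cab ->] := MVT_segment ab (fun x _ => fdf x) (cfw a b).
  exists c => //; move: cab; rewrite in_itv/= => /andP[ac cb].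
  by rewrite ler0_norm ?subr_le0// ger0_norm ?subr_ge0//; lra.
have [c cba fba] := MVT_segment ba (fun x _ => fdf x) (cfw b a).
exists c; last by rewrite -opprB fba -mulrN opprB.
move: cba; rewrite in_itv/= => /andP[bc ca].
by rewrite ger0_norm ?subr_ge0// ler0_norm ?subr_le0//; lra.
Qed.

(** * Stein's method for weakly dependent sums *)

Section stein_bound.
Context d (T : measurableType d) (R : realType) (P : probability T R) (n : nat).
Variables (X : 'I_n -> T -> R) (near1 near2 : 'I_n -> pred 'I_n) (D1 D2 : nat) (eta : R).
Hypothesis bX : forall i, bmeas (X i).
Hypothesis X_le1 : forall i x, `|X i x| <= 1.
Hypothesis card_near1 : forall i, (#|near1 i| <= D1)%N.
Hypothesis card_near2 : forall i, (#|near2 i| <= D2)%N.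
Local Notation E := (mean P).

Let far i x := \sum_(j < n | ~~ near1 i j) X j x.
Let close i x := \sum_(j < n | near1 i j) X j x.
Let A i x := X i x * close i x.
Let S x := \sum_(j < n) X j x.

Hypothesis eta_ge0 : 0 <= eta.
Hypothesis mixing1 : forall i (g : R -> R) (M : R), measurable_fun [set: R] g ->
  (forall x, `|g x| <= M) -> `|E (fun x => X i x * g (far i x))| <= eta * M.
Hypothesis mixing2 : forall i j, ~~ near1 i j -> `|E (fun x => X i x * X j x)| <= eta.
Hypothesis mixing3 : forall i j, ~~ near2 i j ->
  `|E (fun x => A i x * A j x) - E (A i) * E (A j)| <= eta * D1%:R ^+ 2.

Variable sigma : R.
Hypothesis sigma_gt0 : 0 < sigma.
Hypothesis sigmaE : sigma ^+ 2 = E (fun x => S x ^+ 2).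

Let bS : bmeas S. Proof. exact: bmeas_sum. Qed.
Let bclose i : bmeas (close i). Proof. exact: bmeas_sum. Qed.
Let bfar i : bmeas (far i). Proof. exact: bmeas_sum. Qed.
Let bA i : bmeas (A i). Proof. exact: bmeasM. Qed.
Let W x := S x / sigma.
Let bW : bmeas W. Proof. by apply: bmeasM => //; exact: bmeas_cst. Qed.
(** The random coefficient of f'(W) produced by the local expansion; the normal approximation is
    good when [U] is close to 1. *)
Let U x := (\sum_(i < n) A i x) / sigma ^+ 2.
Let bU : bmeas U. Proof. by apply: bmeasM; [exact: bmeas_sum|exact: bmeas_cst]. Qed.

Let W2 : E (fun x => W x ^+ 2) = 1.
Proof.
have -> : E (fun x => W x ^+ 2) = E (fun x => S x ^+ 2 / sigma ^+ 2).
  by apply: eq_mean => x; rewrite expr_div_n.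
rewrite meanZr; last exact: bmeasX.
by rewrite -sigmaE divff// gt_eqF// exprn_gt0.
Qed.

Let W_abs : E (fun x => `|W x|) <= 1.
Proof. by apply: le_trans (mean_norm_le P bW) _; rewrite W2 sqrtr1. Qed.

Let close_le i x : `|close i x| <= D1%:R.
Proof.
apply: le_trans (ler_norm_sum _ _ _) _.
apply: (@le_trans _ _ (\sum_(j < n | near1 i j) 1)); first exact: ler_sum.
by rewrite sumr_const ler_nat.
Qed.

Let A_le i x : `|A i x| <= D1%:R.
Proof. by rewrite normrM -[leRHS]mul1r ler_pM. Qed.

Let S_split i x : S x = close i x + far i x.
Proof. by rewrite /S (bigID (near1 i)). Qed.

(** Since W^2 has mean 1, the difference 1 - E U is the sum of the correlations of pairs that are
    not near each other. *)
Lemma stein_mean_U : `|1 - E U| <= n%:R ^+ 2 * eta / sigma ^+ 2.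
Proof.
have s2 : 0 < sigma ^+ 2 by rewrite exprn_gt0.
have -> : 1 - E U =
    (\sum_(i < n) \sum_(j < n | ~~ near1 i j) E (fun x => X i x * X j x)) / sigma ^+ 2.
  rewrite -W2 -meanB//; last exact: bmeasX.
  have bXX i : bmeas (fun x => \sum_(j < n | ~~ near1 i j) X i x * X j x).
    by apply: bmeas_sum => j; exact: bmeasM.
  transitivity (E (fun x => (\sum_(i < n) \sum_(j < n | ~~ near1 i j) X i x * X j x) / sigma ^+ 2)).
    apply: eq_mean => x; rewrite /W /U expr_div_n -mulrBl; congr (_ / _).
    rewrite expr2 {1}/S mulr_suml -sumrB; apply: eq_bigr => i _.
    by rewrite (S_split i) /A mulrDr addrAC subrr add0r mulr_sumr.
  rewrite meanZr; last exact: bmeas_sum.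
  rewrite mean_sum//; congr (_ / _); apply: eq_bigr => i _.
  by rewrite mean_sum// => j; exact: bmeasM.
rewrite normrM normfV (gtr0_norm s2) ler_pM2r ?invr_gt0//.
apply: le_trans (ler_norm_sum _ _ _) _.
apply: (@le_trans _ _ (\sum_(i < n) n%:R * eta)); last first.
  by rewrite sumr_const card_ord -[leLHS]mulr_natl mulrA expr2.
apply: ler_sum => i _; apply: le_trans (ler_norm_sum _ _ _) _.
apply: (@le_trans _ _ (\sum_(j < n | ~~ near1 i j) eta)).
  by apply: ler_sum => j; exact: mixing2.
rewrite sumr_const -[leLHS]mulr_natl ler_wpM2r// ler_nat.
by rewrite -[leqRHS](card_ord n) max_card.
Qed.

(** For each i, at most D2 indices j are charged the crude covariance bound 2 D1^2; the others are
    charged only eta D1^2. *)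
Lemma stein_var_U : E (fun x => (U x - E U) ^+ 2) <=
  n%:R * D1%:R ^+ 2 * (2 * D2%:R + n%:R * eta) / sigma ^+ 4.
Proof.
have s4 : 0 < sigma ^+ 4 by rewrite exprn_gt0.
pose B i x := A i x - E (A i).
have bB i : bmeas (B i) by apply: bmeasB => //; exact: bmeas_cst.
have BB i j : E (fun x => B i x * B j x) = E (fun x => A i x * A j x) - E (A i) * E (A j).
  transitivity (E (fun x => (A i x * A j x - E (A j) * A i x) -
      (E (A i) * A j x - E (A i) * E (A j)))).
    by apply: eq_mean => x; rewrite /B; ring.
  have bc c : bmeas (fun _ : T => c : R) := bmeas_cst _ c.
  have bZ c g : bmeas g -> bmeas (fun x : T => c * g x) by exact: bmeasZ.
  rewrite !meanB//; do ?[exact: bmeasM|exact: bZ|exact: bc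
    |by apply: bmeasB; do ?[exact: bmeasM|exact: bZ|exact: bc]].
  by rewrite !meanZl// mean_cst; ring.
have -> : E (fun x => (U x - E U) ^+ 2) =
    (\sum_(i < n) \sum_(j < n) E (fun x => B i x * B j x)) / sigma ^+ 4.
  transitivity (E (fun x => (\sum_(i < n) \sum_(j < n) B i x * B j x) / sigma ^+ 4)).
    apply: eq_mean => x; rewrite -big_distrlr/= -expr2.
    have -> : E U = (\sum_(i < n) E (A i)) / sigma ^+ 2.
      by rewrite meanZr ?mean_sum//; exact: bmeas_sum.
    rewrite /U -mulrBl -sumrB exprMn; congr (_ * _).
    by rewrite exprVn -exprM.
  have bBB i : bmeas (fun x => \sum_(j < n) B i x * B j x).
    by apply: bmeas_sum => j; exact: bmeasM.
  rewrite meanZr; last exact: bmeas_sum.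
  rewrite mean_sum//; congr (_ / _); apply: eq_bigr => i _.
  by rewrite mean_sum// => j; exact: bmeasM.
rewrite ler_pM2r ?invr_gt0//.
apply: (@le_trans _ _ (\sum_(i < n) D1%:R ^+ 2 * (2 * D2%:R + n%:R * eta))); last first.
  by rewrite sumr_const card_ord -[leLHS]mulr_natl mulrA.
apply: ler_sum => i _; rewrite (bigID (near2 i))/= mulrDr; apply: lerD.
  apply: (@le_trans _ _ (\sum_(j < n | near2 i j) 2 * D1%:R ^+ 2)).
    apply: ler_sum => j _; rewrite BB; apply: le_trans (ler_norm _) _.
    apply: le_trans (ler_normB _ _) _; rewrite mulr2n mulrDl mul1r; apply: lerD.
      apply: normr_mean_le; first exact: bmeasM.
      by move=> x; rewrite normrM expr2 ler_pM.
    by rewrite normrM expr2 ler_pM//; apply: normr_mean_le.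
  rewrite sumr_const -[leLHS]mulr_natl.
  rewrite [leRHS](_ : _ = D2%:R * (2 * D1%:R ^+ 2)); last by ring.
  by rewrite ler_wpM2r ?mulr_ge0 ?sqr_ge0// ler_nat card_near2.
apply: (@le_trans _ _ (\sum_(j < n | ~~ near2 i j) eta * D1%:R ^+ 2)).
  by apply: ler_sum => j ij; rewrite BB; apply: le_trans (ler_norm _) _; exact: mixing3.
rewrite sumr_const -[leLHS]mulr_natl.
rewrite [leRHS](_ : _ = n%:R * (eta * D1%:R ^+ 2)); last by ring.
rewrite ler_wpM2r ?mulr_ge0 ?sqr_ge0//.
by rewrite ler_nat -[leqRHS](card_ord n) max_card.
Qed.

Variables (f h : R -> R) (c B L : R).
Hypothesis fdf : forall x : R, is_derive x 1 f (x * f x + (h x - c)).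
Hypothesis f_le : forall x, `|f x| <= B.
Hypothesis xf_le : forall x, `|x * f x| <= 1.
Hypothesis h01 : forall x, 0 <= h x <= 1.
Hypothesis c01 : 0 <= c <= 1.
Hypothesis mh : measurable_fun [set: R] h.
Hypothesis h_lip : forall x y, `|h x - h y| <= L * `|x - y|.

Let df x := x * f x + (h x - c).

Let df_le x : `|df x| <= 2.
Proof.
have hc1 : `|h x - c| <= 1 by have := h01 x; move: c01; rewrite ler_norml; lra.
by apply: le_trans (ler_normD _ _) _; have := lerD (xf_le x) hc1; lra.
Qed.

Let mf : measurable_fun [set: R] f.
Proof.
apply: continuous_measurable_fun => x.
apply: differentiable_continuous; apply/derivable1_diffP.
by have dfx := fdf x; exact: ex_derive.
Qed.

Let mdf : measurable_fun [set: R] df.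
Proof.
by apply: measurable_funD; [exact: measurable_funM|exact: measurable_funB].
Qed.

Let bcomp (g : R -> R) (V : T -> R) M : measurable_fun [set: R] g ->
  (forall x, `|g x| <= M) -> bmeas V -> bmeas (fun x => g (V x)).
Proof. by move=> mg gM [mV _]; apply: (bmeas_comp (bmeasW mg gM)). Qed.

Let B_ge0 : 0 <= B. Proof. exact: le_trans (normr_ge0 _) (f_le 0). Qed.

Let L_ge0 : 0 <= L.
Proof.
by have := h_lip 1 0; have := normr_ge0 (h 1 - h 0); rewrite subr0 normr1; lra.
Qed.

(** As h is only Lipschitz, f' is controlled through the equation itself: f'(z) - f'(b) = (z - b)
    f(z) + b (f(z) - f(b)) + h(z) - h(b). The derivative is taken at b, later equal to W, so that
    the factor |b| is harmless: E |W| <= 1. *)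
Lemma stein_taylor a b : `|f b - f a - (b - a) * df b| <=
  (b - a) ^+ 2 * (B + L + 2 * `|b|).
Proof.
have lip x y : `|f y - f x| <= 2 * `|y - x|.
  by have [z _ ->] := mean_value_between x y fdf; rewrite normrM ler_wpM2r//; exact: df_le.
have [z zb ->] := mean_value_between a b fdf.
rewrite [(b - a) * _]mulrC -mulrBl normrM mulrC.
rewrite -[(b - a) ^+ 2]real_normK ?num_real// expr2 -mulrA ler_wpM2l//.
have -> : df z - df b = (z - b) * f z + b * (f z - f b) + (h z - h b) by rewrite /df; ring.
have r0 := normr_ge0 (b - a).
apply: le_trans (ler_normD _ _) _.
apply: (@le_trans _ _ (`|b - a| * B + `|b| * (2 * `|b - a|) + L * `|b - a|)); last by lra.
apply: lerD; last first.
  by apply: le_trans (h_lip _ _) _; rewrite ler_wpM2l.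
apply: le_trans (ler_normD _ _) _; rewrite !normrM; apply: lerD; first by rewrite ler_pM.
by rewrite ler_wpM2l//; apply: le_trans (lip _ _) _; rewrite ler_wpM2l.
Qed.

Theorem stein_bound :
  `|E (fun x => h (W x)) - c| <=
    n%:R * eta * B / sigma + n%:R * D1%:R ^+ 2 * (B + L + 2) / sigma ^+ 3 +
    2 * (n%:R ^+ 2 * eta / sigma ^+ 2 +
         Num.sqrt (n%:R * D1%:R ^+ 2 * (2 * D2%:R + n%:R * eta) / sigma ^+ 4)).
Proof.
have s_neq0 : sigma != 0 by rewrite gt_eqF.
have n_ge0 : 0 <= n%:R :> R by [].
pose V i x := far i x / sigma.
pose Rm i x := f (W x) - f (V i x) - (W x - V i x) * df (W x).
have bV i : bmeas (V i) by apply: bmeasM => //; exact: bmeas_cst.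
have bfW : bmeas (fun x => f (W x)) := bcomp mf f_le bW.
have bfV i : bmeas (fun x => f (V i x)) := bcomp mf f_le (bV i).
have bdfW : bmeas (fun x => df (W x)) := bcomp mdf df_le bW.
have WV i x : W x - V i x = close i x / sigma by rewrite /W /V (S_split i) mulrDl addrK.
have bRm i : bmeas (Rm i).
  apply: bmeasB; [exact: bmeasB|apply: bmeasM => //; exact: bmeasB].
have bh : bmeas (fun x => h (W x)).
  by apply: (bcomp (M := 1) mh _ bW) => x; have := h01 x; rewrite ler_norml; lra.
(* Each X_i f(W) becomes X_i f(V_i), plus A_i f'(W) / sigma, plus a Taylor remainder. The middle
   terms add up to sigma U f'(W). *)
have split_h x : h (W x) - c = df (W x) * (1 - U x) -
    (\sum_(i < n) X i x * f (V i x) + \sum_(i < n) X i x * Rm i x) / sigma.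
  have -> : h (W x) - c = df (W x) - W x * f (W x) by rewrite /df addrAC subrr add0r.
  have -> : W x * f (W x) = (\sum_(i < n) X i x * f (W x)) / sigma.
    by rewrite /W /S mulrAC mulr_suml.
  have -> : df (W x) * (1 - U x) = df (W x) - (\sum_(i < n) A i x * df (W x) / sigma) / sigma.
    rewrite mulrBr mulr1 /U; congr (_ - _); rewrite -!mulr_suml; field.
    by [].
  suff -> : \sum_(i < n) X i x * f (W x) = \sum_(i < n) A i x * df (W x) / sigma +
      (\sum_(i < n) X i x * f (V i x) + \sum_(i < n) X i x * Rm i x).
    by rewrite mulrDl opprD addrA.
  rewrite -!big_split/=; apply: eq_bigr => i _; rewrite /Rm WV /A.
  by move: (f _) (f _) (df _) (close i x) (X i x) => a1 a2 a3 a4 a5; field.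
have bXf i : bmeas (fun x => X i x * f (V i x)) by exact: bmeasM.
have bXR i : bmeas (fun x => X i x * Rm i x) by exact: bmeasM.
have bs1 : bmeas (fun x => \sum_(i < n) X i x * f (V i x)) by exact: bmeas_sum.
have bs2 : bmeas (fun x => \sum_(i < n) X i x * Rm i x) by exact: bmeas_sum.
have b1U : bmeas (fun x => 1 - U x) by apply: bmeasB => //; exact: bmeas_cst.
have bdU : bmeas (fun x => df (W x) * (1 - U x)) by exact: bmeasM.
have bc : bmeas (fun _ : T => c) := bmeas_cst _ c.
have hE : E (fun x => h (W x)) - c = E (fun x => df (W x) * (1 - U x)) -
    (\sum_(i < n) E (fun x => X i x * f (V i x)) +
     \sum_(i < n) E (fun x => X i x * Rm i x)) / sigma.
  rewrite -[c in LHS](mean_cst P) -meanB// (eq_mean P split_h).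
  rewrite meanB//; last by apply: bmeasM; [exact: bmeasD|exact: bmeas_cst].
  by rewrite meanZr; [rewrite meanD// !mean_sum|exact: bmeasD].
rewrite hE; apply: le_trans (ler_normB _ _) _; rewrite addrC.
apply: lerD.
  rewrite normrM normfV (gtr0_norm sigma_gt0).
  have -> : n%:R * eta * B / sigma + n%:R * D1%:R ^+ 2 * (B + L + 2) / sigma ^+ 3 =
      (n%:R * (eta * B) + n%:R * (D1%:R ^+ 2 * (B + L + 2) / sigma ^+ 2)) / sigma by field.
  rewrite ler_pM2r ?invr_gt0//; apply: le_trans (ler_normD _ _) _; apply: lerD.
    apply: le_trans (ler_norm_sum _ _ _) _.
    apply: (@le_trans _ _ (\sum_(i < n) eta * B)); last first.
      by rewrite sumr_const card_ord -[leLHS]mulr_natl.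
    apply: ler_sum => i _; apply: (mixing1 i (g := fun t => f (t / sigma))) => //.
    apply: measurableT_comp => //; apply: measurable_funM => //; exact: measurable_cst.
  apply: le_trans (ler_norm_sum _ _ _) _.
  apply: (@le_trans _ _ (\sum_(i < n) D1%:R ^+ 2 * (B + L + 2) / sigma ^+ 2)); last first.
    by rewrite sumr_const card_ord -[leLHS]mulr_natl.
  apply: ler_sum => i _; apply: le_trans (normr_mean P (bXR i)) _.
  have baW := bmeas_norm bW; have bBL := bmeas_cst T (B + L : R).
  apply: (@le_trans _ _ (E (fun x => (D1%:R / sigma) ^+ 2 * ((B + L) + 2 * `|W x|)))); last first.
    rewrite meanZl; last by apply: bmeasD => //; exact: bmeasZ.
    rewrite meanD//; last exact: bmeasZ.
    rewrite mean_cst meanZl// expr_div_n mulrAC ler_pM2r ?invr_gt0 ?exprn_gt0//.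
    by rewrite ler_wpM2l ?sqr_ge0// lerD2l -[leRHS]mulr1 ler_wpM2l.
  apply: le_mean; [exact: bmeas_norm|by apply: bmeasZ; apply: bmeasD => //; exact: bmeasZ|].
  move=> x; rewrite normrM -[leRHS]mul1r ler_pM//.
  apply: le_trans (stein_taylor _ _) _; apply: ler_wpM2r; first by rewrite !addr_ge0// mulr_ge0.
  rewrite WV -[(close i x / sigma) ^+ 2]real_normK ?num_real// ler_sqr
    ?nnegrE ?divr_ge0 ?(ltW sigma_gt0)//.
  by rewrite normrM normfV (gtr0_norm sigma_gt0) ler_pM2r ?invr_gt0.
apply: le_trans (normr_mean P bdU) _.
have bUE : bmeas (fun x => U x - E U) by apply: bmeasB => //; exact: bmeas_cst.
have b1 : bmeas (fun _ : T => `|1 - E U|) := bmeas_cst _ _.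
(* The factor 2 is the bound on |f'|; the fluctuation of [U] will be passed to its variance. *)
apply: (@le_trans _ _ (E (fun x => 2 * (`|1 - E U| + `|U x - E U|)))).
  apply: le_mean; [exact: bmeas_norm|by apply: bmeasZ; apply: bmeasD => //; exact: bmeas_norm|].
  move=> x; rewrite normrM ler_pM//.
  by rewrite (_ : 1 - U x = (1 - E U) - (U x - E U)) ?ler_normB//; ring.
rewrite meanZl; last by apply: bmeasD => //; exact: bmeas_norm.
rewrite meanD//; last exact: bmeas_norm.
rewrite ler_wpM2l// mean_cst lerD ?stein_mean_U//.
apply: le_trans (mean_norm_le P bUE) _.
by rewrite ler_wsqrtr// stein_var_U.
Qed.


End stein_bound.

(** * From ramps to distribution functions *)

Section smoothed_indicator.
Variable R : realType.
Local Notation mu := (@lebesgue_measure R).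
Local Notation phi := (@normal_pdf R 0 1).
Implicit Types z delta x y : R.

Definition ramp z delta x : R := Num.max 0 (Num.min 1 ((z + delta - x) / delta)).

Lemma ramp01 z delta x : 0 <= ramp z delta x <= 1.
Proof. by rewrite /ramp le_max lexx ge_max ler01 ge_min lexx. Qed.

Lemma ramp_left z delta x : 0 < delta -> x <= z -> ramp z delta x = 1.
Proof.
move=> d0 xz; rewrite /ramp min_l ?max_r//.
by rewrite ler_pdivlMr//; lra.
Qed.

Lemma ramp_right z delta x : 0 < delta -> z + delta <= x -> ramp z delta x = 0.
Proof.
move=> d0 xz; rewrite /ramp max_l// ge_min; apply/orP; right.
by rewrite pmulr_lle0 ?invr_gt0//; lra.
Qed.

Lemma ramp_lip z delta x y : 0 < delta ->
  `|ramp z delta x - ramp z delta y| <= delta^-1 * `|x - y|.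
Proof.
move=> d0; have -> : delta^-1 * `|x - y| = `|(z + delta - x) / delta - (z + delta - y) / delta|.
  rewrite -mulrBl normrM normfV (gtr0_norm d0) mulrC; congr (_ / _).
  by rewrite distrC; congr (`|_|); ring.
rewrite /ramp; move: ((z + delta - x) / delta) ((z + delta - y) / delta) => a b.
have lr u v : `|u - v| <= `|a - b| -> `|Num.max 0 u - Num.max 0 v| <= `|a - b|.
  move=> /le_trans H; apply: le_trans (H _ (lexx _)).
  by rewrite ler_norml; have [] := leP 0 u; have [] := leP 0 v; case: (ler0P (u - v)); lra.
apply: lr; rewrite ler_norml; have [] := leP 1 a; have [] := leP 1 b;
  case: (ler0P (a - b)); lra.
Qed.

Lemma continuous_ramp z delta : 0 < delta -> continuous (ramp z delta).
Proof.
move=> d0 x; apply/cvgrPdist_lt => e e0; near=> y.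
apply: le_lt_trans (ramp_lip _ _ _ d0) _; rewrite mulrC ltr_pdivrMr//.
near: y; apply: cvgr_dist_lt; [exact: cvg_id|exact: mulr_gt0].
Unshelve. all: by end_near. Qed.

Definition normal_cdf z : R := fine (normal_prob 0 1 `]-oo, z]).

Let phi_int (A : set R) : measurable A -> mu.-integrable A (EFin \o phi).
Proof. by move=> mA; apply: integrableS (integrable_normal_pdf 0 1). Qed.

Lemma normal_cdf_mono z delta : 0 < delta ->
  normal_cdf z <= normal_cdf (z + delta) <= normal_cdf z + delta.
Proof.
move=> d0; have -> : normal_cdf (z + delta) =
    normal_cdf z + \int[mu]_(t in `]z, (z + delta)]) phi t.
  rewrite /normal_cdf -Rintegral_setU//.
  - congr fine; congr integral; apply/seteqP; split=> t /=; rewrite !in_itv/=.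
      by case: (leP t z) => tz ?; [left|right].
    by case=> [tz|/andP[_ //]]; lra.
  - exact/phi_int/measurableU.
  - rewrite disj_set2E; apply/eqP/seteqP; split=> // t /=; rewrite !in_itv/=.
    by case=> tz /andP[]; rewrite ltNge tz.
rewrite lerDl Rintegral_ge0/= => [|t _]; last exact: normal_pdf_ge0.
have muE : mu `]z, (z + delta)%R] = delta%:E.
  by rewrite lebesgue_measure_itv/= lte_fin ltrDl d0 -EFinB addrAC subrr add0r.
rewrite lerD2l; apply: (@le_trans _ _ (\int[mu]_(t in `]z, (z + delta)]) 1)).
  apply: le_Rintegral => //; [exact: phi_int| |by move=> t _; exact: normal_pdf01_le1].
  have fin : (mu `]z, (z + delta)%R] < +oo)%E by rewrite muE ltry.
  exact: (@measurable_bounded_integrable _ (measurableTypeR R) R mu (cst 1) _ _ fin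
    (measurable_cst _) (bounded_cst _ _)).
by rewrite Rintegral_cst// mul1r -[X in fine X]/(mu `]z, (z + delta)%R]) muE.
Qed.

Lemma normal_mean_ramp z delta : 0 < delta ->
  normal_cdf z <= normal_mean (ramp z delta) <= normal_cdf z + delta.
Proof.
move=> d0; have /andP[_ cdf_le] := normal_cdf_mono z d0.
have cdfE t : normal_cdf t = \int[mu]_x (\1_`]-oo, t] x * phi x).
  rewrite /normal_cdf -[LHS]/(\int[mu]_(x in `]-oo, t]) phi x) Rintegral_mkcond.
  apply: eq_Rintegral => x _; rewrite patchE indicE.
  by case: ifP => _; rewrite ?mul1r ?mul0r.
have int_mul (g : R -> R) : measurable_fun [set: R] g -> (forall t, `|g t| <= 1) ->
    mu.-integrable [set: R] (EFin \o (fun t => g t * phi t)).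
  move=> mg g1; refine (@le_integrable _ (measurableTypeR R) R mu setT measurableT
    (EFin \o (fun t => g t * phi t)) (EFin \o phi) _ _ (phi_int measurableT)).
    apply/measurable_EFinP; apply: measurable_funM => //; exact: measurable_normal_pdf.
  by move=> t _; rewrite lee_fin normrM ler_piMl.
have ind1 (A : set R) t : `|\1_A t| <= 1 :> R.
  by rewrite indicE; case: (_ \in _); rewrite ?normr1 ?normr0.
have int_ramp : mu.-integrable [set: R] (EFin \o (fun t => ramp z delta t * phi t)).
  apply: int_mul; first by apply: continuous_measurable_fun; exact: continuous_ramp.
  by move=> t; have /andP[? ?] := ramp01 z delta t; rewrite ger0_norm.
have int_ind t : mu.-integrable [set: R] (EFin \o (fun x => \1_`]-oo, t] x * phi x)).
  by apply: int_mul => //; exact: measurable_indic.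
apply/andP; split; last apply: le_trans cdf_le; rewrite cdfE; apply: le_Rintegral => // x _;
  rewrite ler_wpM2r ?normal_pdf_ge0// indicE.
  case: (boolP (x \in _)) => [|_]; last by case/andP: (ramp01 z delta x).
  by rewrite inE/= in_itv/= => xz; rewrite ramp_left.
case: (boolP (x \in _)) => [_|]; first by case/andP: (ramp01 z delta x).
by rewrite notin_setE/= in_itv/= => /negP; rewrite -ltNge => zx; rewrite (ramp_right d0 (ltW zx)).
Qed.

(** The indicator of W <= z lies between the ramps started at z - delta and at z. The Gaussian means
    of both differ from the distribution function at z by at most delta, because the density is at
    most 1. *)
Lemma cdf_dist_le d (T : measurableType d) (P : probability T R) (W : T -> R) delta e z :
  measurable_fun [set: T] W -> 0 < delta ->
  (forall z, `|mean P (fun u : T => ramp z delta (W u)) - normal_mean (ramp z delta)| <= e) ->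
  `|fine (P [set u : T | W u <= z]) - normal_cdf z| <= e + delta.
Proof.
move=> mW d0 We; set A := [set u : T | _].
have mA : measurable A.
  rewrite -[A]setTI (_ : A = W @^-1` `]-oo, z]); first exact: mW.
  by apply/seteqP; split=> x /=; rewrite in_itv.
have bA : bmeas (\1_A : T -> R).
  apply: (@bmeasW _ _ _ _ 1); first exact: measurable_indic.
  by move=> x; rewrite indicE; case: (_ \in _); rewrite ?normr1 ?normr0.
have PA : fine (P A) = mean P \1_A by rewrite mean_indic.
have br t : bmeas (fun u : T => ramp t delta (W u)).
  apply: (@bmeasW _ _ _ _ 1).
    by apply: measurableT_comp => //; apply: continuous_measurable_fun; exact: continuous_ramp.
  by move=> x; have /andP[? ?] := ramp01 t delta (W x); rewrite ger0_norm.
have up : mean P \1_A <= mean P (fun u : T => ramp z delta (W u)).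
  apply: le_mean => // x; rewrite indicE; case: (boolP (x \in A)) => [|_].
    by rewrite inE => xA; rewrite ramp_left.
  by case/andP: (ramp01 z delta (W x)).
have lo : mean P (fun u : T => ramp (z - delta) delta (W u)) <= mean P \1_A.
  apply: le_mean => // x; rewrite indicE; case: (boolP (x \in A)) => [_|].
    by case/andP: (ramp01 (z - delta) delta (W x)).
  by rewrite notin_setE => /negP; rewrite -ltNge => zW; rewrite ramp_right// subrK ltW.
have /andP[_ h1] := normal_mean_ramp z d0.
have /andP[h2 _] := normal_mean_ramp (z - delta) d0.
have := normal_cdf_mono (z - delta) d0; rewrite subrK => /andP[_ h3].
have := We z; have := We (z - delta); rewrite PA !ler_norml; lra.
Qed.

End smoothed_indicator.

Lemma sum_ltn_nat (R : pzSemiRingType) m a : \sum_(j < m) (j < a)%N%:R = (minn a m)%:R :> R.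
Proof.
elim: m => [|m IH]; first by rewrite big_ord0 minn0.
rewrite big_ord_recr/= IH -natrD; congr (_%:R).
by case: ltnP; lia.
Qed.

(** * Functionals determined by their values on indicators *)

Section indicator_functional.
Context d (T : measurableType d) (R : realType) (E1 E2 : (T -> R) -> R).

(** What the mean under the law of Y and [gibbs_mean], a ratio of integrals, have in common. Uniform
    approximation by step functions turns agreement on indicators into equality. *)
Definition mean_like (E : (T -> R) -> R) :=
  [/\ forall f g, bmeas f -> bmeas g -> E (fun x => f x + g x) = E f + E g,
      forall c f, bmeas f -> E (fun x => c * f x) = c * E f,
      forall c, E (fun=> c) = c &
      forall f g, bmeas f -> bmeas g -> (forall x, f x <= g x) -> E f <= E g].

Lemma bmeas_indic (A : set T) : measurable A -> bmeas (\1_A : T -> R).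
Proof.
move=> mA; apply: (@bmeasW _ _ _ _ 1); first exact: measurable_indic.
by move=> x; rewrite indicE; case: (_ \in _); rewrite ?normr1 ?normr0.
Qed.

Hypothesis E1P : mean_like E1.
Hypothesis E2P : mean_like E2.
Hypothesis E12 : forall A, measurable A -> E1 \1_A = E2 \1_A.

Lemma mean_like_sum (E : (T -> R) -> R) (m : nat) (F : nat -> T -> R) : mean_like E ->
  (forall j, bmeas (F j)) -> E (fun x => \sum_(j < m) F j x) = \sum_(j < m) E (F j).
Proof.
move=> [ED _ Ec _] bF; elim: m => [|m IH].
  rewrite big_ord0 -[RHS](Ec 0); congr E.
  by apply/funext => x; rewrite big_ord0.
rewrite big_ord_recr/= -IH -ED//; last exact: bmeas_sum.
by congr E; apply/funext => x; rewrite big_ord_recr.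
Qed.

(* [f] is within [1 / m] of the average of the indicators of [j / m <= f]. *)
Lemma eq_mean_like01 f : bmeas f -> (forall x, 0 <= f x <= 1) -> E1 f = E2 f.
Proof.
move=> bf f01; suff dist m : `|E1 f - E2 f| <= m.+1%:R^-1.
  apply/eqP; rewrite -subr_eq0 -normr_le0; apply/ler_addgt0Pr => e e0; rewrite add0r.
  apply: le_trans (dist (Num.truncn e^-1)) _.
  rewrite invf_ple ?posrE ?ltr0n// ltW//; exact: truncnS_gt.
pose s x : R := m.+1%:R^-1 * \sum_(j < m.+1) \1_[set x | j.+1%:R <= m.+1%:R * f x] x.
have m0 : 0 < m.+1%:R :> R by rewrite ltr0n.
have mA j : measurable [set x | j.+1%:R <= m.+1%:R * f x].
  rewrite -[X in measurable X]setTI (_ : [set x | _] =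
    (fun x => m.+1%:R * f x) @^-1` `[j.+1%:R, +oo[).
    by apply: measurable_funM; [exact: measurable_cst|case: bf| |].
  by apply/seteqP; split=> x /=; rewrite in_itv/= andbT.
have bI j : bmeas (\1_[set x | j.+1%:R <= m.+1%:R * f x] : T -> R) := bmeas_indic (mA j).
have bS : bmeas (fun x => \sum_(j < m.+1) \1_[set x | j.+1%:R <= m.+1%:R * f x] x : R).
  exact: bmeas_sum.
have bs : bmeas s by exact: bmeasZ.
have sE : E1 s = E2 s.
  case: (E1P) (E2P) => _ Z1 _ _ [_ Z2 _ _].
  rewrite /s Z1// Z2//; congr (_ * _).
  rewrite (mean_like_sum _ E1P bI) (mean_like_sum _ E2P bI).
  by apply: eq_bigr => j _; exact: E12.
have close x : s x <= f x <= s x + m.+1%:R^-1.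
  have [f0 f1] := andP (f01 x).
  pose a := Num.truncn (m.+1%:R * f x).
  have mf0 : 0 <= m.+1%:R * f x by rewrite mulr_ge0.
  have /andP[a1 a2] := truncn_itv mf0.
  have am : (a <= m.+1)%N.
    by rewrite -(ler_nat R); apply: le_trans a1 _; rewrite -[leRHS]mulr1 ler_wpM2l.
  have SE : \sum_(j < m.+1) \1_[set x | j.+1%:R <= m.+1%:R * f x] x = a%:R :> R.
    have := sum_ltn_nat R m.+1 a; rewrite (minn_idPl am) => <-.
    apply: eq_bigr => j _; rewrite indicE; congr ((nat_of_bool _)%:R).
    apply/idP/idP; rewrite inE/=.
      by move=> jf; rewrite -ltnS -(ltr_nat R); exact: le_lt_trans jf a2.
    by move=> ja; apply: le_trans a1; rewrite ler_nat.
  rewrite /s SE; apply/andP; split; first by rewrite ler_pdivrMl.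
  rewrite -[X in _ + X]mulr1 -mulrDr ler_pdivlMl//; apply: ltW.
  by apply: lt_le_trans a2 _; rewrite -natr1.
case: (E1P) (E2P) => D1 _ c1 m1 [D2 _ c2 m2].
have bc : bmeas (fun _ : T => m.+1%:R^-1 : R) := bmeas_cst _ _.
have bse : bmeas (fun x => s x + m.+1%:R^-1) by exact: bmeasD.
have lo1 : E1 s <= E1 f by apply: m1 => // x; case/andP: (close x).
have lo2 : E2 s <= E2 f by apply: m2 => // x; case/andP: (close x).
have up1 : E1 f <= E1 s + m.+1%:R^-1.
  by rewrite -[X in _ + X]c1 -D1//; apply: m1 => // x; case/andP: (close x).
have up2 : E2 f <= E2 s + m.+1%:R^-1.
  by rewrite -[X in _ + X]c2 -D2//; apply: m2 => // x; case/andP: (close x).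
move: lo1 lo2 up1 up2; rewrite sE ler_norml.
by move: (E1 f) (E2 f) (E2 s) (m.+1%:R^-1) => u v t r; lra.
Qed.

Lemma eq_mean_like f : bmeas f -> E1 f = E2 f.
Proof.
(* The added 1 keeps M positive even when f = 0; an affine map then sends [-M, M] onto [0, 1]. *)
move=> bf; have [mf [M0 fM0]] := bf; pose M := `|M0| + 1.
have M_gt0 : 0 < M by rewrite /M ltr_wpDl.
have fM x : `|f x| <= M by apply: le_trans (fM0 x) _; rewrite /M; have := ler_norm M0; lra.
pose g x := (2 * M)^-1 * (f x + M).
have bM : bmeas (fun _ : T => M) := bmeas_cst _ _.
have bfM : bmeas (fun x => f x + M) by exact: bmeasD.
have bg : bmeas g by exact: bmeasZ.
have gE : E1 g = E2 g.
  apply: eq_mean_like01 => // x; have := fM x; rewrite ler_norml => /andP[f1 f2].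
  rewrite /g mulrC; apply/andP; split; first by rewrite divr_ge0; lra.
  by rewrite ler_pdivrMr; lra.
have fE : f = fun x => 2 * M * g x + - M.
  by apply/funext => x; rewrite /g mulrA divff ?mul1r ?addrK// gt_eqF// mulr_gt0.
have bN : bmeas (fun _ : T => - M) := bmeas_cst _ _.
have bZg : bmeas (fun x => 2 * M * g x) by exact: bmeasZ.
case: (E1P) (E2P) => D1 Z1 c1 _ [D2 Z2 c2 _].
by rewrite fE D1// D2// Z1// Z2// c1 c2 gE.
Qed.

End indicator_functional.

(** * Lebesgue measure on the cube as a power of the uniform law *)

Section lebesgue_cube.
Variable R : realType.
Local Notation X := (measurableTypeR R).
Local Notation mu := (@lebesgue_measure R).

Definition unit_uniform : probability X R := uniform_prob (@ltr01 R).
Local Notation tp n := (tuple_prob unit_uniform n).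

Lemma mean_unit_uniform (g : X -> R) : bmeas g -> (forall x, 0 <= g x) ->
  (\int[mu]_(x in `[0%R, 1%R]) (g x)%:E)%E = (mean unit_uniform g)%:E.
Proof.
move=> bg g0; rewrite -mean_EFin//.
rewrite [RHS](integral_uniform (@ltr01 R)) ?subr0 ?invr1 ?mul1e//.
by apply/measurable_EFinP; case: bg.
Qed.

Lemma mean_unit_uniform_indic (A : set X) : measurable A ->
  mean unit_uniform \1_A = fine (mu (A `&` `[0%R, 1%R])).
Proof.
move=> mA; rewrite -[LHS]/(fine (mean unit_uniform \1_A)%:E) -mean_unit_uniform.
- by rewrite integral_indic.
- exact: bmeas_indic.
- by move=> x; rewrite indicE.
Qed.

Lemma measurable_unit_cube n : measurable (@unit_cube R n).
Proof.
rewrite (_ : @unit_cube R n =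
  \bigcap_(i in [set: 'I_n]) (@tnth n X ^~ i) @^-1` `[0%R, 1%R]).
  apply: fin_bigcap_measurable => // i _.
  by rewrite -[X in measurable X]setTI; exact: measurable_tnth.
apply/seteqP; split=> y yc i; [move=> _|]; rewrite /= ?in_itv/=; first exact: yc.
by have := yc i I; rewrite /= in_itv.
Qed.

Lemma unit_cube_cons n (x : X) (t : n.-tuple X) :
  unit_cube (pair_cons (x, t)) <-> (0 <= x <= 1 /\ unit_cube t).
Proof.
have coordS i : Defs.coord (pair_cons (x, t)) (lift ord0 i) = Defs.coord t i.
  exact: tnth_pair_consS.
split=> [xt|[x01 tc] i].
  split; first by have := xt ord0.
  by move=> i; rewrite -coordS; exact: xt.
by case: (unliftP ord0 i) => [j|] ->; [rewrite coordS; exact: tc|].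
Qed.

Lemma bmeas_unit_cube n : bmeas (\1_(@unit_cube R n) : n.-tuple X -> R).
Proof. exact: bmeas_indic (@measurable_unit_cube n). Qed.

(** The cube enters as an indicator on the whole space because the tuple measure is an iterated
    pushforward of products: the indicator splits into a head and a tail factor, and the induction
    goes through. *)
Lemma lebesgue_tuple_indic n (F : n.-tuple X -> R) : bmeas F -> (forall y, 0 <= F y) ->
  (\int[lebesgue_tuple R n]_y (F y * \1_(@unit_cube R n) y)%:E)%E = (mean (tp n) F)%:E.
Proof.
elim: n F => [|n IH] F bF F0.
  rewrite (mean_tuple0 unit_uniform [tuple])//.
  rewrite [LHS](integral_dirac [tuple] measurableT
    (f := fun y => (F y * \1_(@unit_cube R 0) y)%:E)) ?diracT ?mul1e.
    by rewrite indicE mem_set ?mulr1// => -[].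
  by apply/measurable_EFinP; case: (bmeasM bF (@bmeas_unit_cube 0)).
have bG := bmeasM bF (@bmeas_unit_cube n.+1).
pose G y := (F y * \1_(@unit_cube R n.+1) y)%:E.
have G0 y : (0 <= G y)%E by rewrite lee_fin mulr_ge0// indicE.
have mG : measurable_fun [set: n.+1.-tuple X] G by apply/measurable_EFinP; case: bG.
rewrite [LHS](@ge0_integral_pushforward _ _ _ _ _ (@pair_cons _ _ n)
  (@measurable_pair_cons _ _ n) (mu \x lebesgue_tuple R n)%E setT G)//.
have mGc : measurable_fun [set: X * n.-tuple X] (G \o @pair_cons _ _ n).
  exact: (measurableT_comp mG (@measurable_pair_cons _ _ n)).
rewrite preimage_setT fubini_tonelli1//; last by move=> p; exact: G0.
have bFc := bmeas_comp bF (@measurable_pair_cons _ _ n).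
have bFx x : bmeas (fun t => F (pair_cons (x, t))).
  exact: (bmeas_comp bFc (measurable_pair1 x)).
rewrite mean_tupleS// -mean_unit_uniform; last 2 first.
- exact: (bmeas_mean1 unit_uniform (tp n) bFc).
- by move=> x; exact: mean_ge0.
rewrite [RHS]integral_mkcond; apply: eq_integral => x _; rewrite patchE.
transitivity (\int[lebesgue_tuple R n]_t
    ((\1_`[0%R, 1%R] x * F (pair_cons (x, t))) * \1_(@unit_cube R n) t)%:E)%E.
  apply: eq_integral => t _; rewrite /fubini_F /G /=; congr EFin.
  rewrite mulrAC mulrC; congr (_ * _); rewrite !indicE -natrM mulnb; congr ((nat_of_bool _)%:R).
  apply/idP/andP; rewrite !inE/= in_itv/=; first by move=> /unit_cube_cons[].
  by move=> [? ?]; apply/unit_cube_cons.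
rewrite (IH (fun t => \1_`[0%R, 1%R] x * F (pair_cons (x, t))))//; last 2 first.
- exact: bmeasZ.
- by move=> t; rewrite mulr_ge0// indicE.
by rewrite meanZl// indicE; case: ifP => _; rewrite ?mul1r ?mul0r.
Qed.

Lemma lebesgue_cube_mean n (F : n.-tuple X -> R) : bmeas F -> (forall y, 0 <= F y) ->
  (\int[lebesgue_tuple R n]_(y in @unit_cube R n) (F y)%:E)%E = (mean (tp n) F)%:E.
Proof.
move=> bF F0; rewrite -lebesgue_tuple_indic// integral_mkcond.
apply: eq_integral => y _; rewrite patchE indicE.
by case: ifP => _; rewrite ?mulr1 ?mulr0.
Qed.

End lebesgue_cube.

(** * The Gibbs kernel and its comparison constant *)

Section gibbs_kernel.
Variables (R : realType) (beta gamma : R).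
Hypotheses (beta_gt0 : 0 < beta) (gamma_ge0 : 0 <= gamma).
Local Notation X := (measurableTypeR R).
Implicit Types x y t z : R.

(* Positive everywhere (as [x / 0 = 0]); it gives back the factors of
   [gibbs_weight] on the points of the cube without vanishing coordinates. *)
Definition gibbs_kernel (x y : X) : R :=
  expR (- (beta / (2 * `|x|) + gamma / (`|x| + `|y|))).

Lemma measurable_gibbs_kernel :
  measurable_fun setT (fun p : X * X => gibbs_kernel p.1 p.2).
Proof.
have invE x : `|x|^-1 = `|x| `^ (-1) by rewrite powR_inv1.
have m1 : measurable_fun [set: X * X] (fun p : X * X => `|p.1|).
  exact: (measurableT_comp (@normr_measurable R setT) measurable_fst).
have m2 : measurable_fun [set: X * X] (fun p : X * X => `|p.2|).
  exact: (measurableT_comp (@normr_measurable R setT) measurable_snd).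
(* On nonnegative reals the inverse is the power of exponent -1; at 0 both take the value 0. *)
have mV (f : X * X -> R) : measurable_fun [set: X * X] f -> (forall p, 0 <= f p) ->
    measurable_fun [set: X * X] (fun p => (f p)^-1).
  move=> mf f0; rewrite (_ : (fun p => _) = (fun p => f p `^ (-1))).
    exact: (measurableT_comp (@measurable_powR R (-1)) mf).
  by apply/funext => p; rewrite powR_inv1.
apply: measurableT_comp => //; apply: measurableT_comp => //.
apply: measurable_funD; apply: measurable_funM => //; apply: mV.
- by apply: measurable_funM => //; exact: measurable_cst.
- by move=> p; rewrite mulr_ge0.
- exact: measurable_funD.
- by move=> p; rewrite addr_ge0.
Qed.

Lemma gibbs_kernel_gt0 x y : 0 < gibbs_kernel x y.
Proof. exact: expR_gt0. Qed.

Let term1_ge0 x : 0 <= beta / (2 * `|x|).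
Proof. by rewrite divr_ge0 ?(ltW beta_gt0)// mulr_ge0. Qed.

Let term2_ge0 x y : 0 <= gamma / (`|x| + `|y|).
Proof. by rewrite divr_ge0 ?addr_ge0. Qed.

Lemma gibbs_kernel_le1 x y : gibbs_kernel x y <= 1.
Proof. by rewrite expR_le1 oppr_le0 addr_ge0. Qed.

Definition away_from0 : set X := [set x | 2^-1 <= `|x|].
(** Moving a site to a value t with |t| >= 1/2 costs at most beta for its own term and 2 gamma for
    each of its two interactions. *)
Definition gibbs_kernel_bound : R := expR (beta + 4 * gamma).
Local Notation K := gibbs_kernel_bound.

Lemma measurable_away_from0 : measurable away_from0.
Proof.
rewrite -[away_from0]setTI (_ : away_from0 = (fun x : X => `|x|) @^-1` `[2^-1, +oo[).
  exact: normr_measurable.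
by apply/seteqP; split=> x /=; rewrite /away_from0 in_itv/= andbT.
Qed.

Lemma away_from0_1 : away_from0 1.
Proof. by rewrite /away_from0/= normr1 invf_le1 ?ler1n. Qed.

Let term1_le x : away_from0 x -> beta / (2 * `|x|) <= beta.
Proof.
rewrite /away_from0/= => x2; rewrite ler_piMr ?(ltW beta_gt0)// invf_le1; lra.
Qed.

Let term2_le x y : away_from0 y -> gamma / (`|x| + `|y|) <= 2 * gamma.
Proof.
rewrite /away_from0/= => y2; have x0 := normr_ge0 x.
rewrite mulrC ler_wpM2r//; rewrite -[leRHS]invrK lef_pV2 ?posrE; lra.
Qed.

Let term2_lel x y : away_from0 x -> gamma / (`|x| + `|y|) <= 2 * gamma.
Proof. by rewrite addrC; exact: term2_le. Qed.

Lemma gibbs_kernel_bound_gt0 : 0 < K. Proof. exact: expR_gt0. Qed.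

(** The term beta / (2 |x|) of the left neighbour occurs on both sides and cancels, so the bound is
    uniform in x however close to 0. The terms at s are nonnegative and are dropped. *)
Let compare x s t z : away_from0 t ->
  gibbs_kernel x s * gibbs_kernel s z <= K * (gibbs_kernel x t * gibbs_kernel t z).
Proof.
move=> Gt; rewrite /K /gibbs_kernel -!expRD ler_expR.
have := term1_le Gt; have := term2_le x Gt; have := term2_lel z Gt.
by have := term1_ge0 s; have := term2_ge0 x s; have := term2_ge0 s z; lra.
Qed.

Lemma gibbs_kernel_star_ub x t z :
  gibbs_kernel x t * gibbs_kernel t z <= K * (gibbs_kernel x 1 * gibbs_kernel 1 z).
Proof. exact: compare away_from0_1. Qed.

Lemma gibbs_kernel_star_lb x t z : away_from0 t ->
  gibbs_kernel x 1 * gibbs_kernel 1 z <= K * (gibbs_kernel x t * gibbs_kernel t z).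
Proof. exact: compare. Qed.

End gibbs_kernel.

(** * Identification of the law of Y *)

Section gibbs_law.
Variables (R : realType) (beta gamma : R).
Hypotheses (beta_gt0 : 0 < beta) (gamma_ge0 : 0 <= gamma).
Local Notation X := (measurableTypeR R).
Variable n : nat.
Local Notation T := (n.-tuple X).
Local Notation mu := (unit_uniform R).
Local Notation I := (mean (tuple_prob mu n)).
Local Notation w := (ring_weight (gibbs_kernel beta gamma) (n := n)).

Let bw : bmeas w.
Proof.
apply: bmeas_ring_weight; [exact: measurable_gibbs_kernel|exact: gibbs_kernel_gt0|].
exact: gibbs_kernel_le1.
Qed.

Let w_gt0 y : 0 < w y.
Proof. exact: (ring_weight_gt0 (gibbs_kernel_gt0 beta gamma)). Qed.

(** The zero value imposed on the density, written as a product of functions of one coordinate so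
    that it is visibly measurable. *)
Definition nonvanishing (y : T) : R := \prod_(i < n) (1 - \1_([set 0] : set X) (tnth y i)).

Let measurable_at0 : measurable ([set 0] : set X).
Proof. exact: measurable_set1. Qed.

Lemma bmeas_at0 i : bmeas (fun y : T => \1_([set 0] : set X) (tnth y i) : R).
Proof. exact: (bmeas_comp (bmeas_indic R measurable_at0) (measurable_tnth i)). Qed.

Lemma bmeas_nonvanishing : bmeas nonvanishing.
Proof.
by apply: bmeas_prod => i; apply: bmeasB; [exact: bmeas_cst|exact: bmeas_at0].
Qed.

Lemma nonvanishingE y : nonvanishing y = if [exists i, Defs.coord y i == 0] then 0 else 1.
Proof.
case: ifPn => [/existsP[i /eqP yi]|/existsPn ne].
  rewrite /nonvanishing (bigD1 i)//= indicE mem_set ?subrr ?mul0r//.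
rewrite /nonvanishing big1// => i _; rewrite indicE memNset ?subr0//.
by move=> /= yi; have := ne i; rewrite /Defs.coord yi eqxx.
Qed.

Lemma gibbs_weight_cube y : unit_cube y -> gibbs_weight beta gamma y = w y * nonvanishing y.
Proof.
move=> yc; rewrite /gibbs_weight nonvanishingE; case: ifP => _; first by rewrite mulr0.
rewrite mulr1 -sumrN expR_sum; apply: eq_bigr => i _.
have n0 j : `|tnth y j| = Defs.coord y j by rewrite ger0_norm//; case/andP: (yc j).
by rewrite /edge /gibbs_kernel !n0.
Qed.

(** Union bound: the difference is dominated by the sum over i of M times the indicator that the
    i-th coordinate is 0, and each of these events is null. *)
Lemma mean_nonvanishing f : bmeas f -> I (fun y => f y * nonvanishing y) = I f.
Proof.
move=> bf; apply/eqP; rewrite -subr_eq0 -normr_le0 -meanB//; last first.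
  by apply: bmeasM => //; exact: bmeas_nonvanishing.
have [_ [M fM]] := bf.
have bd : bmeas (fun y => f y * nonvanishing y - f y).
  by apply: bmeasB => //; apply: bmeasM => //; exact: bmeas_nonvanishing.
apply: le_trans (normr_mean _ bd) _.
have b0 := bmeas_at0.
apply: (@le_trans _ _ (I (fun y => \sum_(i < n) M * \1_([set 0] : set X) (tnth y i)))).
  apply: le_mean; [exact: bmeas_norm|by apply: bmeas_sum => i; exact: bmeasZ|].
  move=> y; rewrite nonvanishingE; case: ifPn => [/existsP[i /eqP yi]|_]; last first.
    rewrite mulr1 subrr normr0; apply: sumr_ge0 => i _.
    by rewrite mulr_ge0// ?indicE// (le_trans _ (fM y)).
  rewrite mulr0 sub0r normrN (bigD1 i)//= indicE mem_set// mulr1.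
  rewrite (le_trans (fM y))// lerDl sumr_ge0// => j _.
  by rewrite mulr_ge0// ?indicE// (le_trans _ (fM y)).
rewrite mean_sum => [|i]; last exact: bmeasZ.
rewrite big1// => i _; rewrite meanZl// (mean_tnth mu i (bmeas_indic R measurable_at0)).
rewrite mean_unit_uniform_indic// (_ : _ `&` _ = [set 0]) ?lebesgue_measure_set1 ?mulr0//.
by apply/seteqP; split=> [x []|_ ->] //; split=> //=; rewrite in_itv/= lexx ler01.
Qed.

Variables (d : measure_display) (Om : measurableType d) (P : probability Om R).
Variable Y : {RV P >-> n.-tuple X}.
Hypothesis Ydens : has_density_on Y (@unit_cube R n) (@gibbs_density R beta gamma n).

Lemma partition_functionE : partition_function beta gamma n = I w.
Proof.
have bwn := bmeasM bw bmeas_nonvanishing.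
have wn0 y : 0 <= w y * nonvanishing y.
  by rewrite mulr_ge0 ?(ltW (w_gt0 y))// nonvanishingE; case: ifP.
rewrite -(mean_nonvanishing bw) /partition_function /Rintegral.
have := lebesgue_cube_mean bwn wn0 => /(congr1 fine) /= <-; congr fine.
apply: eq_integral => y; rewrite inE => yc; congr EFin; exact: gibbs_weight_cube.
Qed.

Lemma gibbs_law f : bmeas f ->
  mean (distribution P Y) f = gibbs_mean mu (gibbs_kernel beta gamma) f.
Proof.
have mh := measurable_gibbs_kernel beta gamma.
have h0 := gibbs_kernel_gt0 beta gamma.
have h1 := gibbs_kernel_le1 beta_gt0 gamma_ge0.
apply: eq_mean_like.
- by split; [exact: meanD|exact: meanZl|exact: mean_cst|exact: le_mean].
- split; [exact: gibbs_meanD|exact: gibbs_meanZ|exact: gibbs_mean_cst|exact: le_gibbs_mean].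
move=> A mA; have bA : bmeas (\1_A : T -> R) := bmeas_indic R mA.
have Iw_gt0 := mean_weight_gt0 mu mh h0 h1 n.
pose g y := (I w)^-1 * (\1_A y * w y * nonvanishing y).
have bAw := bmeasM bA bw.
have bAwn := bmeasM bAw bmeas_nonvanishing.
have bg : bmeas g by exact: bmeasZ.
have g0 y : 0 <= g y.
  rewrite mulr_ge0 ?invr_ge0 ?(ltW Iw_gt0)// mulr_ge0 ?mulr_ge0 ?(ltW (w_gt0 y)) ?indicE//.
  by rewrite nonvanishingE; case: ifP.
have -> : gibbs_mean mu (gibbs_kernel beta gamma) \1_A = I g.
  by rewrite /g meanZl// mean_nonvanishing// mulrC.
rewrite mean_indic//; transitivity (fine (P (Y @^-1` A))) => //; rewrite Ydens//.
rewrite -[RHS]/(fine (I g)%:E) -lebesgue_cube_mean//; congr fine.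
rewrite setIC integral_mkcondr; apply: eq_integral => y; rewrite inE => yc.
rewrite patchE /g indicE; case: ifP => _; last by rewrite !mul0r mulr0.
by rewrite /gibbs_density partition_functionE gibbs_weight_cube// mul1r.
Qed.

End gibbs_law.

(** * The normal approximation for the Gibbs ring *)

Section gibbs_clt.
Variables (R : realType) (beta gamma : R).
Hypotheses (beta_gt0 : 0 < beta) (gamma_ge0 : 0 <= gamma).
Local Notation X := (measurableTypeR R).
Local Notation mu := (unit_uniform R).
Local Notation K := (gibbs_kernel_bound beta gamma).
Local Notation G := (@away_from0 R).
Local Notation h := (gibbs_kernel beta gamma).
Local Notation rho := (contraction_ratio mu G K).

(** The identity on the values that Y takes, truncated so that coordinates become bounded functions
    on the whole space of tuples. *)
Definition clamp01 (x : X) : R := Num.max 0 (Num.min 1 x).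

Lemma clamp01_itv x : 0 <= clamp01 x <= 1.
Proof. by rewrite /clamp01 le_max lexx ge_max ler01 ge_min lexx. Qed.

Lemma clamp01_id x : 0 <= x <= 1 -> clamp01 x = x.
Proof. by move=> /andP[x0 x1]; rewrite /clamp01 min_r// max_r. Qed.

Lemma bmeas_clamp01 : bmeas clamp01.
Proof.
apply: (@bmeasW _ _ _ _ 1); last by move=> x; have /andP[? ?] := clamp01_itv x; rewrite ger0_norm.
apply: measurable_maxr => //; apply: measurable_minr => //.
Qed.

Lemma mean_unit_uniform_itv (a b : R) : 0 <= a -> a <= b -> b <= 1 ->
  mean mu \1_(`[a, b]%classic : set X) = b - a.
Proof.
move=> a0 ab b1; rewrite mean_unit_uniform_indic// (_ : _ `&` _ = `[a, b]%classic); last first.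
  apply/seteqP; split=> x /=; rewrite !in_itv/=; first by case.
  by move=> /andP[ax xb]; split; lra.
rewrite lebesgue_measure_itv/= lte_fin; move: ab; rewrite le_eqVlt => /predU1P[->|ab].
  by rewrite ltxx subrr.
by rewrite ab -EFinB.
Qed.

Lemma theta_away_from0 : theta mu G = 2^-1.
Proof.
rewrite /theta mean_unit_uniform_indic; last exact: measurable_away_from0.
rewrite (_ : _ `&` _ = `[2^-1, 1]%classic); last first.
  apply/seteqP; split=> x /=; rewrite /away_from0 !in_itv/=.
    by case=> + /andP[x0 x1]; rewrite ger0_norm// => ->.
  by move=> /andP[x2 x1]; rewrite ger0_norm; [split=> //; lra|lra].
rewrite lebesgue_measure_itv/= lte_fin invf_lt1 ?ltr1n// -EFinB/=; lra.
Qed.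

Lemma rho_lt1 : rho < 1.
Proof.
rewrite /contraction_ratio theta_away_from0 ltrBlDr ltrDl divr_gt0 ?exprn_gt0//.
by rewrite mulr_gt0// exprn_gt0// gibbs_kernel_bound_gt0.
Qed.

Lemma rho_ge0 : 0 <= rho.
Proof.
exact: (contraction_ratio_ge0 mu (gibbs_kernel_gt0 beta gamma) (@measurable_away_from0 R)
  (gibbs_kernel_bound_gt0 beta gamma) (gibbs_kernel_star_ub beta_gt0 gamma_ge0)).
Qed.

Variable n : nat.
Hypothesis n_gt1 : (1 < n)%N.
Local Notation T := (n.-tuple X).
Variable P : probability T R.
Hypothesis PE : forall f, bmeas f -> mean P f = gibbs_mean mu h f.
Implicit Types (i j : 'I_n) (y : T).

Definition centered_coord i y : R :=
  clamp01 (tnth y i) - mean P (fun y => clamp01 (tnth y i)).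
Local Notation xi := centered_coord.
Definition coord_sum y : R := \sum_(i < n) xi i y.
Definition coord_sd : R := Num.sqrt (mean P (fun y => coord_sum y ^+ 2)).

Let bclamp i : bmeas (fun y : T => clamp01 (tnth y i)).
Proof. exact: (bmeas_comp bmeas_clamp01 (measurable_tnth i)). Qed.

Lemma bmeas_centered_coord i : bmeas (xi i).
Proof. by apply: bmeasB => //; exact: bmeas_cst. Qed.

Lemma bmeas_coord_sum : bmeas coord_sum.
Proof. by apply: bmeas_sum => i; exact: bmeas_centered_coord. Qed.

Lemma mean_centered_coord i : mean P (xi i) = 0.
Proof. by rewrite meanB ?mean_cst ?subrr//; exact: bmeas_cst. Qed.

Lemma centered_coord_le1 i y : `|xi i y| <= 1.
Proof.
have /andP[c0 c1] := clamp01_itv (tnth y i).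
have m0 : 0 <= mean P (fun y => clamp01 (tnth y i)).
  by apply: mean_ge0 => z; case/andP: (clamp01_itv (tnth z i)).
have m1 : mean P (fun y => clamp01 (tnth y i)) <= 1.
  rewrite -[leRHS](mean_cst P); apply: le_mean => //; first exact: bmeas_cst.
  by move=> z; case/andP: (clamp01_itv (tnth z i)).
by rewrite ler_norml /xi; lra.
Qed.

(** The constant of [variance_ge] with a = 1/32, the correlation of the coordinate with the test
    function [psi] chosen in the next proof. *)
Definition variance_rate : R := (32^-1) ^+ 2 / (3 * K ^+ 4).

Lemma coord_sum_variance_ge : n%:R * variance_rate <= mean P (fun y => coord_sum y ^+ 2).
Proof.
(* Two intervals of equal length 1/8 inside [1/2, 1]: this gives mean zero, support in [G] and a
   positive correlation with x. *)
pose psi (x : X) : R := \1_(`[7/8, 1]%classic : set X) x - \1_(`[2^-1, 5/8]%classic : set X) x.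
have bI (a b : R) : bmeas (\1_(`[a, b]%classic : set X) : X -> R) by exact: bmeas_indic.
have bpsi : bmeas psi by exact: bmeasB.
have I01 (A : set X) x : (\1_A x : R) = 0 \/ (\1_A x : R) = 1.
  by rewrite indicE; case: (_ \in _); [right|left].
apply: (@variance_ge _ X R mu h 1 G K (measurable_gibbs_kernel beta gamma)
  (gibbs_kernel_gt0 beta gamma) (gibbs_kernel_le1 beta_gt0 gamma_ge0)
  (gibbs_kernel_bound_gt0 beta gamma) (gibbs_kernel_star_ub beta_gt0 gamma_ge0)
  (@gibbs_kernel_star_lb R beta gamma beta_gt0 gamma_ge0) n n_gt1 P PE clamp01 psi) => //.
- exact: bmeas_clamp01.
- by move=> x; rewrite /psi ler_norml;
    case: (I01 `[7/8, 1]%classic x) => ->; case: (I01 `[2^-1, 5/8]%classic x) => ->; lra.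
- move=> x; rewrite /psi /away_from0/= !indicE.
  case: (boolP (x \in `[7/8, 1]%classic)) => [|_].
    by rewrite inE/= in_itv/= => /andP[? ?] _; rewrite ger0_norm; lra.
  case: (boolP (x \in `[2^-1, 5/8]%classic)) => [|_]; last by rewrite subrr eqxx.
  by rewrite inE/= in_itv/= => /andP[? ?] _; rewrite ger0_norm; lra.
- by rewrite /psi meanB// !mean_unit_uniform_itv; lra.
(* Here x >= 7/8 on the right interval and x <= 5/8 on the left one, hence a correlation of at least
   (7/8 - 5/8) / 8 = 1/32. *)
- apply: (@le_trans _ _ (mean mu (fun x => 7/8 * \1_(`[7/8, 1]%classic : set X) x -
      5/8 * \1_(`[2^-1, 5/8]%classic : set X) x))).
    rewrite meanB; [|exact: bmeasZ|exact: bmeasZ].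
    by rewrite !meanZl// !mean_unit_uniform_itv; lra.
  apply: le_mean => [||x].
  + by apply: bmeasB; exact: bmeasZ.
  + by apply: bmeasM => //; exact: bmeas_clamp01.
  rewrite /psi mulrBr; apply: lerB.
    rewrite !indicE; case: (boolP (x \in `[7/8, 1]%classic)) => [|_]; last by rewrite !mulr0.
    by rewrite inE/= in_itv/= !mulr1 => /andP[? ?]; rewrite clamp01_id; lra.
  rewrite !indicE; case: (boolP (x \in `[2^-1, 5/8]%classic)) => [|_]; last by rewrite !mulr0.
  by rewrite inE/= in_itv/= !mulr1 => /andP[? ?]; rewrite clamp01_id; lra.
Qed.

Lemma variance_rate_gt0 : 0 < variance_rate.
Proof.
by rewrite divr_gt0 ?exprn_gt0// mulr_gt0// exprn_gt0// gibbs_kernel_bound_gt0.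
Qed.

Lemma coord_sd_gt0 : 0 < coord_sd.
Proof.
rewrite sqrtr_gt0; apply: lt_le_trans coord_sum_variance_ge.
by rewrite mulr_gt0 ?variance_rate_gt0// ltr0n ltnW.
Qed.

Lemma coord_sd_sqr : coord_sd ^+ 2 = mean P (fun y => coord_sum y ^+ 2).
Proof. by rewrite sqr_sqrtr// mean_sqr_ge0. Qed.

Variable k : nat.
Hypothesis kn : (8 * k < n)%N.

Lemma gibbs_mixing i r f g M1 M2 : bmeas f -> bmeas g ->
  depends_only (ring_ball i r) f -> depends_only (predC (ring_ball i (r + 2 * k))) g ->
  0 <= M1 -> 0 <= M2 -> (forall y, `|f y| <= M1) -> (forall y, `|g y| <= M2) ->
  (2 * (r + 2 * k) < n)%N ->
  `|mean P (fun y => f y * g y) - mean P f * mean P g| <= 4 * rho ^+ k * (M1 * M2).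
Proof.
move=> bf bg fB gB M10 M20 fM gM rkn; rewrite !PE//; last exact: bmeasM.
have := @gibbs_mean_mixing _ X R mu h 1 G K (measurable_gibbs_kernel beta gamma)
  (gibbs_kernel_gt0 beta gamma) (gibbs_kernel_le1 beta_gt0 gamma_ge0) (@measurable_away_from0 R)
  (gibbs_kernel_bound_gt0 beta gamma) (gibbs_kernel_star_ub beta_gt0 gamma_ge0)
  (@gibbs_kernel_star_lb R beta gamma beta_gt0 gamma_ge0) n n_gt1 i r k f g M1 M2
  bf bg fB gB M10 M20 fM gM rkn.
by move=> /le_trans; apply; rewrite le_eqVlt; apply/orP; left; apply/eqP; ring.
Qed.

Lemma depends_only_xi_sum (B C : pred 'I_n) :
  (forall j, C j -> B j) -> depends_only B (fun y => \sum_(j < n | C j) xi j y).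
Proof. by move=> CB y z yz; apply: eq_bigr => j /CB Bj; rewrite /xi yz. Qed.

Lemma gibbs_stein_bound delta z : 0 < delta ->
  `|fine (P [set y | coord_sum y / coord_sd <= z]) - normal_cdf z| <=
    n%:R * (4 * rho ^+ k) * (normal_pdf 0 1 1)^-1 / coord_sd +
    n%:R * (4 * k).+1%:R ^+ 2 * ((normal_pdf 0 1 1)^-1 + delta^-1 + 2) / coord_sd ^+ 3 +
    2 * (n%:R ^+ 2 * (4 * rho ^+ k) / coord_sd ^+ 2 +
         Num.sqrt (n%:R * (4 * k).+1%:R ^+ 2 *
           (2 * (12 * k).+1%:R + n%:R * (4 * rho ^+ k)) / coord_sd ^+ 4)) + delta.
Proof.
move=> delta_gt0; set eta := 4 * rho ^+ k.
have eta_ge0 : 0 <= eta by rewrite mulr_ge0// exprn_ge0// rho_ge0.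
have bxi := bmeas_centered_coord.
have xi_only i : depends_only (ring_ball i 0) (xi i).
  by move=> y y' yy; rewrite /xi yy// ring_ball_refl.
have sum_le (B : pred 'I_n) D y : (#|B| <= D)%N -> `|\sum_(j < n | B j) xi j y| <= D%:R.
  move=> BD; apply: le_trans (ler_norm_sum _ _ _) _.
  apply: (@le_trans _ _ (\sum_(j < n | B j) 1)).
    by apply: ler_sum => j _; exact: centered_coord_le1.
  by rewrite sumr_const ler_nat.
have ball2k i : (#|ring_ball i (2 * k)| <= (4 * k).+1)%N.
  by apply: leq_trans (card_ring_ball i _) _; lia.
apply: cdf_dist_le => //.
  by apply: measurable_funM; [case: bmeas_coord_sum|exact: measurable_cst].
move=> z'.
(* A gap of 2k steps allows k contractions. A single site needs distance 2k; the products A_i and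
   A_j live on balls of radius 2k, so the same gap requires distance 6k = 2k + 2k + 2k. The mixing
   condition for them is 2 (2k + 2k) < n, that is [kn]. *)
apply: (@stein_bound _ T R P n xi (fun i => ring_ball i (2 * k)) (fun i => ring_ball i (6 * k))
  (4 * k).+1 (12 * k).+1 eta bxi centered_coord_le1 ball2k _ eta_ge0 _ _ _ coord_sd
  coord_sd_gt0 coord_sd_sqr (stein_solution (ramp z' delta)) (ramp z' delta)).
- by move=> i; apply: leq_trans (card_ring_ball i _) _; lia.
- move=> i g M mg gM.
  pose g' y := g (\sum_(j < n | ~~ ring_ball i (2 * k) j) xi j y).
  have bg' : bmeas g'.
    apply: (bmeasW (M := M)) => [|y]; last exact: gM.
    apply: measurableT_comp => //.
    by have [] := bmeas_sum (index_enum 'I_n) (fun j => ~~ ring_ball i (2 * k) j) bxi.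
  have M_ge0 : 0 <= M by exact: le_trans (normr_ge0 _) (gM 0).
  have := @gibbs_mixing i 0 (xi i) g' 1 M (bxi i) bg' (xi_only i) _ ler01 M_ge0
    (centered_coord_le1 i) (fun y => gM _) _.
  rewrite mean_centered_coord mul0r subr0 mul1r; apply; last by lia.
  by move=> y y' yy; congr g; apply: depends_only_xi_sum yy => j.
- move=> i j ij.
  have := @gibbs_mixing i 0 (xi i) (xi j) 1 1 (bxi i) (bxi j) (xi_only i) _ ler01 ler01
    (centered_coord_le1 i) (centered_coord_le1 j) _.
  rewrite mean_centered_coord mul0r subr0 !mulr1; apply; last by lia.
  by move=> y y' yy; rewrite /xi yy.
- move=> i j ij.
  pose A l y := xi l y * \sum_(m < n | ring_ball l (2 * k) m) xi m y.
  have bA l : bmeas (A l) by apply: bmeasM => //; exact: bmeas_sum.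
  have A_only l : depends_only (ring_ball l (2 * k)) (A l).
    apply: depends_only_comp2; last exact: depends_only_xi_sum.
    by apply: depends_onlyS (xi_only l) => m; apply: ring_ball_le.
  have A_le l y : `|A l y| <= (4 * k).+1%:R.
    by rewrite normrM -[leRHS]mul1r ler_pM ?centered_coord_le1// sum_le.
  have := @gibbs_mixing i (2 * k) (A i) (A j) _ _ (bA i) (bA j) (A_only i) _ (ler0n _ _) (ler0n _ _)
    (A_le i) (A_le j) _.
  rewrite expr2; apply; last by lia.
  apply: depends_onlyS (A_only j) => l jl /=; apply: contra ij => il.
  have := ring_ball_trans il (_ : ring_ball l (2 * k) j); rewrite ring_ball_sym => /(_ jl).
  by apply: ring_ball_le; lia.
- by move=> x; apply: is_derive_stein_solution; [exact: continuous_ramp|exact: ramp01].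
- by move=> x; apply: stein_solution_le; [exact: continuous_ramp|exact: ramp01].
- by move=> x; apply: stein_solution_mulx; [exact: continuous_ramp|exact: ramp01].
- exact: ramp01.
- by apply: normal_mean01; [exact: continuous_ramp|exact: ramp01].
- by apply: continuous_measurable_fun; exact: continuous_ramp.
- by move=> x y; exact: ramp_lip.
Qed.

End gibbs_clt.

(** * Numerical estimates for the rate *)

Section rate.
Variable R : realType.

(* The choices [delta = 1 / q] with [q = n ^ (1/4)], [s0 * q ^ 2 <= sigma] and
   [eta <= 4 / n ^ 3] in [stein_bound]. *)
Lemma stein_rate (n k : nat) (q B s0 sigma eta : R) :
  n%:R = q ^+ 4 -> 1 <= q -> (1 <= k)%N -> 0 <= B -> 0 < s0 -> s0 * q ^+ 2 <= sigma ->
  0 <= eta -> n%:R ^+ 3 * eta <= 4 ->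
  n%:R * eta * B / sigma +
    n%:R * (4 * k).+1%:R ^+ 2 * (B + q + 2) / sigma ^+ 3 +
    2 * (n%:R ^+ 2 * eta / sigma ^+ 2 +
         Num.sqrt (n%:R * (4 * k).+1%:R ^+ 2 * (2 * (12 * k).+1%:R + n%:R * eta) / sigma ^+ 4)) +
    q^-1 <=
  (4 * B / s0 + 25 * (B + 3) / s0 ^+ 3 + 2 * (4 / s0 ^+ 2 + 28 / s0 ^+ 2) + 1) * k%:R ^+ 2 / q.
Proof.
move=> nE q1 k1 B0 s0_gt0 sig eta0 eta_le.
have q0 : 0 < q by lra.
have sig0 : 0 < sigma by apply: lt_le_trans sig; rewrite mulr_gt0// exprn_gt0.
have kr : 1 <= k%:R :> R by rewrite (ler_nat _ 1).
have n1 : 1 <= n%:R :> R by rewrite nE exprn_ege1.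
set v := q^-1; have v0 : 0 < v by rewrite invr_gt0.
have v1 : v <= 1 by rewrite invf_le1.
set a := s0^-1; have a0 : 0 < a by rewrite invr_gt0.
set t := k%:R ^+ 2; have t1 : 1 <= t by rewrite exprn_ege1.
have t0 : 0 <= t by lra.
have vt : v <= t * v by rewrite ler_peMl// ltW.
have v2t : v ^+ 2 <= t * v by rewrite expr2 ler_pM2r//; lra.
have sV m : (sigma ^+ m)^-1 <= (a * v ^+ 2) ^+ m.
  rewrite -exprVn lerXn2r ?nnegrE ?invr_ge0 ?(ltW sig0)//; first by rewrite mulr_ge0 ?sqr_ge0 ?ltW.
  by rewrite /a /v exprVn -invfM lef_pV2 ?posrE// mulr_gt0// exprn_gt0.
have sV0 m : 0 <= (sigma ^+ m)^-1 by rewrite invr_ge0 exprn_ge0// ltW.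
have s1V : sigma^-1 <= a * v ^+ 2 by have := sV 1; rewrite !expr1.
have s1V0 : 0 <= sigma^-1 by rewrite invr_ge0 ltW.
have n2eta : n%:R ^+ 2 * eta <= 4.
  apply: le_trans eta_le; rewrite ler_wpM2r// exprS ler_peMl// exprn_ge0//; lra.
have n1eta : n%:R * eta <= 4.
  apply: le_trans n2eta; rewrite ler_wpM2r// expr2 ler_peMl//; lra.
have neta0 m : 0 <= n%:R ^+ m * eta by rewrite mulr_ge0// exprn_ge0//; lra.
have neta10 : 0 <= n%:R * eta by have := neta0 1; rewrite expr1.
have D1k : (4 * k).+1%:R ^+ 2 <= 25 * t.
  have D1k1 : (4 * k).+1%:R <= 5 * k%:R :> R.
    have k5 : ((4 * k).+1 <= 5 * k)%N by move: k1; clear; lia.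
    by apply: (@le_trans _ _ (5 * k)%:R); [rewrite ler_nat|rewrite natrM].
  have -> : 25 * t = (5 * k%:R) ^+ 2 by rewrite /t; move: (k%:R : R) => r; ring.
  by rewrite lerXn2r ?nnegrE// mulr_ge0.
have D10 : 0 <= (4 * k).+1%:R ^+ 2 :> R by rewrite exprn_ge0.
have T1 : n%:R * eta * B / sigma <= 4 * B * a * (t * v).
  apply: (@le_trans _ _ (4 * B * (a * v ^+ 2))).
    by apply: ler_pM => //; [exact: mulr_ge0|exact: ler_wpM2r].
  by rewrite -[leRHS]mulrA ler_wpM2l ?mulr_ge0// ler_wpM2l// ltW.
(* The critical term: the slope q of the ramp leaves q^4 q / q^6 = 1 / q, with nothing to spare. *)
have T2 : n%:R * (4 * k).+1%:R ^+ 2 * (B + q + 2) / sigma ^+ 3 <= 25 * (B + 3) * a ^+ 3 * (t * v).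
  apply: (@le_trans _ _ (q ^+ 4 * (25 * t) * ((B + 3) * q) * (a * v ^+ 2) ^+ 3)).
    apply: ler_pM => //; first by apply: mulr_ge0; [exact: mulr_ge0|lra].
    apply: ler_pM; [exact: mulr_ge0|lra| |].
      by rewrite nE ler_wpM2l// exprn_ge0// ltW.
    have Bq : B <= B * q by rewrite ler_peMr.
    by rewrite mulrDl; lra.
  by rewrite le_eqVlt; apply/orP; left; apply/eqP; rewrite /v; field; rewrite gt_eqF.
have T3 : n%:R ^+ 2 * eta / sigma ^+ 2 <= 4 * a ^+ 2 * (t * v).
  apply: (@le_trans _ _ (4 * (a * v ^+ 2) ^+ 2)); first exact: ler_pM.
  rewrite exprMn -[leRHS]mulrA ler_wpM2l// ler_wpM2l ?sqr_ge0//.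
  by apply: le_trans v2t; rewrite [leLHS]expr2 ler_piMl ?sqr_ge0// exprn_ile1// ltW.
have T4 : Num.sqrt (n%:R * (4 * k).+1%:R ^+ 2 * (2 * (12 * k).+1%:R + n%:R * eta) / sigma ^+ 4) <=
    28 * a ^+ 2 * (t * v).
  apply: (@le_trans _ _ (28 * a ^+ 2 * (t * v ^+ 2))); last first.
    have v2v : v ^+ 2 <= v by rewrite expr2 ler_piMl// ltW.
    by apply: ler_wpM2l; [rewrite mulr_ge0// sqr_ge0|exact: ler_wpM2l].
  have r0 : 0 <= 28 * a ^+ 2 * (t * v ^+ 2).
    by apply: mulr_ge0; apply: mulr_ge0 => //; exact: sqr_ge0.
  rewrite -[leRHS]ger0_norm// -sqrtr_sqr ler_wsqrtr//.
  (* Here 30 t bounds 2 (12 k + 1) + 4, and 25 * 30 = 750 <= 784 = 28^2 explains the constant 28. *)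
  apply: (@le_trans _ _ (q ^+ 4 * (25 * t) * (30 * t) * (a * v ^+ 2) ^+ 4)).
    apply: ler_pM => //; first by apply: mulr_ge0; [exact: mulr_ge0|exact: addr_ge0].
    apply: ler_pM; [exact: mulr_ge0|exact: addr_ge0| |].
      by rewrite nE ler_wpM2l// exprn_ge0// ltW.
    have kt : k%:R <= t by rewrite /t expr2 ler_peMl//; lra.
    have -> : (12 * k).+1%:R = 12 * k%:R + 1 :> R by rewrite -natr1 (natrM _ 12 k).
    by lra.
  rewrite [leLHS](_ : _ = 750 * (a ^+ 2 * (t * v ^+ 2)) ^+ 2); last first.
    by rewrite /v; field; rewrite gt_eqF.
  rewrite [leRHS](_ : _ = 784 * (a ^+ 2 * (t * v ^+ 2)) ^+ 2); last by ring.
  by rewrite ler_wpM2r ?sqr_ge0// ler_nat.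
rewrite [leRHS](_ : _ = 4 * B * a * (t * v) + 25 * (B + 3) * a ^+ 3 * (t * v) +
   2 * (4 * a ^+ 2 * (t * v) + 28 * a ^+ 2 * (t * v)) + t * v); last first.
  by rewrite /a /t /v; field; rewrite !gt_eqF.
by lra.
Qed.

End rate.

Lemma block_length_exists (R : realType) (rho a : R) : 0 <= rho < 1 -> 0 < a ->
  exists2 C : R, 0 < C & forall n, (0 < n)%N -> exists k : nat,
    [/\ (0 < k)%N, k%:R <= C * n%:R `^ a & n%:R ^+ 3 * (4 * rho ^+ k) <= 4].
Proof.
(* As rho may be 0, its logarithm is replaced by that of the midpoint of rho and 1, which lies
   strictly between 0 and 1. *)
move=> /andP[rho0 rho1] a0; pose l := (1 + rho) / 2; pose L := - ln l.
have l0 : 0 < l by rewrite /l; lra.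
have L0 : 0 < L by rewrite oppr_gt0 ln_lt0// l0 /l; lra.
exists (3 / (a * L) + 1); first by rewrite ltr_wpDl// divr_ge0// ltW// mulr_gt0.
move=> n n0; have n1 : 1 <= n%:R :> R by rewrite (ler_nat _ 1).
have np : 0 < n%:R :> R by lra.
have ln0 : 0 <= ln n%:R :> R by rewrite ln_ge0.
have x0 : 0 <= 3 * ln n%:R / L by rewrite divr_ge0 ?mulr_ge0// ltW.
(* Any k above 3 ln n / L makes l^k at most n^(-3). *)
exists (Num.truncn (3 * ln n%:R / L)).+1; have /andP[k1 k2] := truncn_itv x0.
split=> //.
  have powE : n%:R `^ a = expR (a * ln n%:R) by rewrite /powR gt_eqF.
  (* From 1 + u <= exp(u) at u = a ln n: the logarithm is absorbed into an arbitrarily small power,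
     which produces 3 / (a L) in the constant. *)
  have ln_le : ln n%:R <= n%:R `^ a / a.
    rewrite ler_pdivlMr// mulrC powE; have := expR_ge1Dx (a * ln n%:R).
    by move: (a * ln n%:R) (expR _) => u v; lra.
  have pow1 : 1 <= n%:R `^ a.
    by rewrite powE; apply: le_trans (expR_ge1Dx _); rewrite lerDl mulr_ge0// ltW.
  rewrite -[leLHS]natr1 [leRHS]mulrDl; apply: lerD; last by rewrite mul1r.
  apply: (le_trans k1).
  rewrite [leRHS](_ : _ = 3 * (n%:R `^ a / a) / L); last by field; rewrite !gt_eqF.
  by rewrite ler_pM2r ?invr_gt0// ler_pM2l.
set k := (Num.truncn _).+1.
have rl : rho ^+ k <= expR (- (3 * ln n%:R)).
  apply: (@le_trans _ _ (l ^+ k)).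
    by rewrite lerXn2r ?nnegrE ?(ltW l0)// /l; lra.
  have -> : l ^+ k = expR (- (k%:R * L)).
    by rewrite /L mulrN opprK expRM_natl lnK ?posrE.
  by rewrite ler_expR lerN2 -ler_pdivrMr// ltW.
have -> : n%:R ^+ 3 = expR (3 * ln n%:R) :> R by rewrite expRM_natl lnK ?posrE.
rewrite mulrCA -[leRHS]mulr1 ler_wpM2l//.
apply: (@le_trans _ _ (expR (3 * ln n%:R) * expR (- (3 * ln n%:R)))).
  by rewrite ler_wpM2l ?expR_ge0.
by rewrite expRxMexpNx_1.
Qed.

(** * Transfer from the law of Y to the random vector *)

Section kolmogorov_distance.
Variables (R : realType) (beta gamma : R).
Hypotheses (beta_gt0 : 0 < beta) (gamma_ge0 : 0 <= gamma).
Local Notation X := (measurableTypeR R).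
Variables (n : nat) (d : measure_display) (Om : measurableType d) (P : probability Om R).
Variable Y : {RV P >-> n.-tuple X}.
Hypothesis Ycube : forall w, unit_cube (Y w).
Hypothesis n_gt1 : (1 < n)%N.
Hypothesis Ydens : has_density_on Y (@unit_cube R n) (@gibbs_density R beta gamma n).
Local Notation PY := (distribution P Y).

Lemma mean_distribution f : bmeas f -> mean PY f = mean P (fun w => f (Y w)).
Proof.
move=> bf; have bfY : bmeas (fun w => f (Y w)) by apply: (bmeas_comp bf).
have mf : measurable_fun [set: n.-tuple X] (EFin \o f) by apply/measurable_EFinP; case: bf.
rewrite -[LHS]/(fine (mean PY f)%:E) -mean_EFin//.
have -> := @integral_distribution _ _ _ _ R P Y (EFin \o f) mf (bmeas_integrable P bfY).
by rewrite (mean_EFin P bfY).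
Qed.

Let componentE i w : component Y i w = clamp01 (tnth (Y w) i).
Proof. by rewrite clamp01_id//; exact: Ycube. Qed.

Let bclamp i : bmeas (fun y : n.-tuple X => clamp01 (tnth y i)).
Proof. exact: (bmeas_comp (bmeas_clamp01 R) (measurable_tnth i)). Qed.

Lemma centered_sumE w : centered_sum Y w = coord_sum PY (Y w).
Proof.
apply: eq_bigr => i _; rewrite /centered_coord -componentE; congr (_ - _).
rewrite mean_distribution// expectation.unlock; rewrite -[RHS]/(fine (mean P _)%:E) -mean_EFin//.
  by congr fine; apply: eq_integral => x _; rewrite componentE.
by apply: (bmeas_comp (bclamp i)).
Qed.

Lemma sigma2E : n%:R * sigma2 Y = mean PY (fun y => coord_sum PY y ^+ 2).
Proof.
have bS := bmeas_coord_sum PY.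
have bSY : bmeas (fun w => coord_sum PY (Y w)) by apply: (bmeas_comp bS).
have E0 : ('E_P[centered_sum Y] = 0)%E.
  rewrite expectation.unlock (eq_integral (fun w => (coord_sum PY (Y w))%:E)) => [|w _]; last first.
    by rewrite centered_sumE.
  rewrite mean_EFin// -mean_distribution// mean_sum => [|i]; last exact: bmeas_centered_coord.
  by rewrite big1// => i _; exact: mean_centered_coord.
rewrite /sigma2 mulrA divff ?mul1r ?pnatr_eq0 -?lt0n ?(ltnW n_gt1)//.
rewrite /variance covariance.unlock E0 expectation.unlock mean_distribution; last exact: bmeasX.
rewrite -[RHS]/(fine (mean P _)%:E) -mean_EFin; last exact: (bmeasX 2 bSY).
congr fine; apply: eq_integral => w _; congr EFin.
by rewrite -[LHS]/((centered_sum Y w - 0) * (centered_sum Y w - 0)) subr0 centered_sumE expr2.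
Qed.

Lemma zetaE w : zeta Y w = coord_sum PY (Y w) / coord_sd PY.
Proof. by rewrite /zeta sigma2E centered_sumE mulrC. Qed.

Lemma standard_normal_cdf d' (T' : measurableType d') (Q : probability T' R)
  (Z : {RV Q >-> R}) z : standard_normal Z -> fine (Q [set w | Z w <= z]) = normal_cdf z.
Proof.
move=> hZ; have := hZ _ (measurable_itv `]-oo, z]); rewrite /normal_cdf => <-.
by congr (fine (Q _)); apply/seteqP; split=> w /=; rewrite in_itv.
Qed.

Lemma kolmogorov_bound d' (T' : measurableType d') (Q : probability T' R)
    (Z : {RV Q >-> R}) (b : R) : standard_normal Z ->
  (forall z, `|fine (PY [set y | coord_sum PY y / coord_sd PY <= z]) - normal_cdf z| <= b) ->
  `|kolmogorov_distance P Q (zeta Y) Z| <= b.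
Proof.
move=> hZ hb; rewrite /kolmogorov_distance; set S := (X in sup X).
have Sb : ubound S b.
  move=> _ [z _ <-]; rewrite (standard_normal_cdf _ hZ).
  rewrite (_ : P _ = PY [set y | coord_sum PY y / coord_sd PY <= z])//.
  by congr (P _); apply/seteqP; split=> w /=; rewrite zetaE.
(* Nonemptiness makes [sup] a genuine supremum, and an explicit element of S bounds it below by
   0. *)
have S0 : S !=set0 by eexists; exists 0.
rewrite ger0_norm; first exact: ge_sup.
have [s Ss] := S0; apply: (@le_trans _ _ s); first by case: Ss => z _ <-.
by apply: ub_le_sup => //; exists b.
Qed.

End kolmogorov_distance.

(** * Choice of the parameters as functions of N *)

Theorem theorem2p2 (R : realType) (beta gamma : R)
    (hbeta : 0 < beta) (hgamma : 0 <= gamma)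
    (d : nat -> measure_display) (T : forall N, measurableType (d N))
    (P : forall N, probability (T N) R)
    (Y : forall N, {RV (P N) >-> N.-tuple (measurableTypeR R)})
    (hcube : forall N, (0 < N)%N -> forall w, unit_cube (Y N w))
    (hdensity : forall N, (0 < N)%N ->
      has_density_on (Y N) (@unit_cube R N) (@gibbs_density R beta gamma N))
    (d' : measure_display) (T' : measurableType d') (Q : probability T' R)
    (Z : {RV Q >-> R}) (hZ : standard_normal Z)
    (eps : R) (heps : 0 < eps < 4^-1) :
  (fun N => kolmogorov_distance (P N) Q (zeta (Y N)) Z)
    =O_\oo (fun N => N%:R `^ (- 4^-1 + eps)).
Proof.
set rho := contraction_ratio (unit_uniform R) (@away_from0 R) (gibbs_kernel_bound beta gamma).
have rho01 : 0 <= rho < 1 by rewrite rho_lt1 rho_ge0.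
have [eps0 eps4] := andP heps.
(* The block length enters the error through k^2, so k may cost at most N^(eps / 2). *)
pose a := eps / 2; have a0 : 0 < a by rewrite divr_gt0.
have [C C0 blocks] := block_length_exists rho01 a0.
pose B : R := (normal_pdf 0 1 1)^-1.
have B0 : 0 < B by rewrite invr_gt0 normal_pdf01_gt0.
pose s0 : R := Num.sqrt (variance_rate beta gamma).
have s0_gt0 : 0 < s0 by rewrite sqrtr_gt0 variance_rate_gt0.
pose D := 4 * B / s0 + 25 * (B + 3) / s0 ^+ 3 + 2 * (4 / s0 ^+ 2 + 28 / s0 ^+ 2) + 1.
have D0 : 0 < D.
  have V m : 0 <= (s0 ^+ m)^-1 by rewrite invr_ge0 exprn_ge0// ltW.
  have V1 : 0 <= s0^-1 by rewrite invr_ge0 ltW.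
  have B3 : 0 <= B + 3 by rewrite addr_ge0// ltW.
  have B0' := ltW B0; apply: ltr_wpDl => //.
  by apply: addr_ge0; [apply: addr_ge0|]; apply: mulr_ge0 => //;
    [exact: mulr_ge0|exact: mulr_ge0|apply: addr_ge0; exact: mulr_ge0].
apply/eqO_exP; exists (D * C ^+ 2); first by rewrite mulr_gt0 ?exprn_gt0.
near=> N.
have N1 : (1 < N)%N by near: N; exact: nbhs_infty_gt.
have N0 : (0 < N)%N by exact: ltnW.
(* As a < 1/2, k is at most C sqrt(N), and this condition turns 8 C sqrt(N) into something below
   N. *)
have NC : (8 * C) ^+ 2 < N%:R by near: N; exact: nbhs_infty_gtr.
have Np : 0 < N%:R :> R by rewrite ltr0n.
have Nge1 : 1 <= N%:R :> R by rewrite (ler_nat _ 1).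
have [k [k0 kC rhok]] := blocks N N0.
have kN : (8 * k < N)%N.
  rewrite -(ltr_nat R) natrM; apply: (@le_lt_trans _ _ (8 * (C * Num.sqrt N%:R))).
    rewrite ler_pM2l//; apply: le_trans kC _; rewrite ler_pM2l// -(powR12_sqrt (ltW Np)).
    by rewrite ler_powR// /a; lra.
  have sN : 0 < Num.sqrt N%:R :> R by rewrite sqrtr_gt0.
  rewrite mulrA -[ltRHS](sqr_sqrtr (ltW Np)) expr2 ltr_pM2r//.
  by rewrite -[ltLHS]ger0_norm ?mulr_ge0 ?ltW// -sqrtr_sqr ltr_sqrt.
pose q : R := N%:R `^ 4^-1.
have q4 : N%:R = q ^+ 4.
  by rewrite -powR_mulrn ?powR_ge0// -powRrM mulVf ?pnatr_eq0// powRr1// ltW.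
have q1 : 1 <= q by have := ler_powR Nge1 (_ : 0 <= 4^-1); rewrite powRr0; apply; rewrite invr_ge0.
have q0 : 0 < q by lra.
have law := @gibbs_law R beta gamma hbeta hgamma N _ _ _ (Y N) (hdensity N N0).
have s_le : s0 * q ^+ 2 <= coord_sd (distribution (P N) (Y N)).
  have sq0 : 0 <= s0 * q ^+ 2 by rewrite mulr_ge0 ?sqr_ge0// ltW.
  rewrite -(ger0_norm sq0) -sqrtr_sqr ler_wsqrtr//.
  rewrite exprMn -exprM -q4 sqr_sqrtr ?(ltW (variance_rate_gt0 beta gamma))// mulrC.
  exact: (coord_sum_variance_ge hbeta hgamma N1 law).
have eta0 : 0 <= 4 * rho ^+ k by rewrite mulr_ge0// exprn_ge0//; case/andP: rho01.
apply: (@le_trans _ _ (D * k%:R ^+ 2 / q)); last first.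
  rewrite (ger0_norm (powR_ge0 _ _)).
  have -> : N%:R `^ (- 4^-1 + eps) = (N%:R `^ a) ^+ 2 / q.
    rewrite powRD ?(gt_eqF Np) ?implybT// mulrC powRN; congr (_ / _).
    by rewrite -powR_mulrn ?powR_ge0// -powRrM /a divfK.
  rewrite [leRHS]mulrA ler_pM2r ?invr_gt0// -[leRHS]mulrA ler_pM2l// -exprMn.
  by rewrite lerXn2r ?nnegrE// mulr_ge0 ?powR_ge0// ltW.
apply: (kolmogorov_bound (hcube N N0) N1 hZ) => z.
have Vq : 0 < q^-1 by rewrite invr_gt0.
apply: le_trans (stein_rate q4 q1 k0 (ltW B0) s0_gt0 s_le eta0 rhok).
have := gibbs_stein_bound hbeta hgamma N1 law kN z Vq.
by rewrite invrK.
Unshelve. all: by end_near. Qed.
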